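(* Assume the standing setup below and suppose the moment assumption (M) holds with numbers $w>4$ and $q\ge1$ such that $$\sum_{l=1}^\infty l\Big(\big(\phi(l)\big)^{1-\frac4w}+\big(\beta_q(l)\big)^{\kappa}\Big)<\infty .$$ Then, $P$-almost surely, $$\lim_{N\to\infty}\frac1N S_N=\bar F:=\int F(x_1,\dots,x_\ell)\,d\mu(x_1)\cdots d\mu(x_\ell).$$
   Context: Standing setup. Let $(\Omega,\mathcal F,P)$ be a probability space, $\wp\ge1$, and $\{\xi_n\}_{n\ge0}$ a sequence of $\mathbb R^\wp$-valued random vectors on it. Let $\{\mathcal F_{k,l}:-\infty\le k\le l\le\infty\}$ be sub-$\sigma$-algebras of $\mathcal F$ with $\mathcal F_{k,l}\subset\mathcal F_{k',l'}$ whenever $k'\le k$ and $l\le l'$. For sub-$\sigma$-algebras $\mathcal G,\mathcal H$ put $\phi(\mathcal G,\mathcal H)=\sup\{|P(\Gamma\cap\Delta)/P(\Gamma)-P(\Delta)|:\Gamma\in\mathcal G,\Delta\in\mathcal H,P(\Gamma)>0\}$ and $\phi(n)=\sup_{k\in\mathbb Z}\phi(\mathcal F_{-\infty,k},\mathcal F_{k+n,\infty})$. For $q\ge1$, $r\ge0$ put $\beta_q(r)=\sup_{k\ge0}\|\xi_k-\mathbb E[\xi_k\mid\mathcal F_{k-r,k+r}]\|_{L^q}$. Stationarity: every $\xi_n$ has the same distribution $\mu$, and the joint distribution of $(\xi_n,\xi_m)$ depends only on $m-n$. The function $F:(\mathbb R^\wp)^\ell\to\mathbb R$ satisfies, for some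 constants $K>0$, $\iota\ge0$, $\kappa\in(0,1]$ and all $x=(x_1,\dots,x_\ell)$, $z=(z_1,\dots,z_\ell)$: $|F(x)-F(z)|\le K[1+\sum_{i=1}^\ell(|x_i|^\iota+|z_i|^\iota)]\sum_{i=1}^\ell|x_i-z_i|^\kappa$ and $|F(x)|\le K[1+\sum_{i=1}^\ell|x_i|^\iota]$. Moment assumption (M): there are $w>4$, $q\ge1$, $v>0$ with $\frac1w>\frac{\iota}{v}+\frac{\kappa}{q}$ and $\|\xi_0\|_{L^v},\|\xi_0\|_{L^w},\|\xi_0\|_{L^q}<\infty$. Polynomials: $q_1,\dots,q_\ell$ are polynomials in two variables $(n,N)$ with nonnegative integer coefficients, none of which depends only on $N$; the degree of a bivariate polynomial $p(x,y)$ is the degree of $p(x,x)$; $\deg q_i\le\deg q_{i+1}$; for $i\ne j$ the difference $q_i-q_j$ is not constant; each linear $q_i$ has the form $q_i(n,N)=a_in+b_iN$ with integers $a_i,b_i$. Set $F_{n,N}=F(\xi_{q_1(n,N)},\dots,\xi_{q_\ell(n,N)})$ and $S_N=\sum_{n=1}^N F_{n,N}$. *)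

(* Defs.v *)
From HB Require Import structures.
From mathcomp Require Import all_boot all_order all_algebra.
From mathcomp Require Import all_classical all_reals all_analysis.
Set Implicit Arguments. Unset Strict Implicit. Unset Printing Implicit Defensive.
Import Order.TTheory GRing.Theory Num.Theory.
Import numFieldNormedType.Exports.
Local Open Scope classical_set_scope.
Local Open Scope ring_scope.

Section Defs.
Context {R : realType}.

Definition vnorm (p : nat) (x : p.-tuple R) : R :=
  Num.sqrt (\sum_(i < p) tnth x i ^+ 2).
Definition vdist (p : nat) (x z : p.-tuple R) : R :=
  Num.sqrt (\sum_(i < p) (tnth x i - tnth z i) ^+ 2).

Context {d : measure_display} {T : measurableType d}.

Definition G_measurable (G : set (set T)) (Y : T -> R) :=
  forall B : set R, measurable B -> G (Y @^-1` B).

Definition is_cond_exp (P : probability T R) (G : set (set T)) (X Y : T -> R) :=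
  [/\ G_measurable G Y, P.-integrable setT (EFin \o Y) &
      forall A, G A -> (\int[P]_(x in A) (Y x)%:E = \int[P]_(x in A) (X x)%:E)%E].

Definition is_vcond_exp (p : nat) (P : probability T R) (G : set (set T))
    (X Y : T -> p.-tuple R) :=
  forall i : 'I_p, is_cond_exp P G (fun w => tnth (X w) i) (fun w => tnth (Y w) i).

Definition phi_coef (P : probability T R) (G H : set (set T)) : R :=
  sup [set r | exists Ga De, [/\ G Ga, H De, (0 < P Ga)%E &
     r = `| fine (P (Ga `&` De)) / fine (P Ga) - fine (P De) |]].

Definition phi_mix (P : probability T R) (Fam : \bar int -> \bar int -> set (set T))
    (n : nat) : R :=
  sup [set phi_coef P (Fam -oo%E (k%:E)) (Fam ((k + n%:Z)%R%:E) +oo%E) | k in [set: int]].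

(* || xi_k - E[xi_k | F_{k-r,k+r}] ||_{L^q}; all versions of the conditional
   expectation give the same value, we take the infimum over versions *)
Definition cond_dev (p : nat) (P : probability T R) (Fam : \bar int -> \bar int -> set (set T))
    (xi : nat -> T -> p.-tuple R) (q : R) (k r : nat) : \bar R :=
  ereal_inf [set Lnorm P q%:E (fun w => (vdist (xi k w) (Y w))%:E) | Y in
     [set Y | is_vcond_exp P (Fam ((k%:Z - r%:Z)%R%:E) ((k%:Z + r%:Z)%R%:E)) (xi k) Y]].

Definition beta_q (p : nat) (P : probability T R) (Fam : \bar int -> \bar int -> set (set T))
    (xi : nat -> T -> p.-tuple R) (q : R) (r : nat) : \bar R :=
  ereal_sup [set cond_dev P Fam xi q k r | k in [set: nat]].

End Defs.

(* Bivariate polynomials with nonnegative integer coefficients: coefficient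
   table c a b of n^a N^b, supported in [0,D) x [0,D). *)
Definition bsupp (D : nat) (c : nat -> nat -> nat) :=
  forall a b, (D <= a)%N \/ (D <= b)%N -> c a b = 0%N.
Definition beval (D : nat) (c : nat -> nat -> nat) (n N : nat) : nat :=
  (\sum_(a < D) \sum_(b < D) c a b * n ^ a * N ^ b)%N.
Definition bdiag (D : nat) (c : nat -> nat -> nat) (k : nat) : nat :=
  (\sum_(a < D) \sum_(b < D | a + b == k) c a b)%N.
(* degree of the bivariate polynomial = degree of c(x,x) *)
Definition bdeg (D : nat) (c : nat -> nat -> nat) : nat :=
  (\max_(k < 2 * D | bdiag D c k != 0) k)%N.

Fixpoint iter_integral {R : realType} {dV : measure_display} {V : measurableType dV}
    (mu : {measure set V -> \bar R}) (l : nat) : (l.-tuple V -> R) -> R :=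
  match l with
  | 0 => fun f => f [tuple]
  | l'.+1 => fun f => \int[mu]_x iter_integral mu (fun t => f (cons_tuple x t))
  end.

(* Main.v *)
Require Import Defs.
From HB Require Import structures.
From mathcomp Require Import all_boot all_order all_algebra.
From mathcomp Require Import all_classical all_reals all_analysis.
From mathcomp Require Import measurable_realfun.
From mathcomp Require Import zify ring lra.
Set Implicit Arguments. Unset Strict Implicit. Unset Printing Implicit Defensive.
Import Order.TTheory GRing.Theory Num.Theory.
Import numFieldNormedType.Exports.
Local Open Scope ring_scope.

(** Integrating out the last variable writes [F] as a function of fewer variables
    plus a function [f] that is centered in its last variable, so by induction only
    centered [f] matter.  For these the sum [S_N] satisfies [E S_N^4 = O(N^2)], and
    [sum_N E (S_N/N)^4 < oo] forces [S_N/N -> 0] almost surely.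

    Fourth moment: a quadruple [(n_1,..,n_4)] contributes at most
    [C (phi r ^ (1-4/w) + beta r ^ kappa)] as soon as, for some [k], the time
    [q_l(n_k,N)] is at distance at least [3r] from all the other times involved: it
    can then be replaced by an independent copy, and the expectation vanishes.
    The quadruples that fail this at distance [m] are [O(N^2 m^2)], because for
    every [k] the value of [n_k] is then determined by the others, or by itself, up
    to [O(m)] choices; this is what the hypothesis on [sum_r r (..)] pays for.

    Decoupling: the product of four values of [f] is clipped at a level [B], the
    vectors [xi_t] are replaced by finitely valued vectors measurable for
    [F_{t-r,t+r}], for which the mixing bound is a finite sum; [B] is optimized
    last.  The errors of the clipping and of the approximation involve only the
    marginal laws, hence are the same for the decoupled vector. *)

(** * Counting close values of the polynomials *)

(** The isolated time need not be extremal: other times may lie on both sides of it. Decoupling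
    therefore keeps past and future jointly distributed and replaces only the block in the middle.
    The number [w] may be barely above 4. Working with the power [w/4] of the product would then
    leave no room for the Hölder error, because [kappa/q <= 1 - 4/w] can fail. The exponent [s] with
    [1/s = 4 (1/w - kappa/q)] is used instead: the strict inequality in (M) gives [iota/v < 1/(4s)],
    which is integrability of the [s]-th power of the product, while [1 - 1/s] is above [1 - 4/w]
    and large enough for the Hölder error. No monotonicity in [r] of the rate is used. A quadruple
    isolated up to rank [r0] is charged the average of the rates between [r0/2] and [r0]; the weight
    [1/r] of this average against the [r^2] of the count leaves the factor [r] of the hypothesis.
    Quantization has two uses: it makes the mixing bound a finite sum, and it yields the
    measurability of [F], which is known only through its Hölder bound. *)

Definition near_nat (m a b : nat) : bool := (a <= b + m)%N && (b <= a + m)%N.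

(** With nonnegative coefficients every monomial is monotone in [n], and one monomial with a
    positive power of [n] makes the sum strictly larger; [0 < N] keeps its factor [N ^ b] from
    vanishing. *)
Lemma beval_ltn D c N n n' : (0 < N)%N -> bsupp D c ->
  (exists a b, (0 < a)%N /\ c a b <> 0%N) ->
  (n < n')%N -> (beval D c n N < beval D c n' N)%N.
Proof.
move=> N0 sup [a [b [a0 cab]]] nn'.
have aD : (a < D)%N by rewrite ltnNge; apply/negP => h; apply: cab; apply: sup; left.
have bD : (b < D)%N by rewrite ltnNge; apply/negP => h; apply: cab; apply: sup; right.
have mono a' b' : (c a' b' * n ^ a' * N ^ b' <= c a' b' * n' ^ a' * N ^ b')%N.
  rewrite leq_mul2r leq_mul2l; apply/orP; right; apply/orP; right.
  by case: a' => // a'; rewrite leq_exp2r // ltnW.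
rewrite /beval (bigD1 (Ordinal aD)) //= [ltnRHS](bigD1 (Ordinal aD)) //=.
rewrite -addSn leq_add //; last by apply: leq_sum => i _; apply: leq_sum.
rewrite (bigD1 (Ordinal bD)) //= [ltnRHS](bigD1 (Ordinal bD)) //=.
rewrite -addSn leq_add //; last by apply: leq_sum.
by rewrite ltn_pmul2r ?expn_gt0 ?N0 // ltn_pmul2l ?ltn_exp2r //; lia.
Qed.

Lemma card_near_incr (N m t : nat) (f : nat -> nat) :
  (forall n n', (n < n')%N -> (f n < f n')%N) ->
  (#|[set n : 'I_N | near_nat m (f n) t]| <= 2 * m + 1)%N.
Proof.
move=> fincr.
have finj : injective f.
  move=> x y fxy; case: (ltngtP x y) => // /fincr; rewrite fxy ltnn //.
rewrite cardE -(size_map (fun n : 'I_N => f n)).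
(* Truncated subtraction is harmless: for [t < m] the list starts at 0 and ends at [2 * m], beyond
   [t + m]. *)
rewrite -[leqRHS](size_iota (t - m)).
apply: uniq_leq_size.
  rewrite map_inj_uniq ?enum_uniq // => x y /finj; exact: val_inj.
move=> x /mapP[n]; rewrite mem_enum inE => /andP[h1 h2] ->.
rewrite mem_iota; lia.
Qed.

Lemma absz_mulD_ge (u c : int) (N : nat) : u != 0 -> (N <= `|(u * N%:Z + c)%R| + `|c|)%N.
Proof.
move=> u0; have h : (N <= `|(u * N%:Z)%R|)%N by rewrite abszM leq_pmull // absz_gt0.
lia.
Qed.

(** Integrality replaces any estimate of the leading term: in [q * 'X + c] a nonzero value of [q] at
    [N] has modulus at least 1, so its product with [N] beats [c] as soon as [N] exceeds the modulus
    of [c]. *)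
Lemma int_poly_bound (G : {poly int}) : G != 0 ->
  exists N0, forall N, (N0 <= N)%N -> G.[N%:Z] != 0.
Proof.
elim/poly_ind: G => [|q c IH]; first by rewrite eqxx.
have [->|q0 _] := eqVneq q 0.
  rewrite mul0r add0r polyC_eq0 => c0; exists 0%N => N _; by rewrite hornerC.
have [N0 hN0] := IH q0.
exists (maxn N0 (`|c|%N).+1) => N; rewrite geq_max => /andP[/hN0 h1 h2].
rewrite !hornerE; apply: contraTneq (absz_mulD_ge c N h1) => ->; lia.
Qed.

Lemma int_poly_growth (G : {poly int}) k : (0 < k)%N -> G`_k != 0 ->
  exists C, forall N, (C <= N)%N -> (N <= `|G.[N%:Z]|%N + C)%N.
Proof.
elim/poly_ind: G => [|q c _]; first by rewrite coef0 eqxx.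
move=> k0; rewrite coefD coefMX coefC (gtn_eqF k0) addr0 => qk.
have q0 : q != 0 by apply: contraNneq qk => ->; rewrite coef0.
have [N0 hN0] := int_poly_bound q0.
exists (maxn N0 `|c|%N) => N; rewrite geq_max => /andP[/hN0 h1 h2].
rewrite !hornerE; apply: leq_trans (absz_mulD_ge c N h1) _; rewrite leq_add2l; lia.
Qed.

(** Each of the [2 * m + 1] values between [-m] and [m] is taken at no more than [d] points, by
    counting roots. The bound through [d] stays uniform when [Q] itself varies with [N]. *)
Lemma card_near_poly (Q : {poly int}) (k d N m : nat) :
  (0 < k)%N -> Q`_k != 0 -> (size Q <= d)%N ->
  (#|[set n : 'I_N | (`|Q.[n.+1%:Z]|%N <= m)%N]| <= d * (2 * m + 1))%N.
Proof.
move=> k0 Qk sQ.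
have d1 : (1 < d)%N.
  apply: leq_trans sQ; rewrite ltnNge; apply/negP => h.
  by move: Qk; rewrite nth_default ?eqxx // (leq_trans h).
pose A (e : 'I_(2 * m + 1)) := [set n : 'I_N | Q.[n.+1%:Z] == (e%:Z - m%:Z)].
have cA e : (#|A e| <= d)%N.
  pose Q' := Q - (e%:Z - m%:Z)%:P.
  have Q'0 : Q' != 0.
    apply: contraNneq Qk => /(congr1 (fun p : {poly int} => p`_k)).
    by rewrite coefB coefC (gtn_eqF k0) subr0 coef0 => ->.
  have sQ' : (size Q' <= d)%N.
    apply: (leq_trans (size_polyD _ _)); rewrite geq_max sQ /= size_polyN.
    by rewrite (leq_trans (size_polyC_leq1 _)) // ltnW.
  rewrite cardE -(size_map (fun n : 'I_N => n.+1%:Z)).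
  apply: leq_trans sQ'; apply: ltnW; apply: max_poly_roots => //.
    apply/allP => x /mapP[n]; rewrite mem_enum inE => /eqP h ->.
    by rewrite /root hornerD hornerN hornerC h subrr.
  by rewrite map_inj_uniq ?enum_uniq // => x y [] /val_inj.
apply: (@leq_trans #|\bigcup_e A e|).
  apply: subset_leq_card; apply/fintype.subsetP => n; rewrite inE => h.
  have [e he eQ] : exists2 e, (e < 2 * m + 1)%N & Q.[n.+1%:Z] = e%:Z - m%:Z :> int.
    by move: h; set x : int := Q.[_] => h; exists `|(x + m%:Z)%R|%N; lia.
  by apply/bigcupP; exists (Ordinal he) => //; rewrite inE /= eQ.
apply: (@leq_trans (\sum_(e < 2 * m + 1) #|A e|)).
  elim/big_rec2: _ => [|e x y _ h]; first by rewrite cards0.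
  by rewrite (leq_trans (leq_card_setU _ _)) // leq_add2l.
apply: (@leq_trans (\sum_(e < 2 * m + 1) d)); first by apply: leq_sum.
by rewrite sum_nat_const card_ord mulnC.
Qed.

(** The difference is a polynomial in [n] with coefficients polynomial in [N]. If a positive power
    of [n] survives, its coefficient is nonzero for large [N] and roots are counted. Otherwise the
    difference depends on [N] alone and grows at least like [N], so a single near pair forces
    [N <= m + C] and the trivial count [N] is good enough. *)
Lemma card_near_beval D c c' :
  bsupp D c -> bsupp D c' ->
  (exists a b, (0 < a + b)%N /\ c a b <> c' a b) ->
  exists C, forall N m, (C <= N)%N ->
   (#|[set n : 'I_N | near_nat m (beval D c n.+1 N) (beval D c' n.+1 N)]|
     <= C * m.+1)%N.
Proof.
move=> sc sc' [a [b [ab cab]]].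
have aD : (a < D)%N.
  by rewrite ltnNge; apply/negP => h; apply: cab; rewrite sc ?sc' //; left.
have bD : (b < D)%N.
  by rewrite ltnNge; apply/negP => h; apply: cab; rewrite sc ?sc' //; right.
pose G a' := \poly_(b' < D) ((c a' b')%:Z - (c' a' b')%:Z).
pose Q N := \poly_(a' < D) (G a').[N%:Z].
have QE n N : (beval D c n N)%:Z - (beval D c' n N)%:Z = (Q N).[n%:Z].
  rewrite horner_poly /beval -[X in X - _]natz -[X in _ - X]natz !natr_sum -sumrB.
  apply: eq_bigr => i _.
  rewrite horner_poly !natr_sum -sumrB mulr_suml; apply: eq_bigr => j _.
  by rewrite !natrM !natrX !natz; ring.
have [[a1 [b1 [a10 cab1]]]|all0] := pselect (exists a1 b1, (0 < a1)%N /\ c a1 b1 <> c' a1 b1).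
  have a1D : (a1 < D)%N.
    by rewrite ltnNge; apply/negP => h; apply: cab1; rewrite sc ?sc' //; left.
  have b1D : (b1 < D)%N.
    by rewrite ltnNge; apply/negP => h; apply: cab1; rewrite sc ?sc' //; right.
  have Ga0 : G a1 != 0.
    apply/eqP => /(congr1 (fun p : {poly int} => p`_b1)).
    by rewrite coef_poly b1D coef0; lia.
  have [N0 hN0] := int_poly_bound Ga0.
  exists (maxn N0 (2 * D)) => N m; rewrite geq_max => /andP[NN0 _].
  have := @card_near_poly (Q N) a1 D N m a10 _ (size_poly _ _).
  rewrite coef_poly a1D => /(_ (hN0 _ NN0)) h.
  apply: (@leq_trans (D * (2 * m + 1))); last by nia.
  apply: leq_trans h; apply: subset_leq_card; apply/fintype.subsetP => n.
  by rewrite !inE -QE /near_nat; lia.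
have a0 : a = 0%N.
  case: a ab cab {aD} => // a _ cab; exfalso; apply: all0; by exists a.+1, b.
subst a; have b0 : (0 < b)%N by [].
have Gb : (G 0%N)`_b != 0 by rewrite coef_poly bD; apply/eqP; lia.
have [C hC] := int_poly_growth b0 Gb.
exists C.+1 => N m NC.
case: (set_0Vmem [set n : 'I_N | near_nat m (beval D c n.+1 N) (beval D c' n.+1 N)])
  => [->|[n]]; first by rewrite cards0.
rewrite inE => hn.
apply: (leq_trans (max_card _)); rewrite card_ord.
have := hC N (ltnW NC); have : `|(G 0%N).[N%:Z]| <= m%:Z.
  have -> : (G 0%N).[N%:Z] = (Q N).[n.+1%:Z].
    rewrite [RHS]horner_poly (bigD1 (Ordinal aD)) //= big1 ?addr0 ?expr0 ?mulr1 //.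
    move=> i i0; rewrite (_ : G _ = 0) ?horner0 ?mul0r //; apply/polyP => j.
    rewrite coef_poly coef0; case: ifP => // _.
    apply/eqP; rewrite subr_eq0; apply/eqP; congr (_%:Z).
    apply: contrapT => h; apply: all0; exists i, j; split => //.
    by rewrite lt0n; move: i0; rewrite -val_eqE.
  by rewrite -QE; move: hn; rewrite /near_nat; lia.
by set x : int := horner _ _ => h1 h2; nia.
Qed.

Lemma sum_pred_card (J : finType) (Q : pred J) : (\sum_n Q n = #|[set n | Q n]|)%N.
Proof. by rewrite -sum1_card [RHS]big_mkcond /=; apply: eq_bigr => n _; rewrite inE; case: (Q n). Qed.

Lemma count_near_incr (N m t : nat) (f : nat -> nat) :
  (forall n n', (n < n')%N -> (f n < f n')%N) ->
  (\sum_(n < N) near_nat m (f n) t <= 2 * m + 1)%N.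
Proof. by rewrite (sum_pred_card (fun n : 'I_N => near_nat m (f n) t)); exact: card_near_incr. Qed.

Lemma count_near_beval D c c' :
  bsupp D c -> bsupp D c' ->
  (exists a b, (0 < a + b)%N /\ c a b <> c' a b) ->
  exists C, forall N m, (C <= N)%N ->
   (\sum_(n < N) near_nat m (beval D c n.+1 N) (beval D c' n.+1 N) <= C * m.+1)%N.
Proof.
move=> sc sc' cc'; have [C hC] := card_near_beval sc sc' cc'; exists C => N m CN.
rewrite (sum_pred_card (fun n : 'I_N => near_nat m (beval D c n.+1 N) (beval D c' n.+1 N))).
exact: hC.
Qed.

(** * Counting quadruples without an isolated entry *)

Definition quad (J : Type) (a b c d : J) : 'I_4 -> J := tnth [tuple a; b; c; d].

(** In the application [self n] compares the last polynomial at [n] with the other polynomials at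
    [n], and [close n n'] compares it with all polynomials at [n']; hence [close] is not
    symmetric. *)
Definition isolated (J : finType) (self : pred J) (close : rel J) (f : 'I_4 -> J) :=
  [exists k, ~~ self (f k) && [forall k', (k' != k) ==> ~~ close (f k) (f k')]].

Lemma sum_nat_cond_le (J : finType) (M : nat) (u : pred J) (F : J -> nat) (B : nat) :
  (\sum_a u a <= M)%N -> (forall a, u a -> F a <= B)%N -> (forall a, ~~ u a -> F a = 0)%N ->
  (\sum_a F a <= M * B)%N.
Proof.
move=> hu hF F0; apply: (@leq_trans (\sum_a u a * B)).
  by apply: leq_sum => a _; case: (boolP (u a)) => ua; rewrite ?mul1n ?hF ?F0.
by rewrite -big_distrl leq_mul2r hu orbT.
Qed.

(** Two entries are left free and the other two are constrained one after the other, which requires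
    an order without circular dependence. If [a] is constrained by itself, [c] or [d], then [b] is
    chosen last: [3 * M] times [4 * M] choices. Otherwise [a] is close to [b], and [c] is chosen
    last: [M] times [4 * M]. This gives 16, and 24 is a rounder bound. *)
Lemma count_nonisolated (J : finType) (self : pred J) (close : rel J) (M : nat) :
  (\sum_a self a <= M)%N -> (forall b, \sum_a close a b <= M)%N ->
  (\sum_a \sum_b \sum_c \sum_d ~~ isolated self close (quad a b c d)
    <= 24 * #|J| ^ 2 * M ^ 2)%N.
Proof.
move=> hs hc.
pose s4 x y z t := [|| self x, close x y, close x z | close x t].
pose s3 x z t := [|| self x, close x z | close x t].
have hs4 y z t : (\sum_x s4 x y z t <= 4 * M)%N.
  apply: (@leq_trans (\sum_x (self x + close x y + close x z + close x t))).
    by apply: leq_sum => x _; rewrite /s4; do 4 case: (X in X || _) => //; lia.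
  by rewrite !big_split /=; have := hc y; have := hc z; have := hc t; lia.
have hs3 z t : (\sum_x s3 x z t <= 3 * M)%N.
  apply: (@leq_trans (\sum_x (self x + close x z + close x t))).
    by apply: leq_sum => x _; rewrite /s3; do 3 case: (X in X || _) => //; lia.
  by rewrite !big_split /=; have := hc z; have := hc t; lia.
(* Only the failures of isolation at the first three entries are needed; the alternative comes from
   the one at [a]. *)
have hbad a b c d : (~~ isolated self close (quad a b c d) <=
     (s3 a c d && s4 b a c d) + (close a b && s4 c a b d))%N.
  case: (boolP (isolated _ _ _)) => //= /existsPn h.
  have h' k : self (quad a b c d k) || [exists k', (k' != k) && close (quad a b c d k) (quad a b c d k')].
    have := h k; rewrite negb_and negbK => /orP[->//|/forallPn[k']].
    rewrite negb_imply negbK => /andP[k'k cl]; apply/orP; right.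
    by apply/existsP; exists k'; rewrite k'k.
  have sa : s4 a b c d.
    have := h' 0; rewrite /s4 => /orP[->//|/existsP[[[|[|[|[|//]]]] i]]];
    by rewrite /quad !(tnth_nth a) /= => // ->; rewrite ?orbT.
  have sb : s4 b a c d.
    have := h' 1; rewrite /s4 => /orP[->//|/existsP[[[|[|[|[|//]]]] i]]];
    by rewrite /quad !(tnth_nth a) /= => // ->; rewrite ?orbT.
  have sc : s4 c a b d.
    have := h' (inord 2); rewrite /quad !(tnth_nth a) /= inordK //=.
    rewrite /s4 => /orP[->//|/existsP[[[|[|[|[|//]]]] i]]];
    rewrite !(tnth_nth a) /= -val_eqE /= inordK //= => // ->; by rewrite ?orbT.
  rewrite sb sc !andbT; move: sa; rewrite /s4 /s3.
  by case: (self a); case: (close a b); case: (close a c); case: (close a d).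
pose N := #|J|.
have S1 : (\sum_a \sum_b \sum_c \sum_d (s3 a c d && s4 b a c d) <= N * N * (3 * M * (4 * M)))%N.
  under eq_bigr do rewrite exchange_big.
  rewrite exchange_big /=.
  apply: (@leq_trans (\sum_(c in J) N * (3 * M * (4 * M)))); last first.
    by rewrite sum_nat_const mulnA.
  apply: leq_sum => c _.
  under eq_bigr do rewrite exchange_big.
  rewrite exchange_big /=.
  apply: (@leq_trans (\sum_(d in J) (3 * M * (4 * M)))); last by rewrite sum_nat_const.
  apply: leq_sum => d _.
  apply: (sum_nat_cond_le (hs3 c d)) => a; last by move=> /negbTE ->; rewrite big1.
  by move=> ->; exact: hs4.
have S2 : (\sum_a \sum_b \sum_c \sum_d (close a b && s4 c a b d) <= N * N * (M * (4 * M)))%N.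
  rewrite exchange_big /=.
  apply: (@leq_trans (\sum_(b in J) N * (M * (4 * M)))); last first.
    by rewrite sum_nat_const mulnA.
  apply: leq_sum => b _.
  under eq_bigr do rewrite exchange_big.
  rewrite exchange_big /=.
  apply: (@leq_trans (\sum_(d in J) (M * (4 * M)))); last by rewrite sum_nat_const.
  apply: leq_sum => d _.
  apply: (sum_nat_cond_le (hc b)) => a; last by move=> /negbTE ->; rewrite big1.
  by move=> ->; exact: hs4.
apply: (@leq_trans (N * N * (3 * M * (4 * M)) + N * N * (M * (4 * M)))); last first.
  by rewrite -/N; nia.
apply: leq_trans (leq_add S1 S2).
rewrite -big_split; apply: leq_sum => a _.
rewrite -big_split; apply: leq_sum => b _.
rewrite -big_split; apply: leq_sum => c _.
rewrite -big_split; apply: leq_sum => d _ /=; exact: hbad.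
Qed.

Section Window.
Variable R : realFieldType.

(* [iso] holds up to a finite rank [r0]; averaging [e <= eps r] over the window
   [r0/2 < r <= r0] makes each [r] responsible only for the elements that fail at [2r]. *)
Lemma window_bound (iso : nat -> bool) (m0 : nat) (e C0 : R) (eps : nat -> R) :
  (forall r, iso r.+1 -> iso r) -> (forall r, (m0 <= r)%N -> ~~ iso r) ->
  0 <= e -> e <= C0 -> (forall r, 0 <= eps r) ->
  (forall r, (0 < r)%N -> iso r -> e <= eps r) ->
  e <= C0 * (~~ iso 1%N)%:R + \sum_(1 <= r < m0) (2 / r%:R * eps r) * (~~ iso (2 * r)%N)%:R.
Proof.
move=> anti fin e0 eC0 eps0 he.
have sum0 (P : pred nat) : 0 <= \sum_(1 <= r < m0 | P r) (2 / r%:R * eps r) * (~~ iso (2 * r)%N)%:R.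
  by rewrite sumr_ge0 // => r _; rewrite !mulr_ge0 ?invr_ge0.
case: (boolP (iso 1%N)) => i1; last first.
  by rewrite mulr1 (le_trans eC0) // lerDl sum0.
rewrite mulr0 add0r.
have anti' r s : (r <= s)%N -> iso s -> iso r.
  by move=> /subnK <-; elim: (s - r)%N => // n IH; rewrite addSn => /anti.
have exP : exists r, iso r by exists 1%N.
have ub r : iso r -> (r <= m0)%N.
  by move=> ir; rewrite leqNgt; apply/negP => /ltnW /fin; rewrite ir.
case: (ex_maxnP exP ub) => r0 ir0 r0max.
have r01 : (0 < r0)%N by exact: r0max.
have r0m0 : (r0 < m0)%N by rewrite ltnNge; apply/negP => /fin; rewrite ir0.
(* The window contains [r0 - r0 %/ 2] ranks, at least [r / 2], whence the factor [2 / r]. For [r] in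
   it, [2 * r] exceeds the maximal rank [r0], so isolation fails there. *)
pose W r := (r0 < 2 * r)%N && (r <= r0)%N.
have -> : e = \sum_(1 <= r < m0 | W r) e / (r0 - r0 %/ 2)%:R.
  rewrite big_const_seq iter_addr_0.
  have -> : count W (index_iota 1 m0) = (r0 - r0 %/ 2)%N.
    rewrite -size_filter -[RHS](size_iota (r0 %/ 2).+1); apply/perm_size/uniq_perm.
    - by rewrite filter_uniq ?iota_uniq.
    - exact: iota_uniq.
    - by move=> r; rewrite mem_filter /W mem_index_iota mem_iota; lia.
  by rewrite -[RHS]mulr_natr -mulrA mulVf ?mulr1 // pnatr_eq0; lia.
rewrite big_mkcond /= big_nat [leRHS]big_nat; apply: ler_sum => r /andP[r1 rm].
case: ifP => [/andP[W1 W2]|_]; last by rewrite !mulr_ge0 ?invr_ge0.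
have -> : ~~ iso (2 * r)%N.
  by apply/negP => /r0max; rewrite leqNgt W1.
rewrite mulr1 mulrC; apply: ler_pM; [by rewrite invr_ge0|exact: e0| |].
- have r0' : (0 : R) < r%:R by rewrite ltr0n.
  rewrite ler_pdivlMr // mulrC ler_pdivrMr; last by rewrite ltr0n; lia.
  by rewrite -natrM ler_nat; lia.
- by apply: he => //; apply: anti' ir0.
Qed.

(** The bound [window_bound] summed over all quadruples. Rank 1 means distance 3, so [M = 4 * C] and
    the square gives 16. Rank [2 * r] means distance [6 * r], where [6 * r + 1 <= 7 * r]; the square
    49 and the weight [2 / r] give 98. The number [m0] guarantees that each quadruple has a largest
    rank of isolation. *)
Lemma quad_sum_bound (J : finType) (self : nat -> pred J) (close : nat -> rel J)
   (C m0 : nat) (e : ('I_4 -> J) -> R) (C0 S : R) (eps : nat -> R) :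
  (forall m a, self m a -> self m.+1 a) ->
  (forall m a b, close m a b -> close m.+1 a b) ->
  (forall m a b, (m0 <= m)%N -> close m a b) ->
  (forall m, \sum_a self m a <= C * m.+1)%N ->
  (forall m b, \sum_a close m a b <= C * m.+1)%N ->
  (forall f, 0 <= e f <= C0) -> (forall r, 0 <= eps r) ->
  (forall n, \sum_(1 <= r < n) r%:R * eps r <= S) ->
  (forall r f, (0 < r)%N -> isolated (self (3 * r)%N) (close (3 * r)%N) f -> e f <= eps r) ->
  \sum_a \sum_b \sum_c \sum_d e (quad a b c d) <=
    (24 * C ^ 2)%:R * (16 * C0 + 98 * S) * (#|J|%:R) ^+ 2.
Proof.
move=> smono cmono cfull hs hc he eps0 hS hiso.
pose iso f r := isolated (self (3 * r)%N) (close (3 * r)%N) f.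
have smono' m n a : self m a -> self (m + n)%N a.
  by move=> h; elim: n => [|n]; rewrite ?addn0 ?addnS //; exact: smono.
have cmono' m n a b : close m a b -> close (m + n)%N a b.
  by move=> h; elim: n => [|n]; rewrite ?addn0 ?addnS //; exact: cmono.
have iso_anti f r : iso f r.+1 -> iso f r.
  move=> /existsP[k /andP[h1 /forallP h2]]; apply/existsP; exists k.
  rewrite (_ : 3 * r.+1 = 3 * r + 3)%N in h1 h2; last by lia.
  apply/andP; split; first by apply: contra h1 => /smono'.
  apply/forallP => k'; apply/implyP => kk'.
  by have := h2 k'; rewrite kk' /=; apply: contra => /cmono'.
have iso_fin f r : (m0 <= r)%N -> ~~ iso f r.
  move=> mr; apply/existsPn => k; rewrite negb_and; apply/orP; right.
  have [k' k'k] : exists k' : 'I_4, k' != k.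
    by exists (if k == 0 then 1 else 0); case: (eqVneq k 0) => [->//|]; rewrite eq_sym.
  by apply/forallPn; exists k'; rewrite negb_imply negbK k'k cfull //; lia.
(* A point of [J] is needed to deduce [0 <= C0] from the bounds on [e]. *)
have [a0 _|J0] := pickP J; last first.
  have -> : #|J| = 0%N by apply: eq_card0 => a; have := J0 a.
  by rewrite expr0n mulr0 big1 // => a _; have := J0 a.
have bnd f : e f <= C0 * (~~ iso f 1%N)%:R
     + \sum_(1 <= r < m0) (2 / r%:R * eps r) * (~~ iso f (2 * r)%N)%:R.
  have /andP[e0 eC0] := he f.
  by apply: window_bound => // r; [exact: iso_anti|exact: iso_fin|move=> r0; exact: hiso].
pose cnt m := (\sum_a \sum_b \sum_c \sum_d ~~ iso (quad a b c d) m)%N.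
have cntE m : (cnt m)%:R = \sum_a \sum_b \sum_c \sum_d (~~ iso (quad a b c d) m)%:R :> R.
  by rewrite natr_sum; do 3 (apply: eq_bigr => ? _; rewrite natr_sum).
have hcnt m : (cnt m <= 24 * #|J| ^ 2 * (C * (3 * m).+1) ^ 2)%N.
  by apply: count_nonisolated => *; [exact: hs|exact: hc].
have C00 : 0 <= C0 by have /andP[] := he (fun=> a0); exact: le_trans.
have S0 : 0 <= S by have := hS 1%N; rewrite big_geq.
apply: (@le_trans _ _ (C0 * (cnt 1%N)%:R
     + \sum_(1 <= r < m0) (2 / r%:R * eps r) * (cnt (2 * r)%N)%:R)).
  rewrite cntE mulr_sumr; under [X in _ <= _ + X]eq_bigr do rewrite cntE mulr_sumr.
  rewrite [X in _ <= _ + X]exchange_big -big_split; apply: ler_sum => a _ /=.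
  rewrite mulr_sumr; under [X in _ <= _ + X]eq_bigr do rewrite mulr_sumr.
  rewrite [X in _ <= _ + X]exchange_big -big_split; apply: ler_sum => b _ /=.
  rewrite mulr_sumr; under [X in _ <= _ + X]eq_bigr do rewrite mulr_sumr.
  rewrite [X in _ <= _ + X]exchange_big -big_split; apply: ler_sum => c _ /=.
  rewrite mulr_sumr; under [X in _ <= _ + X]eq_bigr do rewrite mulr_sumr.
  rewrite [X in _ <= _ + X]exchange_big -big_split; apply: ler_sum => d _ /=.
  exact: bnd.
pose D := (24 * C ^ 2)%:R * (#|J|%:R) ^+ 2 : R.
have -> : (24 * C ^ 2)%:R * (16 * C0 + 98 * S) * #|J|%:R ^+ 2
   = C0 * (D * 16) + 98 * D * S by rewrite /D; ring.
have D0 : 0 <= D by rewrite mulr_ge0 ?exprn_ge0.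
apply: lerD.
  apply: ler_wpM2l => //; apply: (le_trans (y := (24 * #|J| ^ 2 * (C * (3 * 1).+1) ^ 2)%:R)).
    by rewrite ler_nat.
  by rewrite /D; rewrite le_eqVlt; apply/predU1P; left; rewrite !(natrM, natrX); ring.
apply: (@le_trans _ _ (98 * D * \sum_(1 <= r < m0) r%:R * eps r)); last first.
  by rewrite ler_wpM2l // mulr_ge0.
rewrite mulr_sumr big_nat [leRHS]big_nat; apply: ler_sum => r /andP[r1 _].
have r0 : (0 : R) < r%:R by rewrite ltr0n.
have -> : 98 * D * (r%:R * eps r) = (2 / r%:R * eps r) * (D * (49 * r%:R ^+ 2)).
  by field; rewrite lt0r_neq0.
apply: ler_wpM2l; first by rewrite !mulr_ge0 ?invr_ge0.
apply: (@le_trans _ _ (24 * #|J| ^ 2 * (C * (7 * r)) ^ 2)%:R).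
  rewrite ler_nat (leq_trans (hcnt _)) // leq_mul2l leq_exp2r // leq_mul2l.
  by apply/orP; right; apply/orP; right; lia.
by rewrite /D; rewrite le_eqVlt; apply/predU1P; left; rewrite !(natrM, natrX); ring.
Qed.
End Window.

Local Open Scope classical_set_scope.
Local Open Scope ring_scope.

(** * Norms, quantization and measurability *)

Section Reals.
Context {R : realType}.
Implicit Types (a b r s : R).

Lemma powR_add_le a b r : 0 <= a -> 0 <= b -> 0 <= r ->
  (a + b) `^ r <= 2 `^ r * (a `^ r + b `^ r).
Proof.
move=> a0 b0 r0.
wlog ab : a b a0 b0 / a <= b.
  by move=> H; have [/H|/ltW /H] := leP a b; [exact|rewrite addrC [X in _ <= _ * X]addrC; exact].
apply: (@le_trans _ _ ((2 * b) `^ r)).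
  by apply: ge0_ler_powR; rewrite ?nnegrE ?addr_ge0 ?mulr_ge0 // mulr_natl mulr2n lerD2r.
by rewrite powRM // ler_wpM2l ?powR_ge0 // lerDr powR_ge0.
Qed.

Lemma powR_le1D a r s : 0 <= a -> 0 <= r -> r <= s -> a `^ r <= 1 + a `^ s.
Proof.
move=> a0 r0 rs; have [a1|a1] := leP 1 a.
  by rewrite (le_trans (ler_powR a1 rs)) // lerDr.
rewrite (@le_trans _ _ 1) ?lerDl ?powR_ge0 //.
have <- : 1 `^ r = 1 :> R by rewrite powR1.
by rewrite ge0_ler_powR ?nnegrE // ltW.
Qed.

(** The sum is at most [#|I|.+1] times its largest term [M], and the power of [M] is itself one of
    the terms on the right. *)
Lemma powR_sum_le (I : finType) (y : I -> R) r : 0 <= r -> (forall i, 0 <= y i) ->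
  (1 + \sum_i y i) `^ r <= (#|I|.+1%:R) `^ r * (1 + \sum_i y i `^ r).
Proof.
move=> r0 y0.
pose M := \big[Num.max/1]_i y i.
have yM i : y i <= M by rewrite /M (bigD1 i) //= le_max lexx.
have M1 : 1 <= M by rewrite /M; elim/big_rec: _ => // i x _ h; rewrite le_max h orbT.
have -> : #|I|.+1%:R = 1 + \sum_(i : I) 1 :> R by rewrite sumr_const -natr1 addrC.
apply: (@le_trans _ _ (((1 + \sum_(i : I) 1) * M) `^ r)).
  apply: ge0_ler_powR; rewrite ?nnegrE ?addr_ge0 ?sumr_ge0 //.
    by rewrite mulr_ge0 ?addr_ge0 ?sumr_ge0 // (le_trans _ M1).
  by rewrite mulrDl mul1r mulr_suml lerD // ler_sum // => i _; rewrite mul1r.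
have M0 : 0 <= M by exact: le_trans M1.
rewrite powRM ?addr_ge0 ?sumr_ge0 // ler_wpM2l ?powR_ge0 //.
have [-> | [i ->]] : M = 1 \/ exists i, M = y i.
- rewrite /M; elim/big_rec: _ => [|i x _ [->|[j ->]]]; first by left.
    by have [] := leP (y i) 1; [left|right; exists i].
  by right; have [] := leP (y i) (y j); [exists j|exists i].
- by rewrite powR1 lerDl sumr_ge0 // => *; exact: powR_ge0.
- by rewrite (bigD1 i) //= addrCA lerDl addr_ge0 ?sumr_ge0 // => *; exact: powR_ge0.
Qed.

Lemma cvg_powR0 (u : nat -> R) r : 0 < r -> (forall n, 0 <= u n) ->
  u @ \oo --> 0 -> (fun n => u n `^ r) @ \oo --> 0.
Proof.
move=> r0 u0 /cvgr0Pnorm_lt cu; apply/cvgr0Pnorm_lt => e e0.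
have e'0 : 0 < e `^ r^-1 by exact: powR_gt0.
apply: filterS (cu _ e'0) => n; rewrite !ger0_norm ?powR_ge0 // => h.
have := @gt0_ltr_powR _ r r0 _ _ _ _ h; rewrite !nnegrE u0 powR_ge0 => /(_ isT isT).
by rewrite -powRrM mulVf ?lt0r_neq0 // powRr1 // ltW.
Qed.

(** The factor 2 replaces Minkowski's inequality: [(a + b)^2 <= 2 a^2 + 2 b^2] in each coordinate
    suffices, and constants are immaterial for all later uses. *)
Lemma sqrt_sum_le (I : finType) (u v w : I -> R) :
  (forall i, `|w i| <= `|u i| + `|v i|) ->
  Num.sqrt (\sum_i w i ^+ 2) <= 2 * (Num.sqrt (\sum_i u i ^+ 2) + Num.sqrt (\sum_i v i ^+ 2)).
Proof.
move=> h; set U := \sum_i u i ^+ 2; set V := \sum_i v i ^+ 2.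
have U0 : 0 <= U by rewrite sumr_ge0 // => *; exact: sqr_ge0.
have V0 : 0 <= V by rewrite sumr_ge0 // => *; exact: sqr_ge0.
rewrite -[leRHS]ger0_norm ?mulr_ge0 ?addr_ge0 ?sqrtr_ge0 // -sqrtr_sqr ler_wsqrtr //.
apply: (@le_trans _ _ (2 * U + 2 * V)).
  rewrite !mulr_sumr -big_split /=; apply: ler_sum => i _.
  have := h i; rewrite -[w i ^+ 2]real_normK ?num_real // -[u i ^+ 2]real_normK ?num_real //.
  rewrite -[v i ^+ 2]real_normK ?num_real // => hi.
  have : `|w i| ^+ 2 <= (`|u i| + `|v i|) ^+ 2 by rewrite ler_sqr ?nnegrE ?addr_ge0.
  by have := sqr_ge0 (`|u i| - `|v i|); rewrite !expr2; lra.
have eU := sqr_sqrtr U0; have eV := sqr_sqrtr V0; rewrite !expr2 in eU eV *.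
have : 0 <= Num.sqrt U * Num.sqrt V by rewrite mulr_ge0 ?sqrtr_ge0.
nra.
Qed.

End Reals.

Section Vectors.
Context {R : realType} {p : nat}.
Implicit Types x y z : p.-tuple R.

Lemma vnorm_ge0 x : 0 <= vnorm x. Proof. exact: sqrtr_ge0. Qed.
Lemma vdist_ge0 x y : 0 <= vdist x y. Proof. exact: sqrtr_ge0. Qed.

Lemma vdistxx x : vdist x x = 0.
Proof. by rewrite /vdist big1 ?sqrtr0 // => i _; rewrite subrr expr0n. Qed.

Lemma vnorm_le_vdist x z : vnorm z <= 2 * (vnorm x + vdist x z).
Proof.
apply: sqrt_sum_le => i; rewrite -[X in `|X|](subKr (tnth x i)).
exact: ler_normB.
Qed.

Lemma vdist_le_vnorm x z : vdist x z <= 2 * (vnorm x + vnorm z).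
Proof. by apply: sqrt_sum_le => i; exact: ler_normB. Qed.

Lemma vdist_triangle2 x y z : vdist x z <= 2 * (vdist x y + vdist y z).
Proof. by apply: sqrt_sum_le => i; exact: ler_distD. Qed.

Lemma vdist_le_sum x z : vdist x z <= \sum_i `|tnth x i - tnth z i|.
Proof.
have S0 : 0 <= \sum_(i < p) `|tnth x i - tnth z i| by rewrite sumr_ge0.
rewrite -[leRHS]ger0_norm // -sqrtr_sqr ler_wsqrtr //.
rewrite expr2 [leRHS]mulr_suml; apply: ler_sum => i _.
rewrite -[leLHS]real_normK ?num_real // expr2 ler_wpM2l //.
by rewrite (bigD1 i) //= lerDl sumr_ge0.
Qed.

Lemma vnorm_le x z : (forall i, `|tnth z i| <= `|tnth x i|) -> vnorm z <= vnorm x.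
Proof.
move=> h; rewrite ler_wsqrtr // ler_sum // => i _.
by rewrite -[leLHS]real_normK ?num_real // -[leRHS]real_normK ?num_real // ler_sqr ?nnegrE.
Qed.

End Vectors.

(* A real is encoded by its comparisons with a finite grid of mesh [1/(n+1)], a point
   of [R^p] by the codes of its coordinates. *)
Section Quantization.
Context {R : realType}.

Definition scode (n : nat) : finType :=
  ({ffun 'I_(n.+1 ^ 2) -> bool} * {ffun 'I_(n.+1 ^ 2) -> bool})%type.

Definition sencode n (y : R) : scode n :=
  ([ffun j : 'I_(n.+1 ^ 2) => j.+1%:R <= n.+1%:R * y],
   [ffun j : 'I_(n.+1 ^ 2) => j.+1%:R <= n.+1%:R * - y]).

(** The number of thresholds passed by [y >= 0] is the integer part of [(n+1) y], capped at
    [(n+1)^2]. Decoding thus rounds towards zero: it never increases the modulus and errs by at most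
    [1/(n+1)] while the modulus is at most [n+1]. *)
Definition sdecode n (c : scode n) : R :=
  (\sum_j (c.1 j)%:R - \sum_j (c.2 j)%:R) / n.+1%:R.

Let count_le n (y : R) : \sum_(j < n.+1 ^ 2) (nat_of_bool (j.+1%:R <= n.+1%:R * y)%R)%:R
  = (minn (n.+1 ^ 2) (Num.truncn (n.+1%:R * y)))%:R :> R.
Proof.
rewrite -natr_sum; congr (_%:R).
under eq_bigr do rewrite -truncn_gt_nat.
move: (Num.truncn _) (n.+1 ^ 2)%N => k m.
rewrite -(big_mkord xpredT (fun j => nat_of_bool (j < k)%N)).
elim: m => [|m IH]; first by rewrite big_geq // min0n.
by rewrite big_nat_recr //= IH; lia.
Qed.

Let sdecodeE n (y : R) : sdecode (sencode n y) =
  ((minn (n.+1 ^ 2) (Num.truncn (n.+1%:R * y)))%:R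
   - (minn (n.+1 ^ 2) (Num.truncn (n.+1%:R * - y)))%:R) / n.+1%:R.
Proof.
rewrite /sdecode -!count_le.
by congr ((_ - _) / _); apply: eq_bigr => j _; rewrite ffunE.
Qed.

Let truncn_neg (y : R) : y <= 0 -> Num.truncn y = 0%N.
Proof. by move=> y0; apply/truncn0Pn; rewrite -ltNge (le_lt_trans y0). Qed.

Let sdecodeN n (y : R) : sdecode (sencode n (- y)) = - sdecode (sencode n y).
Proof. by rewrite !sdecodeE opprK -mulNr opprB. Qed.

Lemma sdecode_le n (y : R) : `|sdecode (sencode n y)| <= `|y|.
Proof.
wlog y0 : y / 0 <= y.
  move=> H; have [/H//|/ltW y0] := leP 0 y.
  by rewrite -normrN -sdecodeN -[leRHS]normrN H // oppr_ge0.
have ny0 : 0 <= n.+1%:R * y by rewrite mulr_ge0.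
rewrite sdecodeE [X in _ - X%:R](_ : _ = 0%N); last first.
  by rewrite truncn_neg ?minn0 // mulrN oppr_le0.
rewrite subr0 ger0_norm ?divr_ge0 // ger0_norm // ler_pdivrMr // [leRHS]mulrC.
apply: (@le_trans _ _ (Num.truncn (n.+1%:R * y))%:R); last by have /andP[] := truncn_itv ny0.
by rewrite ler_nat geq_minr.
Qed.

Lemma sdecode_dist n (y : R) : `|y| <= n.+1%:R ->
  `|y - sdecode (sencode n y)| <= n.+1%:R^-1.
Proof.
wlog y0 : y / 0 <= y.
  move=> H; have [/H//|/ltW y0] := leP 0 y.
  by move=> h; rewrite -normrN opprD -sdecodeN H ?oppr_ge0 // normrN.
rewrite ger0_norm // => yn.
have ny0 : 0 <= n.+1%:R * y by rewrite mulr_ge0.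
rewrite sdecodeE [X in _ - X%:R](_ : _ = 0%N); last first.
  by rewrite truncn_neg ?minn0 // mulrN oppr_le0.
rewrite (minn_idPr _); last first.
  rewrite -(ler_nat R); apply: (@le_trans _ _ (n.+1%:R * y)); first by have /andP[] := truncn_itv ny0.
  by rewrite natrX expr2 ler_wpM2l.
have /andP[h1 h2] := truncn_itv ny0.
rewrite subr0; set k := Num.truncn _ in h1 h2 *.
have -> : y - k%:R / n.+1%:R = (n.+1%:R * y - k%:R) / n.+1%:R.
  by field.
rewrite normrM [X in _ * X]ger0_norm ?invr_ge0 // ler_piMl ?invr_ge0 //.
by rewrite ger0_norm ?subr_ge0 // lerBlDr addrC natr1 ltW.
Qed.

Lemma measurable_sencode n (c : scode n) : measurable [set y : R | sencode n y = c].
Proof.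
have mh (s : R) (j : nat) (b : bool) : measurable [set y : R | (j%:R <= n.+1%:R * (s * y)) = b].
  have mf : measurable_fun setT (fun y : R => j%:R <= n.+1%:R * (s * y)).
    by apply: measurable_fun_ler => //; do 2 apply: measurable_funM => //.
  by have := mf measurableT [set b] I; rewrite setTI; apply.
rewrite (_ : [set y | _] =
   \bigcap_(j in [set: 'I_(n.+1 ^ 2)]) [set y : R | (j.+1%:R <= n.+1%:R * (1 * y)) = c.1 j] `&`
   \bigcap_(j in [set: 'I_(n.+1 ^ 2)]) [set y : R | (j.+1%:R <= n.+1%:R * (-1 * y)) = c.2 j]).
  by apply: measurableI; apply: fin_bigcap_measurable => // j _; exact: mh.
apply/seteqP; split => y /=.
  by move=> <-; split => j _ /=; rewrite ffunE ?mul1r ?mulN1r.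
case: c => c1 c2 /= [h1 h2]; congr pair; apply/ffunP => j; rewrite ffunE.
  by have := h1 j I; rewrite /= mul1r.
by have := h2 j I; rewrite /= mulN1r.
Qed.

Definition vcode p n : finType := {ffun 'I_p -> scode n}.
Definition vencode p n (x : p.-tuple R) : vcode p n := [ffun i => sencode n (tnth x i)].
Definition vdecode p n (c : vcode p n) : p.-tuple R := [tuple sdecode (c i) | i < p].

Lemma tnth_vdecode p n (x : p.-tuple R) i :
  tnth (vdecode (vencode n x)) i = sdecode (sencode n (tnth x i)).
Proof. by rewrite tnth_mktuple ffunE. Qed.

Lemma vnorm_vdecode p n (x : p.-tuple R) : vnorm (vdecode (vencode n x)) <= vnorm x.
Proof. by apply: vnorm_le => i; rewrite tnth_vdecode sdecode_le. Qed.

Lemma cvg_vdecode p (x : p.-tuple R) : vdist x (vdecode (vencode n x)) @[n --> \oo] --> 0.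
Proof.
have cN : (p%:R * (n.+1%:R)^-1 : R) @[n --> \oo] --> 0.
  by rewrite -[X in _ --> X](mulr0 p%:R); apply: cvgMr; exact: cvg_harmonic.
apply: (@squeeze_cvgr _ _ _ _ (cst 0) (fun n => p%:R * (n.+1%:R)^-1)) => //; last exact: cvg_cst.
near=> n; rewrite vdist_ge0 /=.
apply: (le_trans (vdist_le_sum _ _)).
rewrite mulrC mulr_natr -[X in _ *+ X]card_ord -sumr_const; apply: ler_sum => i _.
rewrite tnth_vdecode sdecode_dist //.
apply: (@le_trans _ _ (\sum_i `|tnth x i|)); first by rewrite (bigD1 i) //= lerDl sumr_ge0.
apply: (@le_trans _ _ n%:R); last by rewrite ler_nat.
near: n; exact: nbhs_infty_ger.
Unshelve. all: by end_near.
Qed.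

End Quantization.

(** The axioms speak of complements and countable unions, so the intersection is written as the
    complement of a sequence of unions padded with empty sets. *)
Lemma sigma_algebra_fin_bigcap (T : Type) (G : set (set T)) (I : finType) (A : I -> set T) :
  sigma_algebra setT G -> (forall i, G (A i)) -> G (\bigcap_i A i).
Proof.
move=> [G0 GC GU] GA.
have GC' B : G B -> G (~` B) by move=> /GC; rewrite setTD.
rewrite -[X in G X]setCK; apply: (GC' _ _); rewrite setC_bigcap.
pose B n := if insub n is Some j then ~` A (enum_val (j : 'I_#|I|)) else set0.
rewrite (_ : \bigcup_(i in _) _ = \bigcup_n B n).
  apply: GU => n; rewrite /B; case: insubP => // j _ _; exact: GC'.
apply/seteqP; split => [x [i _ Aix]|x [n _]].
  by exists (enum_rank i) => //; rewrite /B valK enum_rankK.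
by rewrite /B; case: insubP => // j _ _ ?; exists (enum_val j).
Qed.

Section FiniteLabels.
Context {R : realType} d {T : measurableType d}.

(** Here [g] is arbitrary: preimages are finite unions of fibers of [lab]. This lets functions not
    yet known to be measurable act on quantized vectors. *)
Lemma measurable_finlabel (L : finType) d' (U : measurableType d') (lab : T -> L) (g : L -> U) :
  (forall a, measurable (lab @^-1` [set a])) -> measurable_fun setT (g \o lab).
Proof.
move=> mlab _ B mB; rewrite setTI.
rewrite (_ : _ @^-1` B = \bigcup_(a in [set a | B (g a)]) (lab @^-1` [set a])).
  exact: fin_bigcup_measurable.
by apply/seteqP; split => [x Bx|x [a Ba e]]; [exists (lab x)|rewrite /preimage /= e].
Qed.

Lemma ffun_fiber (I L : finType) (lab : I -> T -> L) (a : {ffun I -> L}) :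
  (fun x => [ffun i => lab i x]) @^-1` [set a] = \bigcap_i (lab i @^-1` [set a i]).
Proof.
apply/seteqP; split => [x /= <- i _ /=|x /= h]; first by rewrite ffunE.
by apply/ffunP => i; rewrite ffunE; exact: h.
Qed.

Lemma vencode_fiber p n (G : set (set T)) (Y : T -> p.-tuple R) (c : vcode p n) :
  sigma_algebra setT G -> (forall i, G_measurable G (fun x => tnth (Y x) i)) ->
  G ((fun x => vencode n (Y x)) @^-1` [set c]).
Proof.
move=> sG mY.
have -> : (fun x => vencode n (Y x)) @^-1` [set c] =
    \bigcap_i ((fun x => tnth (Y x) i) @^-1` [set y | sencode n y = c i]).
  apply/seteqP; split => [x /= <- i _ /=|x /= h]; first by rewrite ffunE.
  by apply/ffunP => i; rewrite ffunE; exact: h.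
by apply: sigma_algebra_fin_bigcap => // i; apply: mY; exact: measurable_sencode.
Qed.

Lemma measurable_G_measurable (Y : T -> R) : measurable_fun setT Y ->
  G_measurable (@measurable _ T) Y.
Proof. by move=> mY B mB; have := mY measurableT B mB; rewrite setTI. Qed.

Lemma measurable_vencode p n (Y : T -> p.-tuple R) (c : vcode p n) :
  measurable_fun setT Y -> measurable ((fun x => vencode n (Y x)) @^-1` [set c]).
Proof.
move=> mY; apply: vencode_fiber; first exact: sigma_algebra_measurable.
by move=> i; apply: measurable_G_measurable; move/measurable_fun_tnthP: mY; apply.
Qed.

Lemma measurable_vdist p (Y Z : T -> p.-tuple R) :
  measurable_fun setT Y -> measurable_fun setT Z ->
  measurable_fun setT (fun x => vdist (Y x) (Z x)).
Proof.
move=> /measurable_fun_tnthP mY /measurable_fun_tnthP mZ.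
apply: (@measurableT_comp _ _ _ _ _ _ (@Num.sqrt R)).
  by apply: continuous_measurable_fun; exact: sqrt_continuous.
by apply: measurable_sum => i; apply: measurable_funX; apply: measurable_funB;
  [exact: mY|exact: mZ].
Qed.

Lemma measurable_vnorm p (Y : T -> p.-tuple R) :
  measurable_fun setT Y -> measurable_fun setT (fun x => vnorm (Y x)).
Proof.
move=> /measurable_fun_tnthP mY.
apply: (@measurableT_comp _ _ _ _ _ _ (@Num.sqrt R)).
  by apply: continuous_measurable_fun; exact: sqrt_continuous.
by apply: measurable_sum => i; apply: measurable_funX; exact: mY.
Qed.

Lemma measurable_powR_comp (f : T -> R) r : measurable_fun setT f ->
  measurable_fun setT (fun x => f x `^ r).
Proof. by move=> mf; exact: (measurableT_comp (measurable_powR _) mf). Qed.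

End FiniteLabels.

Section Regular.
Context {R : realType}.

Definition regular (l p : nat) (F : l.-tuple (p.-tuple R) -> R) (K iota kappa : R) :=
  (forall x z : l.-tuple (p.-tuple R),
     `| F x - F z | <= K * (1 + \sum_(i < l) (vnorm (tnth x i) `^ iota + vnorm (tnth z i) `^ iota))
                         * \sum_(i < l) (vdist (tnth x i) (tnth z i)) `^ kappa) /\
  (forall x : l.-tuple (p.-tuple R),
     `| F x | <= K * (1 + \sum_(i < l) vnorm (tnth x i) `^ iota)).

(** [F] is the pointwise limit of its values at quantized arguments, which take finitely many
    values. The Hölder bound gives the limit, its weight staying bounded because quantization does
    not increase norms. *)
Lemma measurable_regular d (T : measurableType d) l p (F : l.-tuple (p.-tuple R) -> R)
    K iota kappa (Y : T -> l.-tuple (p.-tuple R)) :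
  0 <= K -> 0 <= iota -> 0 < kappa -> regular F K iota kappa ->
  measurable_fun setT Y -> measurable_fun setT (fun x => F (Y x)).
Proof.
move=> K0 iota0 kappa0 [hF _] mY.
have mYi i : measurable_fun setT (fun x => tnth (Y x) i).
  by move/measurable_fun_tnthP: mY; apply.
pose lab n x := [ffun i : 'I_l => vencode n (tnth (Y x) i)].
pose g n (c : {ffun 'I_l -> vcode p n}) := F [tuple @vdecode R p n (c i) | i < l].
apply: (@measurable_fun_cvg _ _ _ _ (fun n => g n \o lab n)).
  move=> n; apply: measurable_finlabel => a; rewrite ffun_fiber.
  by apply: fin_bigcap_measurable => // i _; exact: measurable_vencode.
move=> x _; apply/cvgrPdist_le => e e0.
pose A := K * (1 + \sum_(i < l) (vnorm (tnth (Y x) i) `^ iota + vnorm (tnth (Y x) i) `^ iota)).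
have A0 : 0 <= A.
  by rewrite mulr_ge0 // addr_ge0 // sumr_ge0 // => i _; rewrite addr_ge0 ?powR_ge0.
pose s n := \sum_(i < l) (vdist (tnth (Y x) i) (@vdecode R p n (vencode n (tnth (Y x) i)))) `^ kappa.
have cs : A * s n @[n --> \oo] --> 0.
  rewrite -[X in _ --> X](mulr0 A); apply: cvgMr.
  rewrite (_ : 0 = \sum_(i < l) 0 :> R); last by rewrite big1.
  apply: cvg_big => [|i _]; first exact: add_continuous.
  apply: cvg_powR0 => // [n|]; first exact: vdist_ge0.
  exact: cvg_vdecode.
move/cvgr0Pnorm_le: cs => /(_ e e0); apply: filterS => n h.
apply: le_trans h; apply: le_trans (ler_norm _).
apply: (le_trans (hF _ _)); rewrite /A /s.
under [X in _ * X <= _]eq_bigr do rewrite tnth_mktuple ffunE.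
rewrite ler_wpM2r ?sumr_ge0 // => [i _|]; first exact: powR_ge0.
rewrite ler_wpM2l // lerD2l ler_sum // => i _; rewrite lerD2l tnth_mktuple ffunE.
by rewrite ge0_ler_powR ?nnegrE ?vnorm_ge0 ?vnorm_vdecode.
Qed.
End Regular.

(** * Decoupling finitely valued functions under phi-mixing *)

Lemma sigma_algebra_fin_preimage (T : Type) (G : set (set T)) (L : finType) (W : T -> L)
    (S : pred L) :
  sigma_algebra setT G -> (forall b, G (W @^-1` [set b])) -> G [set x | S (W x)].
Proof.
move=> sG GW; have [G0 GC _] := sG.
have GT : G setT by rewrite -(setD0 setT); exact: GC.
rewrite (_ : [set _ | _] = \bigcap_b (if S b then setT else setT `\` (W @^-1` [set b]))).
  by apply: sigma_algebra_fin_bigcap => // b; case: ifP => // _; exact: GC.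
apply/seteqP; split => x /=.
  by move=> Sx b _; case: ifPn => // nSb; split => //= Wb; move: nSb; rewrite -Wb Sx.
by move=> /(_ (W x) I); case: ifP => //= _ [_]; case.
Qed.

Section FiniteProbability.
Context {R : realType} {d} {T : measurableType d} (P : probability T R).

Definition prb (A : set T) : R := fine (P A).

Lemma prb_fin A : measurable A -> (prb A)%:E = P A.
Proof. by move=> mA; rewrite /prb fineK // fin_num_measure. Qed.

Lemma prb_ge0 A : 0 <= prb A. Proof. exact: fine_ge0. Qed.

Lemma prb_le1 A : measurable A -> prb A <= 1.
Proof. by move=> mA; rewrite -lee_fin prb_fin // probability_le1. Qed.

Lemma prb_setT : prb setT = 1. Proof. by rewrite /prb probability_setT. Qed.

Lemma prb_le A B : measurable A -> measurable B -> A `<=` B -> prb A <= prb B.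
Proof. by move=> mA mB AB; rewrite -lee_fin !prb_fin // le_measure // inE. Qed.

Lemma integrable_bounded (f : T -> R) (B : R) : measurable_fun setT f ->
  (forall x, `|f x| <= B) -> P.-integrable setT (EFin \o f).
Proof.
move=> mf fB; apply: (@le_integrable _ _ _ _ _ _ _ (EFin \o cst B)) => //.
- exact/measurable_EFinP.
- by move=> x _; rewrite /= lee_fin (le_trans (fB x)) // ler_norm.
- exact: finite_measure_integrable_cst.
Qed.

Lemma Rintegral_sum (I : finType) (f : I -> T -> R) :
  (forall i, P.-integrable setT (EFin \o f i)) ->
  \int[P]_x (\sum_i f i x) = \sum_i \int[P]_x f i x.
Proof.
move=> intf; rewrite /Rintegral.
under eq_integral do rewrite -sumEFin.
rewrite integral_sum //.
rewrite -sum_fine // => i _.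
by apply: integrable_fin_num => //; exact: intf.
Qed.

Lemma Rintegral_indic A : measurable A -> \int[P]_x (\1_A x) = prb A.
Proof. by move=> mA; rewrite /Rintegral integral_indic // setIT. Qed.

Lemma integrable_indicT A : measurable A -> P.-integrable setT (EFin \o (\1_A : T -> R)).
Proof. by move=> mA; exact: integrable_indic. Qed.

Lemma Rintegral_finlabel (L : finType) (lab : T -> L) (g : L -> R) :
  (forall a, measurable (lab @^-1` [set a])) ->
  \int[P]_x g (lab x) = \sum_a g a * prb (lab @^-1` [set a]).
Proof.
move=> mlab.
transitivity (\int[P]_x (\sum_a g a * \1_(lab @^-1` [set a]) x)).
  apply: eq_Rintegral => x _; rewrite (bigD1 (lab x)) //= indicE mem_set // mulr1.
  rewrite big1 ?addr0 // => a al; rewrite indicE memNset ?mulr0 // => /= e.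
  by move: al; rewrite e eqxx.
rewrite Rintegral_sum => [|a]; last first.
  exact: (integrableZl measurableT (g a) (integrable_indicT (mlab a))).
apply: eq_bigr => a _; rewrite RintegralZl //; last exact: integrable_indicT.
by rewrite Rintegral_indic.
Qed.

Lemma prb_fin_additive (L : finType) (A : set T) (W : T -> L) (S : pred L) :
  measurable A -> (forall b, measurable (W @^-1` [set b])) ->
  prb (A `&` [set x | S (W x)]) = \sum_(b | S b) prb (A `&` W @^-1` [set b]).
Proof.
move=> mA mW.
have mAW b : measurable (A `&` W @^-1` [set b]) by exact: measurableI.
have mS : measurable [set x | S (W x)].
  by apply: sigma_algebra_fin_preimage => //; exact: sigma_algebra_measurable.
rewrite -Rintegral_indic; last exact: measurableI.
transitivity (\int[P]_x (\sum_b (S b)%:R * \1_(A `&` W @^-1` [set b]) x)).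
  apply: eq_Rintegral => x _; rewrite (bigD1 (W x)) //= !indicE !in_setI.
  rewrite big1 ?addr0 => [|b bW].
    have -> : (x \in W @^-1` [set W x]) = true by rewrite mem_set.
    rewrite andbT mulrC.
    rewrite -natrM mulnb; congr (_ && _)%:R.
    by apply/idP/idP => [/set_mem//|h]; apply/mem_set.
  rewrite indicE in_setI (memNset (A := W @^-1` [set b])) ?andbF ?mulr0 // => /= e.
  by move: bW; rewrite e eqxx.
rewrite Rintegral_sum => [|b]; last first.
  exact: (integrableZl measurableT (S b)%:R (integrable_indicT (mAW b))).
rewrite [RHS]big_mkcond; apply: eq_bigr => b _.
rewrite RintegralZl //; last exact: integrable_indicT.
by rewrite Rintegral_indic //; case: (S b); rewrite ?mul1r ?mul0r.
Qed.

Lemma prb_fin_total (L : finType) (A : set T) (W : T -> L) :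
  measurable A -> (forall b, measurable (W @^-1` [set b])) ->
  \sum_b prb (A `&` W @^-1` [set b]) = prb A.
Proof.
move=> mA mW; rewrite -(prb_fin_additive xpredT mA mW); congr prb.
by rewrite (_ : [set x | _] = setT) ?setIT //; apply/seteqP; split.
Qed.

Lemma prb_fin_total1 (L : finType) (W : T -> L) :
  (forall b, measurable (W @^-1` [set b])) -> \sum_b prb (W @^-1` [set b]) = 1.
Proof.
move=> mW; rewrite -[RHS]prb_setT -(prb_fin_total measurableT mW).
by apply: eq_bigr => b _; rewrite setTI.
Qed.

(** The inequality defining [phi_coef] multiplied by the probability of [A], so that null events are
    included. *)
Definition phi_dep (G H : set (set T)) (phi : R) :=
  forall A B, G A -> H B -> `|prb (A `&` B) - prb A * prb B| <= phi * prb A.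

(** For fixed [a] the values [b] are split by the sign of the difference. Each half is a single
    event of [H], so it costs [phi] times the probability of [U = a], whatever the number of labels;
    these probabilities add up to 1. *)
Lemma phi_decouple (L M : finType) (U : T -> L) (W : T -> M) (G H : set (set T)) (phi : R) :
  G `<=` measurable -> H `<=` measurable -> sigma_algebra setT H ->
  (forall a, G (U @^-1` [set a])) -> (forall b, H (W @^-1` [set b])) -> phi_dep G H phi ->
  \sum_a \sum_b `|prb (U @^-1` [set a] `&` W @^-1` [set b]) - prb (U @^-1` [set a]) * prb (W @^-1` [set b])|
   <= 2 * phi.
Proof.
move=> mG mH sH GU HW dep.
have mU a : measurable (U @^-1` [set a]) by exact: mG.
have mW b : measurable (W @^-1` [set b]) by exact: mH.
rewrite -[leRHS]mulr1 -[X in _ <= _ * X](prb_fin_total1 mU) mulr_sumr; apply: ler_sum => a _.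
set A := U @^-1` [set a]; have mA : measurable A by exact: mU.
pose D b := prb (A `&` W @^-1` [set b]) - prb A * prb (W @^-1` [set b]).
have DS (S : pred M) : `|\sum_(b | S b) D b| <= phi * prb A.
  rewrite sumrB -mulr_sumr -prb_fin_additive //.
  have -> : \sum_(b | S b) prb (W @^-1` [set b]) = prb [set x | S (W x)].
    rewrite -[X in _ = prb X]setTI prb_fin_additive //.
    by apply: eq_bigr => b _; rewrite setTI.
  by apply: dep; [exact: GU|exact: (sigma_algebra_fin_preimage S sH HW)].
rewrite (bigID (fun b => 0 <= D b)) /=.
have -> : \sum_(b | 0 <= D b) `|D b| = \sum_(b | 0 <= D b) D b.
  by apply: eq_bigr => b /ger0_norm.
have -> : \sum_(b | ~~ (0 <= D b)) `|D b| = - \sum_(b | ~~ (0 <= D b)) D b.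
  by rewrite -sumrN; apply: eq_bigr => b; rewrite -ltNge => /ltr0_norm.
have h1 := DS (fun b => 0 <= D b); have h2 := DS (fun b => ~~ (0 <= D b)).
rewrite -mulrA mulr_natl mulr2n lerD // (le_trans (ler_norm _)) //.
by rewrite normrN.
Qed.

(** [U] is the past, [X] the isolated block, [W] the future. The chain P(UXW), P(UX)P(W),
    P(U)P(X)P(W), P(X)P(UW) has three links, each costing [2 * phi]; the last one restores the joint
    law of past and future. *)
Lemma phi_decouple3 (L M N : finType) (U : T -> L) (X : T -> M) (W : T -> N)
    (G0 G1 H0 H1 : set (set T)) (phi : R) :
  G1 `<=` measurable -> H0 `<=` measurable -> H1 `<=` measurable ->
  sigma_algebra setT G1 -> sigma_algebra setT H0 -> sigma_algebra setT H1 -> G0 `<=` G1 ->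
  (forall a, G0 (U @^-1` [set a])) -> (forall a, G1 (X @^-1` [set a])) ->
  (forall a, H0 (X @^-1` [set a])) -> (forall a, H1 (W @^-1` [set a])) ->
  phi_dep G0 H0 phi -> phi_dep G1 H1 phi ->
  \sum_a \sum_b \sum_c
    `|prb (U @^-1` [set a] `&` X @^-1` [set b] `&` W @^-1` [set c])
      - prb (X @^-1` [set b]) * prb (U @^-1` [set a] `&` W @^-1` [set c])| <= 6 * phi.
Proof.
move=> mG1 mH0 mH1 sG1 sH0 sH1 G01 GU GX HX HW dep0 dep1.
have mG0 : G0 `<=` measurable by exact: (subset_trans G01 mG1).
have mU a : measurable (U @^-1` [set a]) by exact: mG0.
have mX b : measurable (X @^-1` [set b]) by exact: mH0.
have mW c : measurable (W @^-1` [set c]) by exact: mH1.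
pose pU a := prb (U @^-1` [set a]); pose pX b := prb (X @^-1` [set b]).
pose pW c := prb (W @^-1` [set c]).
pose pUX a b := prb (U @^-1` [set a] `&` X @^-1` [set b]).
pose pUW a c := prb (U @^-1` [set a] `&` W @^-1` [set c]).
pose p3 a b c := prb (U @^-1` [set a] `&` X @^-1` [set b] `&` W @^-1` [set c]).
have s1 : \sum_a \sum_b \sum_c `|p3 a b c - pUX a b * pW c| <= 2 * phi.
  have pre ab : (fun x => (U x, X x)) @^-1` [set ab] = U @^-1` [set ab.1] `&` X @^-1` [set ab.2].
    case: ab => a b; apply/seteqP; split => x; rewrite /preimage /= => -[ua xb] //.
    by rewrite ua xb.
  have GUX ab : G1 ((fun x => (U x, X x)) @^-1` [set ab]).
    rewrite pre; case: ab => a b /=.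
    rewrite (_ : _ `&` _ = \bigcap_(i : bool) if i then U @^-1` [set a] else X @^-1` [set b]).
      by apply: sigma_algebra_fin_bigcap => // -[]; [exact: (G01 _ (GU a))|exact: GX].
    apply/seteqP; split => [x [Ux Xx] [] _ //|x h].
    by split; [exact: (h true I)|exact: (h false I)].
  apply: le_trans (phi_decouple mG1 mH1 sH1 GUX HW dep1).
  by rewrite pair_bigA /=; apply: ler_sum => ab _; rewrite pre.
have s2 : \sum_a \sum_b `|pUX a b - pU a * pX b| <= 2 * phi.
  exact: (phi_decouple mG0 mH0 sH0 GU HX dep0).
have s3 : \sum_a \sum_c `|pUW a c - pU a * pW c| <= 2 * phi.
  apply: (phi_decouple mG0 mH1 sH1 GU HW) => A B GA HB; exact: dep1 (G01 _ GA) HB.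
have tW : \sum_c pW c = 1 by exact: prb_fin_total1.
have tX : \sum_b pX b = 1 by exact: prb_fin_total1.
have -> : 6 * phi = 2 * phi + (2 * phi + 2 * phi) by ring.
have s2' : \sum_a \sum_b \sum_c `|pUX a b * pW c - pU a * pX b * pW c| <= 2 * phi.
  apply: le_trans s2; apply: ler_sum => a _; apply: ler_sum => b _.
  under eq_bigr do rewrite -mulrBl normrM [X in _ * X]ger0_norm ?prb_ge0 //.
  by rewrite -mulr_sumr tW mulr1.
have s3' : \sum_a \sum_b \sum_c `|pU a * pX b * pW c - pX b * pUW a c| <= 2 * phi.
  apply: le_trans s3; apply: ler_sum => a _.
  rewrite exchange_big; apply: ler_sum => c _ /=.
  under eq_bigr do rewrite (mulrC (pU a)) -mulrA -mulrBr normrM ger0_norm ?prb_ge0 // distrC.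
  by rewrite -mulr_suml tX mul1r.
apply: le_trans (lerD s1 (lerD s2' s3')).
rewrite -!big_split; apply: ler_sum => a _; rewrite -!big_split; apply: ler_sum => b _.
rewrite -!big_split; apply: ler_sum => c _ /=.
apply: (le_trans (ler_distD (pUX a b * pW c) _ _)); rewrite lerD2l.
exact: ler_distD.
Qed.

End FiniteProbability.

Section ProductProbability.
Context {R : realType} {d1 d2} {T1 : measurableType d1} {T2 : measurableType d2}.
Variables (P1 : probability T1 R) (P2 : probability T2 R).

(** A named copy of the product measure, able to carry the probability structure. *)
Definition prodP : set (T1 * T2) -> \bar R := (P1 \x P2)%E.

HB.instance Definition _ := Measure.on prodP.

Lemma prodP_setT : prodP setT = 1%E.
Proof.
rewrite /prodP -setXTT product_measure1E // -[LHS]/(P1 setT * P2 setT)%E.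
by rewrite !probability_setT mule1.
Qed.

HB.instance Definition _ := @Measure_isProbability.Build _ _ R prodP prodP_setT.

Lemma prb_prodP (A : set T1) (B : set T2) : measurable A -> measurable B ->
  prb prodP (A `*` B) = prb P1 A * prb P2 B.
Proof.
move=> mA mB; rewrite -[LHS]/(fine ((P1 \x P2)%E (A `*` B))) product_measure1E //.
by rewrite fineM // fin_num_measure.
Qed.

End ProductProbability.

Section Mixing.
Context {R : realType} {d} {T : measurableType d} (P : probability T R).
Variable Fam : \bar int -> \bar int -> set (set T).
Hypothesis Fam_sigma : forall k m, (k <= m)%E ->
  sigma_algebra [set: T] (Fam k m) /\ Fam k m `<=` measurable.
Hypothesis Fam_mono : forall k m k' m', (k <= m)%E -> (k' <= k)%E -> (m <= m')%E ->
  Fam k m `<=` Fam k' m'.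

Section Coef.
Variables G H : set (set T).
Hypotheses (mG : G `<=` measurable) (mH : H `<=` measurable) (GT : G setT) (HT : H setT).

Let S := [set r | exists Ga De, [/\ G Ga, H De, (0 < P Ga)%E &
     r = `| fine (P (Ga `&` De)) / fine (P Ga) - fine (P De) |]].

(** A real [sup] is meaningful only for a nonempty bounded set; the comparisons with [phi_coef] and
    [phi_mix] rest on this bound. *)
Let S_le1 r : S r -> 0 <= r <= 1.
Proof.
move=> [A [B [GA HB PA ->]]]; rewrite normr_ge0 /=.
have [mA mB] := (mG GA, mH HB).
have A0 : 0 < prb P A by rewrite -lte_fin prb_fin.
rewrite -/(prb P (A `&` B)) -/(prb P A) -/(prb P B).
have h1 : 0 <= prb P (A `&` B) / prb P A <= 1.
  rewrite divr_ge0 ?prb_ge0 //= ler_pdivrMr // mul1r prb_le //; exact: measurableI.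
have h2 := prb_ge0 P B; have h3 := prb_le1 P mB.
by rewrite ler_norml; apply/andP; split; lra.
Qed.

Let S_ub : has_ubound S.
Proof. by exists 1 => r /S_le1 /andP[]. Qed.

Let S_ne : S !=set0.
Proof. by exists `|fine (P (setT `&` setT)) / fine (P setT) - fine (P setT)|, setT, setT; split; rewrite ?probability_setT. Qed.

Lemma phi_coef_bounds : 0 <= phi_coef P G H <= 1.
Proof.
apply/andP; split; last by apply: ge_sup => // r /S_le1 /andP[].
have [r Sr] := S_ne; have /andP[r0 _] := S_le1 Sr.
by apply: le_trans r0 _; exact: ub_le_sup.
Qed.

Lemma phi_coef_dep : phi_dep P G H (phi_coef P G H).
Proof.
move=> A B GA HB; have [mA mB] := (mG GA, mH HB).
have mAB : measurable (A `&` B) by exact: measurableI.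
(* A null event is excluded from the supremum, but for it the left side vanishes. *)
have [A0|A0] := eqVneq (prb P A) 0.
  have -> : prb P (A `&` B) = 0.
    apply/eqP; rewrite eq_le prb_ge0 andbT -A0; exact: prb_le.
  by rewrite A0 !(mul0r, mulr0) subrr normr0.
have A0' : 0 < prb P A by rewrite lt_neqAle eq_sym A0 prb_ge0.
have -> : prb P (A `&` B) - prb P A * prb P B =
  (prb P (A `&` B) / prb P A - prb P B) * prb P A by field.
rewrite normrM [X in _ * X <= _]ger0_norm ?prb_ge0 // ler_wpM2r ?prb_ge0 //.
apply: ub_le_sup => //; exists A, B; split => //.
by rewrite -prb_fin // lte_fin.
Qed.

End Coef.

Let FamT k m : (k <= m)%E -> Fam k m setT.
Proof. by move=> /Fam_sigma[[F0 FC _] _]; rewrite -(setD0 setT); exact: FC. Qed.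

Let Fam_meas k m : (k <= m)%E -> Fam k m `<=` measurable.
Proof. by move=> /Fam_sigma[]. Qed.

Let coef_bounds n (k : int) :
  0 <= phi_coef P (Fam -oo%E k%:E) (Fam ((k + n%:Z)%R%:E) +oo%E) <= 1.
Proof. by apply: phi_coef_bounds; [apply: Fam_meas|apply: Fam_meas|apply: FamT|apply: FamT]; rewrite ?leNye ?leey. Qed.

Let coef_ub n : has_ubound
  [set phi_coef P (Fam -oo%E (k%:E)) (Fam ((k + n%:Z)%R%:E) +oo%E) | k in [set: int]].
Proof. by exists 1 => _ [k _ <-]; have /andP[] := coef_bounds n k. Qed.

Lemma phi_mix_bounds n : 0 <= phi_mix P Fam n <= 1.
Proof.
apply/andP; split.
  have /andP[h _] := coef_bounds n 0; apply: (le_trans h).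
  by apply: ub_le_sup => //; exists 0.
apply: ge_sup; first by exists (phi_coef P (Fam -oo%E 0%:E) (Fam ((0 + n%:Z)%R%:E) +oo%E)), 0.
by move=> _ [k _ <-]; have /andP[] := coef_bounds n k.
Qed.

Lemma phi_mix_dep n (k : int) :
  phi_dep P (Fam -oo%E k%:E) (Fam ((k + n%:Z)%R%:E) +oo%E) (phi_mix P Fam n).
Proof.
move=> A B GA HB.
have mG : Fam -oo%E k%:E `<=` measurable by apply: Fam_meas; rewrite leNye.
have mH : Fam (k + n%:Z)%:E +oo%E `<=` measurable by apply: Fam_meas; rewrite leey.
apply: (le_trans (phi_coef_dep mG mH GA HB)); rewrite ler_wpM2r ?prb_ge0 //.
by apply: ub_le_sup => //; exists k.
Qed.

Let opt_fiber (L : finType) (G : set (set T)) (b : bool) (lab : T -> L) (c : option L) :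
  sigma_algebra setT G -> (b -> forall a, G (lab @^-1` [set a])) ->
  G ((fun x => if b then Some (lab x) else None) @^-1` [set c]).
Proof.
move=> [G0 GC _] Gl; have GT : G setT by rewrite -(setD0 setT); exact: GC.
case: b Gl => Gl; case: c => [a|].
- rewrite (_ : _ @^-1` _ = lab @^-1` [set a]); first exact: Gl.
  by apply/seteqP; split => x; rewrite /preimage /=; [case|move=> ->].
- by rewrite (_ : _ @^-1` _ = set0) //; apply/seteqP; split.
- by rewrite (_ : _ @^-1` _ = set0) //; apply/seteqP; split.
- by rewrite (_ : _ @^-1` _ = setT) //; apply/seteqP; split.
Qed.

Section Decoupling.
Variables (I L : finType) (i0 : I) (lab : I -> T -> L) (t : I -> nat) (r : nat).
Hypothesis Fam_lab : forall i a,
  Fam (((t i)%:Z - r%:Z)%R%:E) (((t i)%:Z + r%:Z)%R%:E) (lab i @^-1` [set a]).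
Hypothesis sep : forall i, i != i0 ->
  (t i + 3 * r <= t i0)%N || (t i0 + 3 * r <= t i)%N.

Let early i := (i != i0) && (t i + 3 * r <= t i0)%N.
Let late i := (i != i0) && ~~ early i.
Let U x : {ffun I -> option L} := [ffun i => if early i then Some (lab i x) else None].
Let W x : {ffun I -> option L} := [ffun i => if late i then Some (lab i x) else None].
Let X := lab i0.
(** Rebuilds the full labelling from past, isolated and future labels. On values actually taken by
    [U], [X], [W] the default [b] of [odflt] is never reached. *)
Let glue (a : {ffun I -> option L}) (b : L) (c : {ffun I -> option L}) : {ffun I -> L} :=
  [ffun i => if i == i0 then b else odflt b (if early i then a i else c i)].

(** Labels see a window of radius [r] around their time. A separation [3 * r] thus puts early
    windows before [t i0 - 2 r] and late ones after [t i0 + 2 r], leaving a gap [r] on either side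
    of the window of [t i0]. Integers are used because these bounds may be negative. *)
Let tn : int := (t i0)%:Z - (2 * r)%:Z.
Let G0 := Fam -oo%E tn%:E.
Let H0 := Fam ((tn + r%:Z)%R%:E) +oo%E.
Let G1 := Fam -oo%E ((t i0)%:Z + r%:Z)%R%:E.
Let H1 := Fam ((((t i0)%:Z + r%:Z) + r%:Z)%R%:E) +oo%E.

Let lab_in i (k m : \bar int) a : (k <= (((t i)%:Z - r%:Z)%R%:E))%E ->
  ((((t i)%:Z + r%:Z)%R%:E) <= m)%E -> Fam k m (lab i @^-1` [set a]).
Proof. by move=> h1 h2; apply: Fam_mono (Fam_lab i a); rewrite // lee_fin; lia. Qed.

(** Both integrals are sums of the same values of [G] against two families of weights, whose total
    difference is bounded by [phi_decouple3] independently of the number of labels. *)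
Lemma decouple_labels (G : {ffun I -> L} -> R) (B : R) : 0 <= B -> (forall f, `|G f| <= B) ->
  `| \int[P]_x G [ffun i => lab i x]
     - \int[prodP P P]_z G [ffun i => if i == i0 then lab i z.2 else lab i z.1] |
  <= 6 * phi_mix P Fam r * B.
Proof.
move=> B0 GB.
have sFam k m : (k <= m)%E -> sigma_algebra setT (Fam k m) by move=> /Fam_sigma[].
have sG0 : sigma_algebra setT G0 by apply: sFam; rewrite leNye.
have sG1 : sigma_algebra setT G1 by apply: sFam; rewrite leNye.
have sH0 : sigma_algebra setT H0 by apply: sFam; rewrite leey.
have sH1 : sigma_algebra setT H1 by apply: sFam; rewrite leey.
have GU a : G0 (U @^-1` [set a]).
  rewrite ffun_fiber; apply: sigma_algebra_fin_bigcap => // i.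
  apply: opt_fiber => // /andP[_ ei] b; apply: lab_in; rewrite ?leNye // lee_fin /tn; lia.
have HW a : H1 (W @^-1` [set a]).
  rewrite ffun_fiber; apply: sigma_algebra_fin_bigcap => // i.
  apply: opt_fiber => // /andP[ii0]; rewrite /early ii0 /= => nei b.
  have := sep ii0; rewrite (negbTE nei) /= => h.
  by apply: lab_in; rewrite ?leey // lee_fin; lia.
have GX b : G1 (X @^-1` [set b]) by apply: lab_in; rewrite ?leNye // lee_fin.
have HX b : H0 (X @^-1` [set b]) by apply: lab_in; rewrite ?leey // lee_fin /tn; lia.
have mG1 : G1 `<=` measurable by apply: Fam_meas; rewrite leNye.
have mG0 : G0 `<=` measurable by apply: Fam_meas; rewrite leNye.
have mH0 : H0 `<=` measurable by apply: Fam_meas; rewrite leey.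
have mH1 : H1 `<=` measurable by apply: Fam_meas; rewrite leey.
have G01 : G0 `<=` G1 by apply: Fam_mono; rewrite ?leNye // lee_fin /tn; lia.
have mU a : measurable (U @^-1` [set a]) by exact: mG0.
have mX b : measurable (X @^-1` [set b]) by exact: mH0.
have mW c : measurable (W @^-1` [set c]) by exact: mH1.
have key := phi_decouple3 mG1 mH0 mH1 sG1 sH0 sH1 G01 GU GX HX HW
  (@phi_mix_dep r tn) (@phi_mix_dep r _).
have e1 : \int[P]_x G [ffun i => lab i x] = \sum_a \sum_b \sum_c
    G (glue a b c) * prb P (U @^-1` [set a] `&` X @^-1` [set b] `&` W @^-1` [set c]).
  pose l3 x := (U x, X x, W x).
  have pre abc : l3 @^-1` [set abc] =
     U @^-1` [set abc.1.1] `&` X @^-1` [set abc.1.2] `&` W @^-1` [set abc.2].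
    case: abc => [[a b] c]; apply/seteqP; split => x; rewrite /preimage /l3 /=.
      by case.
    by case=> -[-> ->] ->.
  have ml3 abc : measurable (l3 @^-1` [set abc]) by rewrite pre; do 2 apply: measurableI => //.
  pose g (abc : {ffun I -> option L} * L * {ffun I -> option L}) :=
    G (glue abc.1.1 abc.1.2 abc.2).
  transitivity (\int[P]_x g (l3 x)).
    apply: eq_Rintegral => x _; congr G; apply/ffunP => i; rewrite !ffunE /=.
    have [->//|ii0] := eqVneq i i0.
    by rewrite /late ii0 /=; case: (early i).
  rewrite (Rintegral_finlabel _ g ml3).
  rewrite pair_bigA /= pair_bigA /=; apply: eq_bigr => -[[a b] c] _ /=.
  by rewrite pre.
have e2 : \int[prodP P P]_z G [ffun i => if i == i0 then lab i z.2 else lab i z.1] =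
   \sum_a \sum_b \sum_c
    G (glue a b c) * (prb P (X @^-1` [set b]) * prb P (U @^-1` [set a] `&` W @^-1` [set c])).
  pose l3 (z : T * T) := (U z.1, X z.2, W z.1).
  have pre abc : l3 @^-1` [set abc] =
     (U @^-1` [set abc.1.1] `&` W @^-1` [set abc.2]) `*` (X @^-1` [set abc.1.2]).
    case: abc => [[a b] c]; apply/seteqP; split => -[x y]; rewrite /preimage /l3 /=.
      by case.
    by case=> -[-> ->] ->.
  have mUW a c : measurable (U @^-1` [set a] `&` W @^-1` [set c]) by exact: measurableI.
  have ml3 abc : measurable (l3 @^-1` [set abc]) by rewrite pre; exact: measurableX.
  pose g (abc : {ffun I -> option L} * L * {ffun I -> option L}) :=
    G (glue abc.1.1 abc.1.2 abc.2).
  transitivity (\int[prodP P P]_z g (l3 z)).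
    apply: eq_Rintegral => z _; congr G; apply/ffunP => i; rewrite !ffunE /=.
    have [->//|ii0] := eqVneq i i0.
    by rewrite /late ii0 /=; case: (early i).
  rewrite (Rintegral_finlabel _ g ml3).
  rewrite pair_bigA /= pair_bigA /=; apply: eq_bigr => -[[a b] c] _ /=.
  by rewrite pre prb_prodP //= [X in _ = _ * X]mulrC.
rewrite e1 e2 mulrC; apply: le_trans (ler_wpM2l B0 key).
rewrite mulr_sumr -sumrB (le_trans (ler_norm_sum _ _ _)) // ler_sum // => a _.
rewrite mulr_sumr -sumrB (le_trans (ler_norm_sum _ _ _)) // ler_sum // => b _.
rewrite mulr_sumr -sumrB (le_trans (ler_norm_sum _ _ _)) // ler_sum // => c _.
by rewrite -mulrBr normrM ler_wpM2r.
Qed.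

End Decoupling.
End Mixing.

(** * Clipping and approximation *)

Lemma sum_le_card {R : realType} (I : finType) (f : I -> R) c :
  (forall i, f i <= c) -> \sum_i f i <= #|I|%:R * c.
Proof.
by move=> h; rewrite mulr_natl -sumr_const; apply: ler_sum => i _; exact: h.
Qed.

Section RealIntegrable.
Context {R : realType} {d} {T : measurableType d} (P : probability T R).
Implicit Types f g : T -> R.

Lemma integrable_realZ k f : P.-integrable setT (EFin \o f) ->
  P.-integrable setT (EFin \o (fun x => k * f x)).
Proof. exact: (integrableZl measurableT k). Qed.

Lemma integrable_realD f g : P.-integrable setT (EFin \o f) ->
  P.-integrable setT (EFin \o g) -> P.-integrable setT (EFin \o (fun x => f x + g x)).
Proof. exact: (integrableD measurableT). Qed.

Lemma integrable_real_cst (k : R) : P.-integrable setT (EFin \o (fun=> k)).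
Proof. exact: finite_measure_integrable_cst. Qed.

Lemma integrable_real_sum (I : finType) (f : I -> T -> R) :
  (forall i, P.-integrable setT (EFin \o f i)) ->
  P.-integrable setT (EFin \o (fun x => \sum_i f i x)).
Proof.
move=> h; rewrite (_ : EFin \o _ = fun x => (\sum_i (EFin \o f i) x)%E).
  by apply: integrable_sum => // i _; exact: h.
by apply/funext => x /=; rewrite sumEFin.
Qed.

Lemma Rintegral_prob1 : \int[P]_x (1 : R) = 1.
Proof. by rewrite Rintegral_cst // mul1r; exact: (prb_setT P). Qed.

Lemma dominated_Rintegral (f g : T -> R) : measurable_fun setT f ->
  P.-integrable setT (EFin \o g) -> (forall x, `|f x| <= g x) ->
  P.-integrable setT (EFin \o f) /\ `|\int[P]_x f x| <= \int[P]_x g x.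
Proof.
move=> mf ig fg.
have intf : P.-integrable setT (EFin \o f).
  apply: le_integrable ig => //; first exact/measurable_EFinP.
  by move=> x _ /=; rewrite lee_fin (le_trans (fg x)) // ler_norm.
split => //; apply: (le_trans (le_normr_Rintegral measurableT intf)).
by apply: le_Rintegral => //; exact: integrable_norm.
Qed.

End RealIntegrable.

Section Clip.
Context {R : realType}.
Implicit Types (B y z s t b : R).

Definition clip B y := Num.min (Num.max y (- B)) B.

Lemma clip_le B y : 0 <= B -> `|clip B y| <= B.
Proof.
move=> B0; rewrite /clip ler_norml; have NB : - B <= B by lra.
by rewrite le_min NB !ge_min !le_max !lexx ?orbT.
Qed.

Lemma clip_lip B y z : `|clip B y - clip B z| <= `|y - z|.
Proof.
rewrite /clip ler_norml; have := ler_norm (y - z); have := ler_norm (z - y).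
rewrite (distrC z y) => h1 h2.
by case: (leP y (- B)) => ?; case: (leP z (- B)) => ?; rewrite ?minEle; repeat case: ifP => ?;
  apply/andP; split; lra.
Qed.

Lemma clip_id B y : `|y| <= B -> clip B y = y.
Proof. by rewrite ler_norml => /andP[h1 h2]; rewrite /clip (max_idPl h1) (min_idPl h2). Qed.

(** Where clipping acts, the modulus of [y] exceeds [B], so it may be multiplied by the power
    [s - 1] of its ratio to [B]. *)
Lemma clip_tail B y s : 0 < B -> 1 <= s -> `|y - clip B y| <= B `^ (1 - s) * `|y| `^ s.
Proof.
move=> B0 s1; have [yB|By] := leP `|y| B.
  by rewrite clip_id // subrr normr0 mulr_ge0 ?powR_ge0.
have y0 : 0 < `|y| by exact: lt_trans By.
have -> : B `^ (1 - s) * `|y| `^ s = `|y| * (B `^ (1 - s) * `|y| `^ (s - 1)).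
  by rewrite [RHS]mulrCA mulr_powRB1 // (lt_le_trans ltr01).
apply: (@le_trans _ _ `|y|).
  rewrite /clip ler_norml; have h1 := ler_norm y.
  have h2 : - y <= `|y| by rewrite -normrN ler_norm.
  by case: (leP y (- B)) => ?; [case: (leP (- B) B)|case: (leP y B)] => ?; apply/andP; split; lra.
rewrite ler_peMr // -(opprB s) powRN mulrC ler_pdivlMr ?powR_gt0 // mul1r.
by rewrite ge0_ler_powR ?nnegrE ?subr_ge0 // ltW.
Qed.

(** Young's inequality for [u] and [(t/b)^kappa] with conjugate exponents [s] and [s/(s-1)], the
    product being at most the larger of the two powers. As [kappa s/(s-1) <= q], the second power is
    at most [1 + (t/b)^q]. *)
Lemma young_scaled s kappa q (u t b : R) : 1 < s -> 0 <= kappa -> kappa * s <= q * (s - 1) ->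
  0 <= u -> 0 <= t -> 0 < b ->
  u * t `^ kappa <= b `^ kappa * (u `^ s + 1 + t `^ q / b `^ q).
Proof.
move=> s1 k0 kq u0 t0 b0.
have s10 : 0 < s - 1 by rewrite subr_gt0.
have tb0 : 0 <= t / b by rewrite divr_ge0 // ltW.
pose y := (t / b) `^ kappa.
have tE : t `^ kappa = b `^ kappa * y.
  by rewrite /y -powRM ?(ltW b0) // mulrCA divff ?mulr1 // gt_eqF.
have y0 : 0 <= y by exact: powR_ge0.
have ys : y `^ (s / (s - 1)) <= 1 + t `^ q / b `^ q.
  have -> : t `^ q / b `^ q = (t / b) `^ q.
    rewrite powRM ?invr_ge0 ?(ltW b0) //; congr (_ * _).
    by rewrite -[in RHS]powR_inv1 ?(ltW b0) // -powRrM mulN1r powRN.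
  rewrite /y -powRrM; apply: powR_le1D => //.
    by rewrite mulr_ge0 // divr_ge0 // ltW // (lt_trans ltr01).
  by rewrite mulrA ler_pdivrMr.
rewrite tE mulrCA ler_wpM2l ?powR_ge0 // -addrA.
have [uy|yu] := leP y (u `^ (s - 1)).
  apply: (@le_trans _ _ (u `^ s)).
    by rewrite -(@mulr_powRB1 _ u s) ?ler_wpM2l // (lt_trans ltr01).
  by rewrite lerDl (le_trans _ ys) // powR_ge0.
apply: (@le_trans _ _ (y `^ (s / (s - 1)))); last first.
  by rewrite (le_trans ys) // lerDr powR_ge0.
have uy : u <= y `^ (s - 1)^-1.
  have -> : u = (u `^ (s - 1)) `^ (s - 1)^-1.
    by rewrite -powRrM divff ?gt_eqF // powRr1.
  by rewrite ge0_ler_powR ?nnegrE ?powR_ge0 ?invr_ge0 // ltW.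
have [y00|yn0] := eqVneq y 0; first by rewrite y00 mulr0 powR_ge0.
apply: (@le_trans _ _ (y `^ (s - 1)^-1 * y)); first by rewrite ler_wpM2r.
rewrite -{2}(powRr1 y0) -powRD ?yn0 ?implybT //.
by rewrite (_ : _ + 1 = s / (s - 1)) //; field; rewrite gt_eqF.
Qed.

End Clip.

Section Approximation.
Context {R : realType} {p : nat} {I : finType}.
Local Notation V := (p.-tuple R).
Variables (H : (I -> V) -> R) (C iota kappa q s v : R).
Hypotheses (C0 : 0 <= C) (iota0 : 0 <= iota) (kappa0 : 0 < kappa) (q0 : 0 < q) (s1 : 1 < s).
Hypotheses (vs : 4 * iota * s <= v) (qs : kappa * s <= q * (s - 1)).

Definition weight (x : I -> V) : R := 1 + \sum_i vnorm (x i) `^ iota.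

Hypothesis H_growth : forall x, `|H x| <= C * weight x ^+ 4.
Hypothesis H_holder : forall x z, (forall i, vdist (x i) (z i) <= 1) ->
  `|H x - H z| <= C * weight x ^+ 4 * \sum_i vdist (x i) (z i) `^ kappa.

Let M : R := #|I|.+1%:R `^ (4 * s).
Definition envelope (x : I -> V) : R := M * (1 + \sum_i (1 + vnorm (x i) `^ v)).

Lemma weight_ge1 x : 1 <= weight x.
Proof. by rewrite lerDl sumr_ge0 // => i _; exact: powR_ge0. Qed.

Let s0 : 0 < s. Proof. exact: lt_trans s1. Qed.

Let weight_powR x r : 0 <= r -> (weight x ^+ 4) `^ r = weight x `^ (4 * r).
Proof.
by move=> r0; rewrite -powR_mulrn ?(le_trans ler01 (weight_ge1 x)) // -powRrM.
Qed.

(** The product of four factors grows like [weight ^+ 4], so its [s]-th power needs moments of order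
    [4 * iota * s]; these are covered by the order [v]. *)
Lemma weight_envelope x : (weight x ^+ 4) `^ s <= envelope x.
Proof.
rewrite weight_powR ?(ltW s0) //.
have s40 : 0 <= 4 * s by rewrite mulr_ge0 ?(ltW s0).
have y0 i : 0 <= vnorm (x i) `^ iota by exact: powR_ge0.
apply: (le_trans (powR_sum_le s40 y0)).
rewrite ler_wpM2l ?powR_ge0 // lerD2l ler_sum // => i _.
rewrite -powRrM powR_le1D ?vnorm_ge0 ?mulr_ge0 ?(ltW s0) //.
by rewrite mulrA (mulrC iota).
Qed.

Lemma weight4_envelope x : weight x ^+ 4 <= envelope x.
Proof.
apply: le_trans (weight_envelope x).
have w1 : 1 <= weight x ^+ 4 by rewrite exprn_ege1 // weight_ge1.
by rewrite le1r_powR // ltW.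
Qed.

Lemma envelope_ge0 x : 0 <= envelope x.
Proof. by apply: le_trans (weight4_envelope x); rewrite exprn_ge0 // (le_trans ler01 (weight_ge1 x)). Qed.

(** If all distances are at most 1, the Hölder bound and [young_scaled] apply; otherwise the clipped
    values differ by at most [2 * B], which one distance to the power [q] absorbs. Only norms of [x]
    occur on the right: the approximants substituted for [z] are controlled in [q]-distance, not in
    their moments of order [v]. *)
Lemma clip_holder B b x z : 0 <= B -> 0 < b ->
  `|clip B (H x) - clip B (H z)| <=
    \sum_i (C * b `^ kappa * (envelope x + 1) +
            (C * b `^ kappa / b `^ q + 2 * B) * vdist (x i) (z i) `^ q).
Proof.
move=> B0 b0.
have bq0 : 0 < b `^ q by exact: powR_gt0.
have term i : C * (weight x ^+ 4 * vdist (x i) (z i) `^ kappa)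
   <= C * b `^ kappa * (envelope x + 1) + C * b `^ kappa / b `^ q * vdist (x i) (z i) `^ q.
  have w0 : 0 <= weight x ^+ 4 by rewrite exprn_ge0 // (le_trans ler01 (weight_ge1 x)).
  have h := young_scaled s1 (ltW kappa0) qs w0 (vdist_ge0 (x i) (z i)) b0.
  apply: (le_trans (ler_wpM2l C0 h)).
  have -> : C * b `^ kappa * (envelope x + 1) + C * b `^ kappa / b `^ q * vdist (x i) (z i) `^ q
    = C * (b `^ kappa * (envelope x + 1 + vdist (x i) (z i) `^ q / b `^ q)) by ring.
  by rewrite ler_wpM2l // ler_wpM2l ?powR_ge0 // lerD2r lerD2r weight_envelope.
have [/forallP small|] := boolP [forall i, vdist (x i) (z i) <= 1].
  apply: (le_trans (clip_lip _ _ _)); apply: (le_trans (H_holder _)) => //.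
  rewrite -mulrA !mulr_sumr; apply: ler_sum => i _.
  apply: (le_trans (term i)); rewrite lerD2l ler_wpM2r ?powR_ge0 // lerDl.
  by rewrite mulr_ge0.
move=> /forallPn[i]; rewrite -ltNge => ti.
apply: (@le_trans _ _ (2 * B)).
  apply: (le_trans (ler_normB _ _)).
  by rewrite mulr_natl mulr2n lerD // clip_le.
have c10 : 0 <= C * b `^ kappa by rewrite mulr_ge0 ?powR_ge0.
have c20 : 0 <= C * b `^ kappa / b `^ q + 2 * B by rewrite addr_ge0 ?divr_ge0 ?mulr_ge0 ?powR_ge0.
have big0 j : 0 <= C * b `^ kappa * (envelope x + 1) +
            (C * b `^ kappa / b `^ q + 2 * B) * vdist (x j) (z j) `^ q.
  have e0 := envelope_ge0 x.
  by apply: addr_ge0; apply: mulr_ge0 => //; [exact: addr_ge0|exact: powR_ge0].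
rewrite (bigD1 i) //=; apply: (@le_trans _ _ ((C * b `^ kappa / b `^ q + 2 * B) * vdist (x i) (z i) `^ q)).
  apply: (@le_trans _ _ ((2 * B) * 1)); first by rewrite mulr1.
  rewrite ler_pM ?mulr_ge0 //.
    by rewrite lerDr divr_ge0 // powR_ge0.
  by rewrite -(powRr0 (vdist (x i) (z i))) ler_powR // ltW.
rewrite -addrA addrCA lerDl addr_ge0 ?sumr_ge0 //.
by have e0 := envelope_ge0 x; apply: mulr_ge0 => //; exact: addr_ge0.
Qed.

Lemma clip_tail_envelope B x : 0 < B ->
  `|H x - clip B (H x)| <= B `^ (1 - s) * (C `^ s * envelope x).
Proof.
move=> B0; apply: (le_trans (clip_tail _ B0 (ltW s1))).
have w0 : 0 <= weight x ^+ 4 by rewrite exprn_ge0 // (le_trans ler01 (weight_ge1 x)).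
rewrite ler_wpM2l ?powR_ge0 //; apply: (@le_trans _ _ ((C * weight x ^+ 4) `^ s)).
  have Cw0 : 0 <= C * weight x ^+ 4 by exact: mulr_ge0.
  by have := @ge0_ler_powR R s (ltW s0) _ _ (normr_ge0 (H x)) Cw0 (H_growth x).
by rewrite powRM // ler_wpM2l ?powR_ge0 // weight_envelope.
Qed.

Variable Mv : R.
Hypothesis Mv0 : 0 <= Mv.
Let E0 : R := M * (1 + #|I|%:R * (1 + Mv)).

Section Space.
Context {d} {T : measurableType d} (P : probability T R).
Variable zeta : I -> T -> V.
Hypothesis zeta_meas : forall i, measurable_fun setT (zeta i).
Hypothesis zeta_int : forall i, P.-integrable setT (EFin \o (fun x => vnorm (zeta i x) `^ v)).
Hypothesis zeta_mom : forall i, \int[P]_x vnorm (zeta i x) `^ v <= Mv.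
Hypothesis H_meas : measurable_fun setT (fun x => H (fun i => zeta i x)).

Let int_vn i : P.-integrable setT (EFin \o (fun x => 1 + vnorm (zeta i x) `^ v)).
Proof. by apply: integrable_realD; [exact: integrable_real_cst|exact: zeta_int]. Qed.

Let int_sum : P.-integrable setT (EFin \o (fun x => \sum_i (1 + vnorm (zeta i x) `^ v))).
Proof. by apply: integrable_real_sum => i; exact: int_vn. Qed.

Let int_sum1 : P.-integrable setT (EFin \o (fun x => 1 + \sum_i (1 + vnorm (zeta i x) `^ v))).
Proof. by apply: integrable_realD => //; exact: integrable_real_cst. Qed.

Lemma integrable_envelope : P.-integrable setT (EFin \o (fun x => envelope (fun i => zeta i x))).
Proof. exact: integrable_realZ. Qed.

Lemma Rintegral_envelope : \int[P]_x envelope (fun i => zeta i x) <= E0.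
Proof.
rewrite /envelope RintegralZl // ler_wpM2l ?powR_ge0 //.
rewrite RintegralD //; last exact: integrable_real_cst.
rewrite Rintegral_prob1 lerD2l Rintegral_sum //.
apply: sum_le_card => i; rewrite RintegralD //; last exact: integrable_real_cst.
by rewrite Rintegral_prob1 lerD2l.
Qed.

Lemma E0_ge0 : 0 <= E0.
Proof. by rewrite mulr_ge0 ?powR_ge0 ?addr_ge0 ?mulr_ge0 ?addr_ge0. Qed.

Lemma integrable_of_growth : P.-integrable setT (EFin \o (fun x => H (fun i => zeta i x))) /\
  `|\int[P]_x H (fun i => zeta i x)| <= C * E0.
Proof.
have [|||h1 h2] := @dominated_Rintegral _ _ _ P (fun x => H (fun i => zeta i x))
   (fun x => C * envelope (fun i => zeta i x)) => //.
- by apply: integrable_realZ; exact: integrable_envelope.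
- by move=> x; apply: (le_trans (H_growth _)); rewrite ler_wpM2l // weight4_envelope.
split => //; apply: (le_trans h2); rewrite RintegralZl //; last exact: integrable_envelope.
by rewrite ler_wpM2l // Rintegral_envelope.
Qed.

Lemma measurable_clip B (f : T -> R) : measurable_fun setT f ->
  measurable_fun setT (fun x => clip B (f x)).
Proof.
move=> mf; apply: measurable_minr => //; exact: measurable_maxr.
Qed.

Lemma clip_tail_Rintegral B : 0 < B ->
  `|\int[P]_x H (fun i => zeta i x) - \int[P]_x clip B (H (fun i => zeta i x))|
    <= C `^ s * E0 * B `^ (1 - s).
Proof.
move=> B0; have [iH _] := integrable_of_growth.
have iC : P.-integrable setT (EFin \o (fun x => clip B (H (fun i => zeta i x)))).
  by apply: (@integrable_bounded _ _ _ _ _ B); [exact: measurable_clip|move=> x; rewrite clip_le // ltW].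
rewrite -RintegralB //.
have [|||_ h] := @dominated_Rintegral _ _ _ P
  (fun x => H (fun i => zeta i x) - clip B (H (fun i => zeta i x)))
  (fun x => B `^ (1 - s) * C `^ s * envelope (fun i => zeta i x)).
- by apply: measurable_funB => //; exact: measurable_clip.
- by apply: integrable_realZ; exact: integrable_envelope.
- by move=> x; rewrite -mulrA clip_tail_envelope.
apply: (le_trans h); rewrite RintegralZl //; last exact: integrable_envelope.
rewrite [leRHS]mulrC mulrA ler_wpM2l ?mulr_ge0 ?powR_ge0 //.
exact: Rintegral_envelope.
Qed.

(** The scale in [young_scaled] is the size [b] of the error itself, so the normalized distance
    integrates to at most 1. This 1 and the one already in [young_scaled] turn [E0] into
    [E0 + 2]. *)
Lemma clip_approx_Rintegral (X : I -> T -> V) B b : 0 <= B -> 0 < b ->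
  (forall i, measurable_fun setT (X i)) ->
  measurable_fun setT (fun x => H (fun i => X i x)) ->
  (forall i, P.-integrable setT (EFin \o (fun x => vdist (zeta i x) (X i x) `^ q))) ->
  (forall i, \int[P]_x vdist (zeta i x) (X i x) `^ q <= b `^ q) ->
  `|\int[P]_x clip B (H (fun i => zeta i x)) - \int[P]_x clip B (H (fun i => X i x))|
    <= #|I|%:R * (C * (E0 + 2) + 2) * (b `^ kappa + B * b `^ q).
Proof.
move=> B0 b0 mX mHX iD hD.
have bq0 : 0 < b `^ q by exact: powR_gt0.
have iC (f : T -> R) : measurable_fun setT f -> P.-integrable setT (EFin \o (fun x => clip B (f x))).
  by move=> mf; apply: (@integrable_bounded _ _ _ _ _ B); [exact: measurable_clip|move=> x; rewrite clip_le].
rewrite -RintegralB //; try exact: iC.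
pose c1 := C * b `^ kappa; pose c2 := C * b `^ kappa / b `^ q + 2 * B.
have c10 : 0 <= c1 by rewrite mulr_ge0 ?powR_ge0.
have c20 : 0 <= c2 by rewrite addr_ge0 ?divr_ge0 ?mulr_ge0 ?powR_ge0.
have ie1 : P.-integrable setT (EFin \o (fun x => c1 * (envelope (fun i => zeta i x) + 1))).
  apply: integrable_realZ; apply: integrable_realD; first exact: integrable_envelope.
  exact: integrable_real_cst.
have id2 i : P.-integrable setT (EFin \o (fun x => c2 * vdist (zeta i x) (X i x) `^ q)).
  by apply: integrable_realZ; exact: iD.
have it i : P.-integrable setT (EFin \o (fun x => c1 * (envelope (fun i => zeta i x) + 1)
   + c2 * vdist (zeta i x) (X i x) `^ q)).
  by apply: integrable_realD; [exact: ie1|exact: id2].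
have [|||_ h] := @dominated_Rintegral _ _ _ P
  (fun x => clip B (H (fun i => zeta i x)) - clip B (H (fun i => X i x)))
  (fun x => \sum_i (c1 * (envelope (fun i => zeta i x) + 1) + c2 * vdist (zeta i x) (X i x) `^ q)).
- by apply: measurable_funB; exact: measurable_clip.
- by apply: integrable_real_sum => i; exact: it.
- by move=> x; exact: clip_holder.
apply: (le_trans h); rewrite Rintegral_sum //.
rewrite -mulrA; apply: sum_le_card => i.
rewrite RintegralD // !RintegralZl //; last first.
  by apply: integrable_realD; [exact: integrable_envelope|exact: integrable_real_cst].
rewrite RintegralD //; [|exact: integrable_envelope|exact: integrable_real_cst].
rewrite Rintegral_prob1.
apply: (@le_trans _ _ (c1 * (E0 + 1) + c2 * b `^ q)).
  by rewrite lerD // ler_wpM2l // lerD2r Rintegral_envelope.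
have -> : c2 * b `^ q = c1 + 2 * B * b `^ q.
  by rewrite /c2 mulrDl divfK // gt_eqF.
have := E0_ge0 => e0.
have -> : c1 * (E0 + 1) + (c1 + 2 * B * b `^ q) = C * (E0 + 2) * b `^ kappa + 2 * (B * b `^ q).
  by rewrite /c1; ring.
rewrite [leRHS]mulrDr lerD // ler_wpM2r ?mulr_ge0 ?powR_ge0 //; first by rewrite lerDl.
by rewrite lerDr mulr_ge0 // addr_ge0.
Qed.

End Space.
End Approximation.

(** * Finitely valued approximants from conditional expectations *)

Section LnormMoments.
Context {R : realType} {d} {T : measurableType d} (P : probability T R).

Lemma Lnorm_lty_integrable (f : T -> R) (q : R) : 0 < q -> measurable_fun setT f ->
  (forall x, 0 <= f x) -> (Lnorm P q%:E (fun x => (f x)%:E) < +oo)%E ->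
  P.-integrable setT (EFin \o (fun x => f x `^ q)).
Proof.
move=> q0 mf f0 fin; apply/integrableP; split.
  by apply/measurable_EFinP; exact: measurable_powR_comp.
rewrite (_ : (\int[P]_x _)%E = (Lnorm P q%:E (fun x => (f x)%:E) `^ q)%E).
  exact: poweR_lty.
rewrite poweR_Lnorm; last by rewrite gt_eqF.
  apply: eq_integral => x _ /=.
by rewrite !ger0_norm ?powR_ge0.
Qed.

Lemma Rintegral_powR_le_Lnorm (f : T -> R) (q b : R) : 0 < q -> 0 <= b -> measurable_fun setT f ->
  (forall x, 0 <= f x) -> (Lnorm P q%:E (fun x => (f x)%:E) <= b%:E)%E ->
  \int[P]_x f x `^ q <= b `^ q.
Proof.
move=> q0 b0 mf f0 fb.
have fin : (Lnorm P q%:E (fun x => (f x)%:E) < +oo)%E by rewrite (le_lt_trans fb) // ltry.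
have If := Lnorm_lty_integrable q0 mf f0 fin.
rewrite -lee_fin /Rintegral fineK; last exact: integrable_fin_num.
rewrite (_ : (\int[P]_x _)%E = (Lnorm P q%:E (fun x => (f x)%:E) `^ q)%E); last first.
  rewrite poweR_Lnorm; last by rewrite gt_eqF.
  apply: eq_integral => x _ /=.
  by rewrite ger0_norm.
rewrite -poweR_EFin; apply: gt0_ler_poweR => //; first exact: ltW.
- by rewrite in_itv /= Lnorm_ge0 leey.
- by rewrite in_itv /= lee_fin b0 leey.
Qed.

Lemma eventually_le_of_dominated (f : nat -> T -> R) (g : T -> R) (e : R) : 0 < e ->
  (forall n, measurable_fun setT (f n)) -> P.-integrable setT (EFin \o g) ->
  (forall n x, 0 <= f n x <= g x) -> (forall x, f n x @[n --> \oo] --> 0) ->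
  \forall n \near \oo, \int[P]_x f n x <= e.
Proof.
move=> e0 mf ig fg f0.
have cv : (fun n => \int[P]_x (EFin \o f n) x)%E @ \oo --> (\int[P]_x (cst 0 x))%E.
  have [||||//] := @dominated_convergence _ T R P setT measurableT
    (fun n => EFin \o f n) (cst 0%E) (EFin \o g) _ _ _ ig.
  - by move=> n; apply/measurable_EFinP.
  - exact: measurable_cst.
  - by apply: aeW => x _; apply: cvg_EFin; [exact: nearW|exact: f0].
  - apply: aeW => x n _ /=; have /andP[h1 h2] := fg n x.
    by rewrite lee_fin ger0_norm.
rewrite integral0 in cv.
have /fine_cvgP[_ /cvgr0Pnorm_le /(_ e e0)] := cv; apply: filterS => n.
by apply: le_trans; exact: ler_norm.
Qed.

End LnormMoments.

Lemma window_le (k r : nat) : ((k%:Z - r%:Z)%R%:E <= (k%:Z + r%:Z)%R%:E)%E.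
Proof. rewrite lee_fin; lia. Qed.

Section Approximants.
Context {R : realType} {d} {T : measurableType d} (P : probability T R).
Variables (p : nat) (xi : nat -> T -> p.-tuple R) (Fam : \bar int -> \bar int -> set (set T)) (q : R).
Hypothesis xi_meas : forall n, measurable_fun setT (xi n).
Hypothesis Fam_sigma : forall k m, (k <= m)%E ->
  sigma_algebra [set: T] (Fam k m) /\ Fam k m `<=` measurable.
Hypothesis q1 : 1 <= q.
Let q0 : 0 < q. Proof. exact: lt_le_trans q1. Qed.
Hypothesis xi_int : forall n, P.-integrable setT (EFin \o (fun x => vnorm (xi n x) `^ q)).

Local Notation FamR k r := (Fam ((k%:Z - r%:Z)%R%:E) ((k%:Z + r%:Z)%R%:E)).

(** The strict inequality yields a version [Y] within [b]; its quantizations converge to it by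
    domination. The 8 collects the constant 2 of [vdist_triangle2], that of [powR_add_le], and
    [2 <= 2 ^ q] for the two errors. The bound holds for all large [n], so that one level can serve
    finitely many times. *)
Lemma cond_dev_approx k r (b : R) : 0 < b -> (cond_dev P Fam xi q k r < b%:E)%E ->
  exists Y : T -> p.-tuple R,
   (forall i, G_measurable (FamR k r) (fun x => tnth (Y x) i)) /\
   \forall n \near \oo,
     P.-integrable setT (EFin \o (fun x => vdist (xi k x) (vdecode (vencode n (Y x))) `^ q)) /\
     \int[P]_x vdist (xi k x) (vdecode (vencode n (Y x))) `^ q <= (8 `^ q * b `^ q).
Proof.
move=> b0 /ereal_inf_lt[_ [Y condY <-] Yb].
have [sF mF] := Fam_sigma (window_le k r).
have GY i : G_measurable (FamR k r) (fun x => tnth (Y x) i) by have [] := condY i.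
exists Y; split => //.
have mY : measurable_fun setT Y.
  by apply/measurable_fun_tnthP => i _ B mB; rewrite setTI; apply: mF; exact: GY.
have mD : measurable_fun setT (fun x => vdist (xi k x) (Y x)) by exact: measurable_vdist.
have iD : P.-integrable setT (EFin \o (fun x => vdist (xi k x) (Y x) `^ q)).
  apply: Lnorm_lty_integrable => // [x|]; first exact: vdist_ge0.
  by rewrite (lt_trans Yb) // ltry.
have hD : \int[P]_x vdist (xi k x) (Y x) `^ q <= b `^ q.
  by apply: Rintegral_powR_le_Lnorm => // [|x|]; [exact: ltW|exact: vdist_ge0|exact: ltW].
pose Yn n x := vdecode (vencode n (Y x)) : p.-tuple R.
have mYn n : measurable_fun setT (Yn n).
  have -> : Yn n = (@vdecode R p n) \o (fun x => vencode n (Y x)) by [].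
  by apply: measurable_finlabel => a; exact: measurable_vencode.
(* [Y] is compared with [xi k] plus their distance, both integrable to the power [q]. The 4 comes
   from a distance between [Y] and its quantization of at most [4 * vnorm (Y x)]. *)
pose g x := 4 `^ q * (2 `^ q * (2 `^ q * (vnorm (xi k x) `^ q + vdist (xi k x) (Y x) `^ q))).
have ig : P.-integrable setT (EFin \o g).
  by do 3 apply: integrable_realZ; apply: integrable_realD; [exact: xi_int|exact: iD].
have q0' := ltW q0.
have dom n x : 0 <= vdist (Y x) (Yn n x) `^ q <= g x.
  rewrite powR_ge0 /=.
  apply: (@le_trans _ _ ((4 * vnorm (Y x)) `^ q)).
    apply: ge0_ler_powR => //; rewrite ?nnegrE ?mulr_ge0 ?vdist_ge0 ?vnorm_ge0 //.
    apply: (le_trans (vdist_le_vnorm _ _)).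
    by have := vnorm_vdecode n (Y x); rewrite -/(Yn n x); lra.
  rewrite powRM ?vnorm_ge0 // ler_wpM2l ?powR_ge0 //.
  apply: (@le_trans _ _ ((2 * (vnorm (xi k x) + vdist (xi k x) (Y x))) `^ q)).
    apply: ge0_ler_powR => //; rewrite ?nnegrE ?mulr_ge0 ?addr_ge0 ?vdist_ge0 ?vnorm_ge0 //.
    exact: vnorm_le_vdist.
  rewrite powRM ?addr_ge0 ?vnorm_ge0 ?vdist_ge0 // ler_wpM2l ?powR_ge0 //.
  by rewrite powR_add_le ?vnorm_ge0 ?vdist_ge0.
have ev : \forall n \near \oo, \int[P]_x vdist (Y x) (Yn n x) `^ q <= b `^ q.
  apply: (@eventually_le_of_dominated _ _ _ P _ g) => //; first exact: powR_gt0.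
  - by move=> n; apply: measurable_powR_comp; exact: measurable_vdist.
  - by move=> x; apply: cvg_powR0 => // [n|]; [exact: vdist_ge0|exact: cvg_vdecode].
apply: filterS ev => n hn.
pose h x := 2 `^ q * (2 `^ q * (vdist (xi k x) (Y x) `^ q + vdist (Y x) (Yn n x) `^ q)).
have iYn : P.-integrable setT (EFin \o (fun x => vdist (Y x) (Yn n x) `^ q)).
  have [] // := @dominated_Rintegral _ _ _ P (fun x => vdist (Y x) (Yn n x) `^ q) g.
    by apply: measurable_powR_comp; exact: measurable_vdist.
  by move=> x; have /andP[h1 h2] := dom n x; rewrite ger0_norm.
have is2 : P.-integrable setT (EFin \o (fun x => vdist (xi k x) (Y x) `^ q + vdist (Y x) (Yn n x) `^ q)).
  exact: (integrable_realD iD iYn).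
have ih : P.-integrable setT (EFin \o h).
  by do 2 apply: integrable_realZ.
have le_h x : vdist (xi k x) (Yn n x) `^ q <= h x.
  apply: (@le_trans _ _ ((2 * (vdist (xi k x) (Y x) + vdist (Y x) (Yn n x))) `^ q)).
    apply: ge0_ler_powR => //; rewrite ?nnegrE ?mulr_ge0 ?addr_ge0 ?vdist_ge0 //.
    exact: vdist_triangle2.
  rewrite powRM ?addr_ge0 ?vdist_ge0 // ler_wpM2l ?powR_ge0 //.
  by rewrite powR_add_le ?vdist_ge0.
have [|||h1 h2] := @dominated_Rintegral _ _ _ P (fun x => vdist (xi k x) (Yn n x) `^ q) h.
- by apply: measurable_powR_comp; exact: measurable_vdist.
- exact: ih.
- by move=> x; rewrite ger0_norm ?powR_ge0.
split => //.
apply: (le_trans (ler_norm _)); apply: (le_trans h2).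
rewrite (RintegralZl _ measurableT (integrable_realZ (2 `^ q) is2)).
rewrite (RintegralZl _ measurableT is2) (RintegralD measurableT iD iYn).
have -> : 8 `^ q = 2 `^ q * 2 `^ q * 2 `^ q :> R.
  by rewrite -!powRM ?mulr_ge0 //; congr (_ `^ _); ring.
rewrite -!mulrA; do 2 (apply: ler_wpM2l; first exact: powR_ge0).
apply: (le_trans (lerD hD hn)).
apply: (@le_trans _ _ (2 * b `^ q)); first by rewrite mulr_natl mulr2n.
by rewrite ler_wpM2r ?powR_ge0 // -{1}(@powRr1 _ 2) // ler_powR // ler1n.
Qed.

End Approximants.

(** * Products of four factors with an isolated time *)

Section Transfer.
Context {R : realType} {d1 d2} {X : measurableType d1} {Y : measurableType d2}.
Variables (Q : probability X R) (P : probability Y R) (phi : X -> Y).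
Hypothesis mphi : measurable_fun setT phi.
Hypothesis law : forall A, measurable A -> Q (phi @^-1` A) = P A.
Implicit Type f : Y -> R.

Lemma integrable_transfer f : measurable_fun setT f ->
  Q.-integrable setT (EFin \o (fun x => f (phi x))) <-> P.-integrable setT (EFin \o f).
Proof.
move=> mf; have mfphi : measurable_fun setT (fun x => f (phi x)).
  exact: (measurableT_comp mf mphi).
have mabs : measurable_fun setT (fun x => `|(EFin \o f) x|)%E.
  by apply: measurableT_comp => //; exact/measurable_EFinP.
have E : (\int[P]_y `|(EFin \o f) y| = \int[Q]_x `|(EFin \o (fun x => f (phi x))) x|)%E.
  rewrite -[RHS](ge0_integral_pushforward mphi Q measurableT mabs) //.
  by apply: eq_measure_integral => A mA _; apply/esym; exact: law.
by split => /integrableP[m i]; apply/integrableP; split;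
  [exact/measurable_EFinP|rewrite E|exact/measurable_EFinP|rewrite -E].
Qed.

Lemma Rintegral_transfer f : measurable_fun setT f -> P.-integrable setT (EFin \o f) ->
  \int[Q]_x f (phi x) = \int[P]_y f y.
Proof.
move=> mf intf; rewrite /Rintegral; congr fine.
have mEf : measurable_fun setT (EFin \o f) by exact/measurable_EFinP.
rewrite -[LHS](integral_pushforward mphi mEf ((integrable_transfer mf).2 intf) measurableT).
by apply: eq_measure_integral => A mA _; exact: law.
Qed.

End Transfer.

Lemma prod_sub_le (R : realDomainType) n (a b : 'I_n -> R) (M dlt : R) : 0 <= M -> 0 <= dlt ->
  (forall k, `|a k| <= M) -> (forall k, `|b k| <= M) -> (forall k, `|a k - b k| <= dlt) ->
  `|\prod_k a k - \prod_k b k| <= n%:R * M ^+ n.-1 * dlt.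
Proof.
move=> M0 d0; elim: n a b => [|n IH] a b ha hb hab.
  by rewrite !big_ord0 subrr normr0 !mul0r.
rewrite !big_ord_recl /=.
have pb : `|\prod_(i < n) b (lift ord0 i)| <= M ^+ n.
  rewrite normr_prod -[X in _ ^+ X]card_ord -prodr_const.
  by apply: ler_prod => i _; rewrite normr_ge0 hb.
have h := IH (fun i => a (lift ord0 i)) (fun i => b (lift ord0 i)) (fun i => ha _) (fun i => hb _) (fun i => hab _).
have -> : a ord0 * \prod_(i < n) a (lift ord0 i) - b ord0 * \prod_(i < n) b (lift ord0 i)
  = a ord0 * (\prod_(i < n) a (lift ord0 i) - \prod_(i < n) b (lift ord0 i))
    + (a ord0 - b ord0) * \prod_(i < n) b (lift ord0 i) by ring.
apply: (le_trans (ler_normD _ _)); rewrite !normrM.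
have -> : n.+1%:R * M ^+ n * dlt = n%:R * M ^+ n * dlt + M ^+ n * dlt :> R.
  by rewrite -natr1; ring.
apply: lerD; last by rewrite mulrC ler_pM.
apply: (le_trans (ler_pM (normr_ge0 _) (normr_ge0 _) (ha ord0) h)).
by case: n {IH a b ha hb hab pb h} => [|n]; rewrite ?mul0r ?mulr0 // /= exprS; lra.
Qed.

Section Product.
Context {R : realType} (p l : nat).
Local Notation V := (p.-tuple R).
Variables (f : l.-tuple V -> R) (K iota kappa : R).
Hypotheses (K0 : 0 <= K) (iota0 : 0 <= iota) (kappa0 : 0 < kappa).
Hypothesis reg : regular f K iota kappa.
Definition idx : finType := ('I_4 * 'I_l)%type.

Definition prod4 (x : idx -> V) : R := \prod_(k < 4) f [tuple x (k, i) | i < l].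

Let c : R := 4 `^ iota * #|idx|.+1%:R.
(** The factor [c] bounds the growth of [weight] when every vector moves by at most 1. Telescoping
    four factors of size [c * K * weight] whose increments carry [2 * c * K * weight] gives
    [8 = 4 * 2] and the fourth powers. *)
Definition prod4_const : R := 8 * c ^+ 4 * K ^+ 4.

Let f1 : 1 <= 4 `^ iota :> R.
Proof.
have h4 : 1 <= 4 :> R by rewrite ler1n.
by have := ler_powR h4 iota0; rewrite powRr0.
Qed.

Let c1 : 1 <= c.
Proof. by rewrite /c -[leLHS]mulr1 ler_pM // ler1n. Qed.

Lemma prod4_const_ge0 : 0 <= prod4_const.
Proof. by rewrite !mulr_ge0 ?exprn_ge0 // (le_trans ler01 c1). Qed.

Let block_le (x : idx -> V) (k : 'I_4) (g : V -> R) : (forall y, 0 <= g y) ->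
  \sum_(i < l) g (x (k, i)) <= \sum_j g (x j).
Proof.
move=> g0; rewrite (eq_bigr (fun j => g (x (j.1, j.2)))); last by case.
rewrite -(pair_bigA _ (fun a b => g (x (a, b)))) /= (bigD1 k) //= lerDl.
by rewrite sumr_ge0 // => a _; rewrite sumr_ge0.
Qed.

Let block_le2 (x z : idx -> V) (k : 'I_4) :
  \sum_(i < l) vdist (x (k, i)) (z (k, i)) `^ kappa <= \sum_j vdist (x j) (z j) `^ kappa.
Proof.
rewrite (eq_bigr (fun j => vdist (x (j.1, j.2)) (z (j.1, j.2)) `^ kappa)); last by case.
rewrite -(pair_bigA _ (fun a b => vdist (x (a, b)) (z (a, b)) `^ kappa)) /= (bigD1 k) //= lerDl.
by rewrite sumr_ge0 // => a _; rewrite sumr_ge0 // => b _; exact: powR_ge0.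
Qed.

Let weight0 (x : idx -> V) : 0 <= weight iota x.
Proof. exact: le_trans ler01 (weight_ge1 _ _). Qed.

Let factor_le (x : idx -> V) k : `|f [tuple x (k, i) | i < l]| <= K * weight iota x.
Proof.
case: reg => _ h; apply: (le_trans (h _)); rewrite ler_wpM2l // lerD2l.
under eq_bigr do rewrite tnth_mktuple.
exact: (block_le x k (g := fun y => vnorm y `^ iota) (fun y => powR_ge0 _ _)).
Qed.

Lemma prod4_growth (x : idx -> V) : `|prod4 x| <= prod4_const * weight iota x ^+ 4.
Proof.
rewrite /prod4 normr_prod; apply: (@le_trans _ _ ((K * weight iota x) ^+ 4)).
  rewrite -[X in _ ^+ X](card_ord 4) -prodr_const.
  by apply: ler_prod => k _; rewrite normr_ge0 factor_le.
rewrite exprMn ler_wpM2r ?exprn_ge0 // /prod4_const ler_peMl ?exprn_ge0 //.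
by rewrite -[leLHS]mulr1 ler_pM // ?exprn_ege1 // ler1n.
Qed.

Let weight_near (x z : idx -> V) : (forall i, vdist (x i) (z i) <= 1) ->
  weight iota z <= c * weight iota x.
Proof.
move=> h; have f0 : 0 < 4 `^ iota :> R by exact: powR_gt0.
apply: (@le_trans _ _ (4 `^ iota * (#|idx|%:R + weight iota x))).
  have zi i : vnorm (z i) `^ iota <= 4 `^ iota * (1 + vnorm (x i) `^ iota).
    apply: (@le_trans _ _ ((2 * (1 + vnorm (x i))) `^ iota)).
      apply: ge0_ler_powR => //; rewrite ?nnegrE ?mulr_ge0 ?addr_ge0 ?vnorm_ge0 //.
      apply: (le_trans (vnorm_le_vdist (x i) (z i))); rewrite ler_wpM2l //.
      by rewrite addrC lerD2r h.
    rewrite powRM ?addr_ge0 ?vnorm_ge0 //.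
    have -> : 4 `^ iota = 2 `^ iota * 2 `^ iota :> R.
      by rewrite -powRM //; congr (_ `^ _); ring.
    rewrite -mulrA ler_wpM2l ?powR_ge0 //.
    apply: (le_trans (powR_add_le _ _ _)); rewrite ?vnorm_ge0 //.
    by rewrite powR1.
  rewrite /weight addrCA mulrDr mulr1.
  apply: lerD => //; apply: (@le_trans _ _ (\sum_i 4 `^ iota * (1 + vnorm (x i) `^ iota))).
    by apply: ler_sum => i _; exact: zi.
  by rewrite -mulr_sumr big_split /= sumr_const.
rewrite /c -mulrA ler_wpM2l ?(ltW f0) //.
have := weight_ge1 iota x; set W := weight _ _ => W1.
by rewrite -natr1 mulrDl mul1r lerD2r ler_peMr.
Qed.

Lemma prod4_holder (x z : idx -> V) : (forall i, vdist (x i) (z i) <= 1) ->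
  `|prod4 x - prod4 z| <= prod4_const * weight iota x ^+ 4 * \sum_i vdist (x i) (z i) `^ kappa.
Proof.
move=> h; have wz := weight_near h.
set S := \sum_i _; have S0 : 0 <= S by rewrite sumr_ge0 // => i _; exact: powR_ge0.
have c0 : 0 <= c by exact: le_trans ler01 c1.
set W := weight iota x in wz *; have W0 : 0 <= W by exact: weight0.
have hx k : `|f [tuple x (k, i) | i < l]| <= c * K * W.
  by apply: (le_trans (factor_le x k)); rewrite -mulrA ler_peMl ?mulr_ge0.
have hz k : `|f [tuple z (k, i) | i < l]| <= c * K * W.
  by apply: (le_trans (factor_le z k)); rewrite [c * K]mulrC -mulrA ler_wpM2l.
have hxz k : `|f [tuple x (k, i) | i < l] - f [tuple z (k, i) | i < l]| <= 2 * c * K * W * S.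
  case: reg => hh _; apply: (le_trans (hh _ _)).
  under [X in _ * X <= _]eq_bigr do rewrite !tnth_mktuple.
  under [X in _ * (_ + X) * _ <= _]eq_bigr do rewrite !tnth_mktuple.
  apply: ler_pM.
  - by rewrite mulr_ge0 // addr_ge0 // sumr_ge0 // => i _; rewrite addr_ge0 ?powR_ge0.
  - by rewrite sumr_ge0 // => i _; exact: powR_ge0.
  - have bx := block_le x k (g := fun y => vnorm y `^ iota) (fun y => powR_ge0 _ _).
    have bz := block_le z k (g := fun y => vnorm y `^ iota) (fun y => powR_ge0 _ _).
    have -> : 2 * c * K * W = K * (2 * c * W) by ring.
    rewrite big_split /= ler_wpM2l //.
    apply: (@le_trans _ _ (W + weight iota z)).
      by rewrite /W /weight; move: bx bz => /=; lra.
    have WcW : W <= c * W by rewrite ler_peMl.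
    by rewrite -mulrA; move: wz WcW; lra.
  - exact: (block_le2 x z k).
have := @prod_sub_le _ 4 (fun k => f [tuple x (k, i) | i < l]) (fun k => f [tuple z (k, i) | i < l])
  (c * K * W) (2 * c * K * W * S) _ _ hx hz hxz.
rewrite /= -/(prod4 x) -/(prod4 z) => hh; apply: (le_trans (hh _ _)).
- by rewrite !mulr_ge0.
- by rewrite !mulr_ge0.
- by rewrite /prod4_const le_eqVlt; apply/predU1P; left; ring.
Qed.

Lemma measurable_prod4 d (T : measurableType d) (zeta : idx -> T -> V) :
  (forall i, measurable_fun setT (zeta i)) -> measurable_fun setT (fun x => prod4 (fun i => zeta i x)).
Proof.
move=> mz; apply: measurable_prod => k _.
apply: (measurable_regular K0 iota0 kappa0 reg).
by apply/measurable_fun_tnthP => i; rewrite (_ : _ \o _ = zeta (k, i)) //;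
  apply/funext => x /=; rewrite tnth_mktuple.
Qed.

End Product.

(** In order: the expectation [a1], clipped [a2], quantized [a3], decoupled [a4], no longer
    quantized [a5], no longer clipped 0. Clipping and quantization are paid twice, mixing once. *)
Lemma chain_dist_le (R : realDomainType) (a1 a2 a3 a4 a5 u1 u2 u3 : R) :
  `|a1 - a2| <= u1 -> `|a2 - a3| <= u2 -> `|a3 - a4| <= u3 -> `|a5 - a4| <= u2 ->
  `|0 - a5| <= u1 -> `|a1| <= 2 * u1 + 2 * u2 + u3.
Proof.
rewrite !ler_norml => /andP[x1 y1] /andP[x2 y2] /andP[x3 y3] /andP[x4 y4] /andP[x5 y5].
by apply/andP; split; lra.
Qed.

Section Rcons.
Context {V : Type} {l : nat}.
Implicit Types (x : l.-tuple V) (y : V).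

Lemma tnth_rcons_max x y : tnth [tuple of rcons x y] ord_max = y.
Proof. by rewrite (tnth_nth y) /= nth_rcons size_tuple ltnn eqxx. Qed.

Lemma tnth_rcons_widen x y i : tnth [tuple of rcons x y] (widen_ord (leqnSn l) i) = tnth x i.
Proof. by rewrite !(tnth_nth y) /= nth_rcons size_tuple ltn_ord. Qed.

Lemma ord_last_case (Q : 'I_l.+1 -> Prop) :
  Q ord_max -> (forall i : 'I_l, Q (widen_ord (leqnSn l) i)) -> forall i, Q i.
Proof.
move=> Qm Qw i; have [->//|il] := eqVneq i ord_max.
have il' : (i < l)%N by rewrite ltn_neqAle -ltnS ltn_ord andbT; move: il; rewrite -val_eqE.
by rewrite (_ : i = widen_ord (leqnSn l) (Ordinal il')); [exact: Qw|exact: val_inj].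
Qed.

End Rcons.

Lemma integrable_rcons {R : realType} {p l : nat} (mu : probability (p.-tuple R) R)
    (f : l.+1.-tuple (p.-tuple R) -> R) (K iota kappa v : R) (x : l.-tuple (p.-tuple R)) :
  0 <= K -> 0 <= iota -> 0 < kappa -> iota <= v -> regular f K iota kappa ->
  mu.-integrable setT (EFin \o (fun y => vnorm y `^ v)) ->
  mu.-integrable setT (EFin \o (fun y => f [tuple of rcons x y])).
Proof.
move=> K0 iota0 kappa0 v0 reg mu_v.
pose g (y : p.-tuple R) := K * (1 + (\sum_(i < l) vnorm (tnth x i) `^ iota + (1 + vnorm y `^ v))).
have [] // := @dominated_Rintegral _ _ _ mu (fun y => f [tuple of rcons x y]) g.
- apply: (measurable_regular K0 iota0 kappa0 reg).
  apply/measurable_fun_tnthP; apply: ord_last_case => [|i].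
    rewrite (_ : _ \o _ = id); first exact: measurable_id.
    by apply/funext => y; exact: tnth_rcons_max.
  rewrite (_ : _ \o _ = cst (tnth x i)); first exact: measurable_cst.
  by apply/funext => y; exact: tnth_rcons_widen.
- apply: integrable_realZ; apply: integrable_realD; first exact: integrable_real_cst.
  apply: integrable_realD; first exact: integrable_real_cst.
  by apply: integrable_realD => //; exact: integrable_real_cst.
- move=> y; case: reg => _ h; apply: (le_trans (h _)); rewrite /g ler_wpM2l // lerD2l.
  rewrite big_ord_recr /=; apply: lerD.
    rewrite le_eqVlt; apply/predU1P; left; apply: eq_bigr => i _.
    by rewrite tnth_rcons_widen.
  rewrite tnth_rcons_max.
  by apply: powR_le1D => //; exact: vnorm_ge0.
Qed.

Section Core.
Context {R : realType} {d} {T : measurableType d} (P : probability T R).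
Variables (p : nat) (xi : nat -> T -> p.-tuple R) (Fam : \bar int -> \bar int -> set (set T)).
Variable mu : probability (p.-tuple R) R.
Local Notation V := (p.-tuple R).
Hypothesis xi_meas : forall n, measurable_fun setT (xi n).
Hypothesis Fam_sigma : forall k m, (k <= m)%E ->
  sigma_algebra [set: T] (Fam k m) /\ Fam k m `<=` measurable.
Hypothesis Fam_mono : forall k m k' m', (k <= m)%E -> (k' <= k)%E -> (m <= m')%E ->
  Fam k m `<=` Fam k' m'.
Hypothesis xi_law : forall n (A : set V), measurable A -> P (xi n @^-1` A) = mu A.

Variables (iota kappa q s v : R).
Hypotheses (iota0 : 0 <= iota) (kappa0 : 0 < kappa) (q1 : 1 <= q) (s1 : 1 < s).
Hypotheses (vs : 4 * iota * s <= v) (qs : kappa * s <= q * (s - 1)).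
Hypothesis mu_v : mu.-integrable setT (EFin \o (fun y => vnorm y `^ v)).
Hypothesis mu_q : mu.-integrable setT (EFin \o (fun y => vnorm y `^ q)).

Lemma measurable_vnorm_powR r : measurable_fun setT (fun y : V => vnorm y `^ r).
Proof. by apply: measurable_powR_comp; apply: measurable_vnorm; exact: measurable_id. Qed.

Lemma xi_moment r n : mu.-integrable setT (EFin \o (fun y : V => vnorm y `^ r)) ->
  P.-integrable setT (EFin \o (fun x => vnorm (xi n x) `^ r)) /\
  \int[P]_x vnorm (xi n x) `^ r = \int[mu]_y vnorm y `^ r.
Proof.
move=> ir; have mr := measurable_vnorm_powR r.
have law A : measurable A -> P (xi n @^-1` A) = mu A by exact: xi_law.
split; first exact: ((integrable_transfer (xi_meas n) law mr).2 ir).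
exact: (Rintegral_transfer (xi_meas n) law mr ir).
Qed.

Let Mv : R := \int[mu]_y vnorm y `^ v.

Let Mv0 : 0 <= Mv.
Proof. by apply: Rintegral_ge0 => y _; exact: powR_ge0. Qed.

Variables (l : nat) (f : l.+1.-tuple V -> R) (K : R).
Hypotheses (K0 : 0 <= K) (reg : regular f K iota kappa).
Hypothesis centered : forall x : l.-tuple V, \int[mu]_y f [tuple of rcons x y] = 0.

Local Notation I := (idx l.+1).
Let H : (I -> V) -> R := prod4 f.
Let C : R := prod4_const l.+1 K iota.
Let C0 : 0 <= C. Proof. exact: prod4_const_ge0. Qed.
Let q0 : 0 < q. Proof. exact: lt_le_trans q1. Qed.
Let growth : forall x, `|H x| <= C * weight iota x ^+ 4.
Proof. exact: (prod4_growth K0 iota0 reg). Qed.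
Let holder : forall x z, (forall i, vdist (x i) (z i) <= 1) ->
  `|H x - H z| <= C * weight iota x ^+ 4 * \sum_i vdist (x i) (z i) `^ kappa.
Proof. by move=> x z; exact: (prod4_holder K0 iota0 reg). Qed.

Let E0 : R := #|I|.+1%:R `^ (4 * s) * (1 + #|I|%:R * (1 + Mv)).

Let xi_int_v (t : I -> nat) i : P.-integrable setT (EFin \o (fun x => vnorm (xi (t i) x) `^ v)).
Proof. exact: (xi_moment (t i) mu_v).1. Qed.

Let xi_mom_v (t : I -> nat) i : \int[P]_x vnorm (xi (t i) x) `^ v <= Mv.
Proof. by rewrite (xi_moment (t i) mu_v).2. Qed.

Let H_xi_meas (t : I -> nat) : measurable_fun setT (fun x => H (fun i => xi (t i) x)).
Proof. by apply: (measurable_prod4 K0 iota0 kappa0 reg) => i; exact: xi_meas. Qed.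

Lemma integrable_prod4_xi (t : I -> nat) :
  P.-integrable setT (EFin \o (fun x => H (fun i => xi (t i) x))) /\
  `|\int[P]_x H (fun i => xi (t i) x)| <= C * E0.
Proof.
exact: (integrable_of_growth C0 iota0 s1 vs growth (xi_int_v t) (xi_mom_v t) (H_xi_meas t)).
Qed.

Section Isolated.
Variables (t : I -> nat) (k0 : 'I_4) (r : nat).
Let i0 : I := (k0, ord_max).
Hypothesis sep : forall i, i != i0 ->
  (t i + 3 * r <= t i0)%N || (t i0 + 3 * r <= t i)%N.

(** Only the last argument of the factor [k0] is read off the second copy of the space; all others,
    including those of the same factor, keep their joint law. *)
Let zeta2 i (z : T * T) := if i == i0 then xi (t i) z.2 else xi (t i) z.1.
Let P2 : probability (T * T)%type R := prodP P P.

Let law_fst A : measurable A -> P2 (fst @^-1` A) = P A.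
Proof.
move=> mA; rewrite (_ : fst @^-1` A = A `*` setT); last first.
  by apply/seteqP; split => [x|x []].
rewrite -[LHS]/((P \x P)%E (A `*` setT)) product_measure1E //.
by rewrite [X in (_ * X)%E]probability_setT mule1.
Qed.

Let law_snd A : measurable A -> P2 (snd @^-1` A) = P A.
Proof.
move=> mA; rewrite (_ : snd @^-1` A = setT `*` A); last first.
  by apply/seteqP; split => [x|x []].
rewrite -[LHS]/((P \x P)%E (setT `*` A)) product_measure1E //.
by rewrite [X in (X * _)%E]probability_setT mul1e.
Qed.

(* Each [zeta2 i] has, under [P2], the law of [xi (t i)] under [P]. *)
Let transfer2 i (g : T -> R) : measurable_fun setT g -> P.-integrable setT (EFin \o g) ->
  P2.-integrable setT (EFin \o (fun z => if i == i0 then g z.2 else g z.1)) /\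
  \int[P2]_z (if i == i0 then g z.2 else g z.1) = \int[P]_x g x.
Proof.
move=> mg ig; case: (i == i0).
  split; first exact: ((integrable_transfer measurable_snd law_snd mg).2 ig).
  exact: (Rintegral_transfer measurable_snd law_snd mg ig).
split; first exact: ((integrable_transfer measurable_fst law_fst mg).2 ig).
exact: (Rintegral_transfer measurable_fst law_fst mg ig).
Qed.

Let zeta2_meas i : measurable_fun setT (zeta2 i).
Proof.
rewrite /zeta2; case: (i == i0); first exact: (measurableT_comp (xi_meas _) measurable_snd).
exact: (measurableT_comp (xi_meas _) measurable_fst).
Qed.

Let zeta2_int i : P2.-integrable setT (EFin \o (fun z => vnorm (zeta2 i z) `^ v)) /\
  \int[P2]_z vnorm (zeta2 i z) `^ v <= Mv.
Proof.
have [h1 h2] := xi_moment (t i) mu_v.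
have mg : measurable_fun setT (fun x => vnorm (xi (t i) x) `^ v).
  by apply: measurable_powR_comp; exact: measurable_vnorm.
have [h3 h4] := transfer2 i mg h1.
rewrite (_ : (fun z => vnorm (zeta2 i z) `^ v) =
  fun z => if i == i0 then vnorm (xi (t i) z.2) `^ v else vnorm (xi (t i) z.1) `^ v).
  by split; rewrite // h4 h2.
by apply/funext => z; rewrite /zeta2; case: ifP.
Qed.

Let zeta2_int_v i : P2.-integrable setT (EFin \o (fun z => vnorm (zeta2 i z) `^ v)).
Proof. exact: (zeta2_int i).1. Qed.

Let zeta2_mom_v i : \int[P2]_z vnorm (zeta2 i z) `^ v <= Mv.
Proof. exact: (zeta2_int i).2. Qed.

Let H_zeta2_meas : measurable_fun setT (fun x => H (fun i => zeta2 i x)).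
Proof. by apply: (measurable_prod4 K0 iota0 kappa0 reg) => i; exact: zeta2_meas. Qed.

Let H_zeta2_int : P2.-integrable setT (EFin \o (fun x => H (fun i => zeta2 i x))).
Proof.
exact: (integrable_of_growth C0 iota0 s1 vs growth zeta2_int_v zeta2_mom_v H_zeta2_meas).1.
Qed.

Let integrable_section (x : l.-tuple V) :
  mu.-integrable setT (EFin \o (fun y => f [tuple of rcons x y])).
Proof.
apply: (integrable_rcons x K0 iota0 kappa0 _ reg mu_v).
apply: le_trans vs; rewrite mulrAC ler_peMl //.
by rewrite -[leLHS]mulr1 ler_pM // ?ler1n // ltW.
Qed.

(** By Fubini the second coordinate is integrated first. It enters a single factor, through its last
    argument, where [f] is centered; so the inner integral is 0 at every point. *)
Lemma Rintegral_prod4_isolated : \int[P2]_z H (fun i => zeta2 i z) = 0.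
Proof.
rewrite /Rintegral -(integral12_prod_meas1 H_zeta2_int).
rewrite (eq_integral (cst 0%E)); first by rewrite integral0.
move=> x _.
pose a := [tuple xi (t (k0, widen_ord (leqnSn l) i)) x | i < l].
pose c := \prod_(k < 4 | k != k0) f [tuple xi (t (k, i)) x | i < l.+1].
have mfa : measurable_fun setT (fun y => f [tuple of rcons a y]).
  by have /integrableP[/measurable_EFinP] := integrable_section a.
have law A : measurable A -> P (xi (t i0) @^-1` A) = mu A by exact: xi_law.
have HE y : H (fun i => zeta2 i (x, y)) = c * f [tuple of rcons a (xi (t i0) y)].
  rewrite /H /prod4 (bigD1 k0) //= mulrC; congr (_ * _).
    apply: eq_bigr => k kk0; congr (f _); apply: eq_from_tnth => i.
    by rewrite !tnth_mktuple /zeta2 /i0 xpair_eqE (negbTE kk0).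
  congr (f _); apply: eq_from_tnth; apply: ord_last_case => [|i].
    by rewrite tnth_rcons_max tnth_mktuple /zeta2 eqxx.
  rewrite tnth_rcons_widen !tnth_mktuple /zeta2 xpair_eqE eqxx -val_eqE /=.
  by rewrite (ltn_eqF (ltn_ord i)).
have int0 : P.-integrable setT (EFin \o (fun y => f [tuple of rcons a (xi (t i0) y)])).
  exact: ((integrable_transfer (xi_meas (t i0)) law mfa).2 (integrable_section a)).
have eq0 : \int[P]_y f [tuple of rcons a (xi (t i0) y)] = 0.
  by rewrite (Rintegral_transfer (xi_meas (t i0)) law mfa (integrable_section a)).
transitivity (\int[P]_y (c%:E * (EFin \o (fun y => f [tuple of rcons a (xi (t i0) y)])) y))%E.
  by apply: eq_integral => y _; rewrite /= HE EFinM.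
rewrite (integralZl measurableT int0) -(fineK (integrable_fin_num measurableT int0)).
by rewrite [fine _]eq0 mule0.
Qed.

Lemma prod4_clip_bound b B : 0 < b -> 0 < B ->
  (forall i, (cond_dev P Fam xi q (t i) r < b%:E)%E) ->
  `|\int[P]_x H (fun i => xi (t i) x)| <=
    2 * (C `^ s * E0) * B `^ (1 - s)
    + 2 * (#|I|%:R * (C * (E0 + 2) + 2)) * ((8 * b) `^ kappa + B * (8 * b) `^ q)
    + 6 * phi_mix P Fam r * B.
Proof.
move=> b0 B0 hb.
have xi_q n : P.-integrable setT (EFin \o (fun x => vnorm (xi n x) `^ q)).
  by have [] := xi_moment n mu_q.
have b80 : 0 < 8 * b by rewrite mulr_gt0.
have /choice[Y hY] : forall i, exists Y : T -> V,
   (forall j, G_measurable (Fam (((t i)%:Z - r%:Z)%R%:E) (((t i)%:Z + r%:Z)%R%:E)) (fun x => tnth (Y x) j)) /\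
   \forall n \near \oo,
     P.-integrable setT (EFin \o (fun x => vdist (xi (t i) x) (vdecode (vencode n (Y x))) `^ q)) /\
     \int[P]_x vdist (xi (t i) x) (vdecode (vencode n (Y x))) `^ q <= (8 `^ q * b `^ q).
  by move=> i; exact: (cond_dev_approx xi_meas Fam_sigma q1 xi_q b0 (hb i)).
(* One quantization level for all indices, so that all labels lie in the same finite type. *)
have [n hn] : exists n, forall i,
     P.-integrable setT (EFin \o (fun x => vdist (xi (t i) x) (vdecode (vencode n (Y i x))) `^ q)) /\
     \int[P]_x vdist (xi (t i) x) (vdecode (vencode n (Y i x))) `^ q <= (8 `^ q * b `^ q).
  have /choice[N hN] : forall i, exists N, forall n, (N <= n)%N ->
     P.-integrable setT (EFin \o (fun x => vdist (xi (t i) x) (vdecode (vencode n (Y i x))) `^ q)) /\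
     \int[P]_x vdist (xi (t i) x) (vdecode (vencode n (Y i x))) `^ q <= (8 `^ q * b `^ q).
    by move=> i; have [_ [N _ hN]] := hY i; exists N => n Nn; exact: hN.
  exists (\max_i N i) => i; apply: hN; exact: leq_bigmax.
pose lab i x := vencode n (Y i x).
pose X i x : V := vdecode (lab i x).
have FamR i : sigma_algebra setT (Fam (((t i)%:Z - r%:Z)%R%:E) (((t i)%:Z + r%:Z)%R%:E)) /\
   (Fam (((t i)%:Z - r%:Z)%R%:E) (((t i)%:Z + r%:Z)%R%:E)) `<=` measurable.
  exact: (Fam_sigma (window_le _ _)).
have Flab i a : Fam (((t i)%:Z - r%:Z)%R%:E) (((t i)%:Z + r%:Z)%R%:E) (lab i @^-1` [set a]).
  by have [GY _] := hY i; exact: (vencode_fiber a (FamR i).1 GY).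
have mX i : measurable_fun setT (X i).
  by apply: (@measurable_finlabel _ _ _ _ _ (lab i) (@vdecode R p n)) => a; apply: (FamR i).2; exact: Flab.
pose X2 i (z : T * T) := if i == i0 then X i z.2 else X i z.1.
have mX2 i : measurable_fun setT (X2 i).
  rewrite /X2; case: (i == i0); first exact: (measurableT_comp (mX _) measurable_snd).
  exact: (measurableT_comp (mX _) measurable_fst).
have d8 : 8 `^ q * b `^ q = (8 * b) `^ q by rewrite powRM // ltW.
have mD i : measurable_fun setT (fun x => vdist (xi (t i) x) (X i x) `^ q).
  by apply: measurable_powR_comp; exact: measurable_vdist.
have D2 i : P2.-integrable setT (EFin \o (fun z => vdist (zeta2 i z) (X2 i z) `^ q)) /\
  \int[P2]_z vdist (zeta2 i z) (X2 i z) `^ q <= (8 * b) `^ q.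
  have [h1 h2] := hn i; have [h3 h4] := transfer2 i (mD i) h1.
  rewrite (_ : (fun z => vdist (zeta2 i z) (X2 i z) `^ q) =
    fun z => if i == i0 then vdist (xi (t i) z.2) (X i z.2) `^ q else vdist (xi (t i) z.1) (X i z.1) `^ q).
    by split; rewrite // h4 -d8.
  by apply/funext => z; rewrite /zeta2 /X2; case: ifP.
set a1 := \int[P]_x _.
pose a2 := \int[P]_x clip B (H (fun i => xi (t i) x)).
pose a3 := \int[P]_x clip B (H (fun i => X i x)).
pose a4 := \int[P2]_z clip B (H (fun i => X2 i z)).
pose a5 := \int[P2]_z clip B (H (fun i => zeta2 i z)).
have Hm (Z : I -> T -> V) : (forall i, measurable_fun setT (Z i)) ->
    measurable_fun setT (fun x => H (fun i => Z i x)).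
  exact: (measurable_prod4 K0 iota0 kappa0 reg).
have HX2 : measurable_fun setT (fun z => H (fun i => X2 i z)).
  exact: (measurable_prod4 K0 iota0 kappa0 reg mX2).
have hn1 i := (hn i).1.
have hn2 i : \int[P]_x vdist (xi (t i) x) (X i x) `^ q <= (8 * b) `^ q.
  by rewrite -d8; exact: (hn i).2.
have e12 : `|a1 - a2| <= C `^ s * E0 * B `^ (1 - s).
  exact: (clip_tail_Rintegral C0 iota0 s1 vs growth (xi_int_v t) (xi_mom_v t) (H_xi_meas t) B0).
have e23 : `|a2 - a3| <= #|I|%:R * (C * (E0 + 2) + 2) * ((8 * b) `^ kappa + B * (8 * b) `^ q).
  exact: (clip_approx_Rintegral C0 iota0 kappa0 q0 s1 vs qs holder Mv0 (xi_int_v t) (xi_mom_v t)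
    (H_xi_meas t) (ltW B0) b80 mX (Hm X mX) hn1 hn2).
have e34 : `|a3 - a4| <= 6 * phi_mix P Fam r * B.
  pose G (c : {ffun I -> vcode p n}) := clip B (H (fun i => vdecode (c i))).
  have GB c : `|G c| <= B by apply: clip_le; exact: ltW.
  have -> : a3 = \int[P]_x G [ffun i => lab i x].
    by apply: eq_Rintegral => x _; congr (clip B (H _)); apply/funext => i; rewrite ffunE.
  have -> : a4 = \int[prodP P P]_z G [ffun i => if i == i0 then lab i z.2 else lab i z.1].
    apply: eq_Rintegral => z _; congr (clip B (H _)); apply/funext => i; rewrite ffunE.
    by rewrite /X2 /X; case: ifP.
  exact: (decouple_labels P Fam_sigma Fam_mono Flab sep (ltW B0) GB).
have D21 i := (D2 i).1.
have D22 i := (D2 i).2.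
have e45 : `|a5 - a4| <= #|I|%:R * (C * (E0 + 2) + 2) * ((8 * b) `^ kappa + B * (8 * b) `^ q).
  exact: (clip_approx_Rintegral C0 iota0 kappa0 q0 s1 vs qs holder Mv0 zeta2_int_v zeta2_mom_v
    H_zeta2_meas (ltW B0) b80 mX2 HX2 D21 D22).
have e5 : `|0 - a5| <= C `^ s * E0 * B `^ (1 - s).
  rewrite -[X in X - a5]Rintegral_prod4_isolated.
  exact: (clip_tail_Rintegral C0 iota0 s1 vs growth zeta2_int_v zeta2_mom_v H_zeta2_meas B0).
have -> : 2 * (C `^ s * E0) * B `^ (1 - s) +
  2 * (#|I|%:R * (C * (E0 + 2) + 2)) * ((8 * b) `^ kappa + B * (8 * b) `^ q) + 6 * phi_mix P Fam r * B
  = 2 * (C `^ s * E0 * B `^ (1 - s))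
    + 2 * (#|I|%:R * (C * (E0 + 2) + 2) * ((8 * b) `^ kappa + B * (8 * b) `^ q))
    + 6 * phi_mix P Fam r * B by ring.
exact: (chain_dist_le e12 e23 e34 e45 e5).
Qed.

End Isolated.
End Core.

(** * Choice of the clipping level and of the exponent *)

Section Optimize.
Context {R : realType}.

(* The clipping level is [B = e ^ (-1/(s-1))] with [e = phi ^ (1-1/s) + b ^ kappa]. *)
Lemma optimize_clip (phi b s kappa q a0 a1 a2 a3 X : R) :
  0 <= phi -> 0 < b -> 1 < s -> 0 < kappa -> 0 < q -> kappa * s <= q * (s - 1) ->
  0 <= a0 -> 0 <= a1 -> 0 <= a2 -> 0 <= a3 -> X <= a0 ->
  (forall B, 0 < B -> X <= a1 * B `^ (1 - s)
     + a2 * ((8 * b) `^ kappa + B * (8 * b) `^ q) + a3 * phi * B) ->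
  X <= (a0 + a1 + a2 * (8 `^ kappa + 8 `^ q) + a3) * (phi `^ (1 - s^-1) + b `^ kappa).
Proof.
move=> phi0 b0 s1 k0 q0 qs a00 a10 a20 a30 Xa0 hX.
set e := phi `^ _ + _.
have bk0 : 0 < b `^ kappa by exact: powR_gt0.
have e0 : 0 < e by rewrite ltr_wpDl ?powR_ge0.
have c80 : 0 <= 8 `^ kappa + 8 `^ q :> R by rewrite addr_ge0 ?powR_ge0.
(* For [e > 1] the trivial bound [a0] suffices; below, [e <= 1] allows exponents to be lowered. *)
have [e1|e1] := ltP 1 e.
  apply: (le_trans Xa0); rewrite -[leLHS]mulr1 ler_pM ?(ltW e1) //.
  by rewrite -!addrA lerDl !addr_ge0 // mulr_ge0.
have s0 : 0 < s by exact: lt_trans s1.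
have s10 : 0 < s - 1 by rewrite subr_gt0.
have s1n : s - 1 != 0 by rewrite gt_eqF.
pose B := e `^ (- (s - 1)^-1).
have B0 : 0 < B by exact: powR_gt0.
have Be : B `^ (1 - s) = e.
  rewrite /B -powRrM (_ : _ * _ = 1) ?powRr1 ?(ltW e0) //.
  by rewrite -(opprB s) mulrNN mulVf.
have Bphi : phi * B <= e.
  apply: (@le_trans _ _ (e `^ (s / (s - 1)) * B)).
    rewrite ler_wpM2r ?(ltW B0) //.
    have -> : phi = (phi `^ (1 - s^-1)) `^ (s / (s - 1)).
      rewrite -powRrM (_ : _ * _ = 1) ?powRr1 //.
      by field; rewrite s1n gt_eqF.
    apply: ge0_ler_powR; rewrite ?nnegrE ?powR_ge0 ?(ltW e0) //.
      by rewrite divr_ge0 // ltW.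
    by rewrite /e lerDl ltW.
  rewrite /B -powRD ?(gt_eqF e0) ?implybT // (_ : _ + _ = 1) ?powRr1 ?(ltW e0) //.
  by field.
(* Since [b ^ kappa <= e], the left side is at most [e] to the power [q/kappa - 1/(s-1)], which is
   at least 1 by [kappa * s <= q * (s - 1)]. *)
have Bbq : B * b `^ q <= e.
  apply: (@le_trans _ _ (B * e `^ (q / kappa))).
    rewrite ler_wpM2l ?(ltW B0) //.
    have -> : b `^ q = (b `^ kappa) `^ (q / kappa).
      by rewrite -powRrM mulrCA divff ?mulr1 // gt_eqF.
    apply: ge0_ler_powR; rewrite ?nnegrE ?powR_ge0 ?(ltW e0) //.
      by rewrite divr_ge0 // ltW.
    by rewrite /e lerDr powR_ge0.
  rewrite /B -powRD ?(gt_eqF e0) ?implybT //.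
  apply: ge1r_powR; first by rewrite e0.
  suff : 1 + (s - 1)^-1 <= q / kappa by lra.
  have -> : 1 + (s - 1)^-1 = s / (s - 1) by field.
  by rewrite ler_pdivlMr // mulrAC ler_pdivrMr // mulrC.
apply: (le_trans (hX B B0)).
have -> : (a0 + a1 + a2 * (8 `^ kappa + 8 `^ q) + a3) * e =
  a0 * e + (a1 * e + a2 * ((8 `^ kappa + 8 `^ q) * e) + a3 * e) by ring.
rewrite -[leLHS]add0r; apply: lerD; first by rewrite mulr_ge0 // ltW.
rewrite Be -mulrA; apply: lerD; last by rewrite ler_wpM2l.
rewrite lerD2l ler_wpM2l // !powRM ?(ltW b0) // [leRHS]mulrDl; apply: lerD.
  by rewrite ler_wpM2l ?powR_ge0 // /e lerDr powR_ge0.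
by rewrite mulrCA ler_wpM2l ?powR_ge0.
Qed.

Lemma le_of_add_eps (X A c : R) : 0 <= c -> (forall e, 0 < e -> X <= A + c * e) -> X <= A.
Proof.
move=> c0 h; apply/ler_addgt0Pr => e e0.
have c10 : 0 < c + 1 by rewrite ltr_wpDl.
apply: (le_trans (h (e / (c + 1)) (divr_gt0 e0 c10))).
rewrite lerD2l mulrCA ler_piMr ?(ltW e0) // ler_pdivrMr // mul1r lerDl.
by [].
Qed.

End Optimize.

Section IsolatedBound.
Context {R : realType} {d} {T : measurableType d} (P : probability T R).
Variables (p : nat) (xi : nat -> T -> p.-tuple R) (Fam : \bar int -> \bar int -> set (set T)).
Variable mu : probability (p.-tuple R) R.
Local Notation V := (p.-tuple R).
Hypothesis xi_meas : forall n, measurable_fun setT (xi n).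
Hypothesis Fam_sigma : forall k m, (k <= m)%E ->
  sigma_algebra [set: T] (Fam k m) /\ Fam k m `<=` measurable.
Hypothesis Fam_mono : forall k m k' m', (k <= m)%E -> (k' <= k)%E -> (m <= m')%E ->
  Fam k m `<=` Fam k' m'.
Hypothesis xi_law : forall n (A : set V), measurable A -> P (xi n @^-1` A) = mu A.

Variables (iota kappa w q v : R).
Hypotheses (iota0 : 0 <= iota) (kappa0 : 0 < kappa) (q1 : 1 <= q) (w4 : 4 < w) (v0 : 0 < v).
Hypothesis wvq : iota / v + kappa / q < w^-1.
Hypothesis mu_v : mu.-integrable setT (EFin \o (fun y => vnorm y `^ v)).
Hypothesis mu_q : mu.-integrable setT (EFin \o (fun y => vnorm y `^ q)).
Variables (l : nat) (f : l.+1.-tuple V -> R) (K : R).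
Hypotheses (K0 : 0 <= K) (reg : regular f K iota kappa).
Hypothesis centered : forall x : l.-tuple V, \int[mu]_y f [tuple of rcons x y] = 0.

Let q0 : 0 < q. Proof. exact: lt_le_trans q1. Qed.
Let w0 : 0 < w. Proof. exact: lt_trans w4. Qed.
(** Then [1/(4s) = 1/w - kappa/q] exceeds [iota/v], which is the moment condition, and
    [1 - 1/s = (1 - 4/w) + 4 kappa/q] is above both [kappa/q] and [1 - 4/w]. The choice [s = w/4]
    could violate the comparison with [kappa/q] when [w] is near 4. *)
Let s : R := (4 / w - 4 * kappa / q)^-1.

Let s_spec : [/\ 1 < s, 4 * iota * s <= v, kappa * s <= q * (s - 1) & s^-1 <= 4 / w].
Proof.
have kq0 : 0 < kappa / q by rewrite divr_gt0.
have iv0 : 0 <= iota / v by rewrite divr_ge0 // ltW.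
have w1 : 4 / w < 1 by rewrite ltr_pdivrMr // mul1r.
have u0 : 0 < 4 / w - 4 * kappa / q.
  by rewrite -!mulrA -mulrBr mulr_gt0 // subr_gt0; move: wvq; lra.
have sV : s^-1 = 4 / w - 4 * kappa / q by rewrite /s invrK.
have s0 : 0 < s by rewrite invr_gt0.
have uE : 4 / w - 4 * kappa / q = 4 * (w^-1 - kappa / q) by ring.
split; last by rewrite sV uE; move: kq0; lra.
- by rewrite -(invf_lt1 s0) sV uE; move: kq0 w1; lra.
- rewrite -ler_pdivlMr // sV uE -subr_ge0.
  have -> : v * (4 * (w^-1 - kappa / q)) - 4 * iota = 4 * v * (w^-1 - kappa / q - iota / v).
    by field; rewrite !gt_eqF.
  by rewrite mulr_ge0 ?mulr_ge0 ?(ltW v0) //; move: wvq; lra.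
- rewrite mulrBr mulr1 -subr_ge0.
  have -> : q * s - q - kappa * s = q * s * (1 - s^-1 - kappa / q) .
    by field; rewrite (gt_eqF q0) (gt_eqF s0).
  rewrite mulr_ge0 ?mulr_ge0 ?(ltW q0) ?(ltW s0) // sV uE.
  by move: kq0 w1; lra.
Qed.

Lemma isolated_bound : exists C1 : R, 0 <= C1 /\
  (forall t : idx l.+1 -> nat,
    P.-integrable setT (EFin \o (fun x => prod4 f (fun i => xi (t i) x))) /\
    `|\int[P]_x prod4 f (fun i => xi (t i) x)| <= C1) /\
  (forall (t : idx l.+1 -> nat) (k0 : 'I_4) (r : nat) (beta : R),
    (forall i, i != (k0, ord_max) ->
      (t i + 3 * r <= t (k0, ord_max))%N || (t (k0, ord_max) + 3 * r <= t i)%N) ->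
    0 <= beta -> (forall i, (cond_dev P Fam xi q (t i) r <= beta%:E)%E) ->
    `|\int[P]_x prod4 f (fun i => xi (t i) x)| <=
      C1 * (phi_mix P Fam r `^ (1 - 4 / w) + beta `^ kappa)).
Proof.
have [s1 vs qs sw] := s_spec.
have s0 : 0 < s by exact: lt_trans s1.
pose C := prod4_const l.+1 K iota.
pose Mv := \int[mu]_y vnorm y `^ v.
pose E0 : R := #|idx l.+1|.+1%:R `^ (4 * s) * (1 + #|idx l.+1|%:R * (1 + Mv)).
have C0 : 0 <= C by exact: prod4_const_ge0.
have Mv0 : 0 <= Mv by apply: Rintegral_ge0 => y _; exact: powR_ge0.
have E00 : 0 <= E0 by rewrite mulr_ge0 ?powR_ge0 ?addr_ge0 ?mulr_ge0 ?addr_ge0.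
pose a0 := C * E0.
pose a1 := 2 * (C `^ s * E0).
pose a2 := 2 * (#|idx l.+1|%:R * (C * (E0 + 2) + 2)).
have a00 : 0 <= a0 by exact: mulr_ge0.
have a10 : 0 <= a1 by rewrite mulr_ge0 // mulr_ge0 // powR_ge0.
have a20 : 0 <= a2 by rewrite mulr_ge0 // mulr_ge0 // addr_ge0 // mulr_ge0 // addr_ge0.
pose C1 := a0 + a1 + a2 * (8 `^ kappa + 8 `^ q) + 6.
have C10 : 0 <= C1 by rewrite !addr_ge0 // mulr_ge0 // addr_ge0 // powR_ge0.
have a0C1 : a0 <= C1.
  by rewrite /C1 -!addrA lerDl !addr_ge0 // mulr_ge0 // addr_ge0 // powR_ge0.
have basic t := @integrable_prod4_xi _ _ _ P _ xi mu xi_meas xi_law iota kappa s v iota0 kappa0 s1 vs mu_v l f K K0 reg t.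
exists C1; split => //; split => [t|t k0 r beta sep beta0 hbeta].
  by have [h1 h2] := basic t; split => //; exact: le_trans a0C1.
set X := `|_|.
have /andP[phi0 phi1] := phi_mix_bounds P Fam_sigma r.
set phi := phi_mix P Fam r in phi0 phi1 *.
(* The coefficient is at most 1, so the smaller exponent [1 - 4/w] gives the larger power; at 0 both
   powers vanish because both exponents are positive. *)
have phi_le : phi `^ (1 - s^-1) <= phi `^ (1 - 4 / w).
  have e1 : 0 < 1 - 4 / w by rewrite subr_gt0 ltr_pdivrMr // mul1r.
  have e2 : 0 < 1 - s^-1 by rewrite subr_gt0 invf_lt1.
  have [->|phin0] := eqVneq phi 0; first by rewrite !powR0 ?gt_eqF.
  apply: ger_powR; first by rewrite lt_neqAle eq_sym phin0 phi0 phi1.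
  by rewrite lerB.
apply: (le_trans (y := C1 * (phi `^ (1 - s^-1) + beta `^ kappa))); last first.
  by rewrite ler_wpM2l // lerD2r.
apply: (le_of_add_eps C10) => e e0.
have bk0 : 0 <= beta `^ kappa by exact: powR_ge0.
(* A number strictly above [beta], as the approximation requires ([beta] may be 0), chosen so that
   its excess is exactly [e] after taking the power [kappa]. *)
pose b := (beta `^ kappa + e) `^ kappa^-1.
have be0 : 0 < beta `^ kappa + e by rewrite ltr_wpDl.
have b0 : 0 < b by exact: powR_gt0.
have bk : b `^ kappa = beta `^ kappa + e.
  by rewrite /b -powRrM mulVf ?gt_eqF // powRr1 // ltW.
have betab : beta < b.
  have -> : beta = (beta `^ kappa) `^ kappa^-1 by rewrite -powRrM divff ?gt_eqF // powRr1.
  by apply: gt0_ltr_powR; rewrite ?nnegrE ?invr_gt0 ?(ltW be0) // ltrDl.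
have hb i : (cond_dev P Fam xi q (t i) r < b%:E)%E.
  by apply: le_lt_trans (hbeta i) _; rewrite lte_fin.
rewrite -mulrDr -addrA -bk.
apply: optimize_clip => //.
  by have [] := basic t.
move=> B B0.
exact: (prod4_clip_bound xi_meas Fam_sigma Fam_mono xi_law iota0 kappa0 q1 s1 vs qs mu_v mu_q K0 reg centered sep b0 B0 hb).
Qed.

End IsolatedBound.

(** * Fourth moments *)

Lemma exists_le_sum (J : finType) (Q : pred J) : ([exists i, Q i] <= \sum_i Q i)%N.
Proof.
by case: existsP => // -[i Qi]; rewrite (bigD1 i) //= Qi.
Qed.

Lemma near_nat_mono m a b : near_nat m a b -> near_nat m.+1 a b.
Proof. by rewrite /near_nat; lia. Qed.

Lemma near_nat_full m a b : (a <= m)%N -> (b <= m)%N -> near_nat m a b.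
Proof. by rewrite /near_nat; lia. Qed.

Lemma not_near_nat m a b : ~~ near_nat m a b -> (a + m <= b)%N || (b + m <= a)%N.
Proof. by rewrite /near_nat; lia. Qed.

Lemma sum4_prod (R : comPzRingType) N (y : 'I_N -> R) :
  (\sum_n y n) ^+ 4 = \sum_a \sum_b \sum_c \sum_d \prod_(k < 4) y (quad a b c d k).
Proof.
have E a b c d : \prod_(k < 4) y (quad a b c d k) = y a * (y b * (y c * y d)).
  by rewrite !big_ord_recl big_ord0 /quad !(tnth_nth a) /= mulr1.
transitivity (\sum_a \sum_b \sum_c \sum_d y a * (y b * (y c * y d))); last first.
  by do 4 (apply: eq_bigr => ? _); rewrite E.
rewrite !exprS expr0 mulr1 mulr_suml; apply: eq_bigr => a _.
rewrite [in LHS]mulr_suml mulr_sumr; apply: eq_bigr => b _.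
rewrite [in LHS]mulr_suml !mulr_sumr; apply: eq_bigr => c _.
by rewrite !mulr_sumr.
Qed.

Section FourthMoment.
Context {R : realType} {d} {T : measurableType d} (P : probability T R).
Variables (p : nat) (xi : nat -> T -> p.-tuple R) (Fam : \bar int -> \bar int -> set (set T)).
Variables (q w kappa : R) (l : nat) (f : l.+1.-tuple (p.-tuple R) -> R) (C1 S : R).
Variable beta : nat -> R.
Hypothesis C10 : 0 <= C1.
Hypothesis basic : forall t : idx l.+1 -> nat,
    P.-integrable setT (EFin \o (fun x => prod4 f (fun i => xi (t i) x))) /\
    `|\int[P]_x prod4 f (fun i => xi (t i) x)| <= C1.
Hypothesis iso : forall (t : idx l.+1 -> nat) (k0 : 'I_4) (r : nat) (beta : R),
    (forall i, i != (k0, ord_max) ->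
      (t i + 3 * r <= t (k0, ord_max))%N || (t (k0, ord_max) + 3 * r <= t i)%N) ->
    0 <= beta -> (forall i, (cond_dev P Fam xi q (t i) r <= beta%:E)%E) ->
    `|\int[P]_x prod4 f (fun i => xi (t i) x)| <=
      C1 * (phi_mix P Fam r `^ (1 - 4 / w) + beta `^ kappa).
Hypothesis beta_ge0 : forall r, 0 <= beta r.
Hypothesis beta_dev : forall r k, (0 < r)%N -> (cond_dev P Fam xi q k r <= (beta r)%:E)%E.
Let eps r := phi_mix P Fam r `^ (1 - 4 / w) + beta r `^ kappa.
Hypothesis sum_eps : forall n, \sum_(1 <= r < n) r%:R * eps r <= S.

Variables (N Cn : nat) (tm : 'I_l.+1 -> nat -> nat).
Hypothesis count_self : forall m (i : 'I_l),
  (\sum_(n < N) near_nat m (tm ord_max n) (tm (widen_ord (leqnSn l) i) n) <= Cn * m.+1)%N.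
Hypothesis count_close : forall m t, (\sum_(n < N) near_nat m (tm ord_max n) t <= 2 * m + 1)%N.

Let self m (n : 'I_N) :=
  [exists i : 'I_l, near_nat m (tm ord_max n) (tm (widen_ord (leqnSn l) i) n)].
Let close m (n n' : 'I_N) := [exists i : 'I_l.+1, near_nat m (tm ord_max n) (tm i n')].
Let t (g : 'I_4 -> 'I_N) (i : idx l.+1) := tm i.2 (g i.1).
Let Y (n : nat) x := f [tuple xi (tm i n) x | i < l.+1].

Let sumE x : (\sum_(n < N) Y n x) ^+ 4 =
  \sum_a \sum_b \sum_c \sum_d prod4 f (fun i => xi (t (quad a b c d) i) x).
Proof. by rewrite (sum4_prod (fun n : 'I_N => Y n x)). Qed.

Lemma integrable_fourth_power :
  P.-integrable setT (EFin \o (fun x => (\sum_(n < N) Y n x) ^+ 4)).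
Proof.
rewrite (_ : (fun x => _ ^+ 4) = fun x =>
  \sum_a \sum_b \sum_c \sum_d prod4 f (fun i => xi (t (quad a b c d) i) x)); last first.
  by apply/funext => x; exact: sumE.
do 4 apply: integrable_real_sum => ?; exact: (basic _).1.
Qed.

(** Here [quad_sum_bound] is applied with [Cn * l], from the [l] comparisons inside one entry, plus
    [2 * l.+1], from the [l.+1] comparisons with another entry. The rank at which everything is
    close is taken as the sum of all times. *)
Lemma fourth_moment_le : \int[P]_x (\sum_(n < N) Y n x) ^+ 4 <=
  (24 * (Cn * l + 2 * l.+1) ^ 2)%:R * (16 * C1 + 98 * (C1 * S)) * N%:R ^+ 2.
Proof.
pose e g := `|\int[P]_x prod4 f (fun i => xi (t g i) x)|.
apply: (@le_trans _ _ (\sum_a \sum_b \sum_c \sum_d e (quad a b c d))).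
  rewrite (_ : (fun x => _ ^+ 4) = fun x =>
    \sum_a \sum_b \sum_c \sum_d prod4 f (fun i => xi (t (quad a b c d) i) x)); last first.
    by apply/funext => x; exact: sumE.
  rewrite Rintegral_sum => [|a]; last by do 3 apply: integrable_real_sum => ?; exact: (basic _).1.
  apply: ler_sum => a _.
  rewrite Rintegral_sum => [|b]; last by do 2 apply: integrable_real_sum => ?; exact: (basic _).1.
  apply: ler_sum => b _.
  rewrite Rintegral_sum => [|c]; last by apply: integrable_real_sum => ?; exact: (basic _).1.
  apply: ler_sum => c _.
  rewrite Rintegral_sum => [|z]; last exact: (basic _).1.
  by apply: ler_sum => z _; exact: ler_norm.
rewrite -[X in X%:R ^+ 2](card_ord N).
apply: (@quad_sum_bound R _ self close _ (\sum_i \sum_(n < N) tm i n) e C1 (C1 * S) (fun r => C1 * eps r)).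
- by move=> m a /existsP[i h]; apply/existsP; exists i; exact: near_nat_mono.
- by move=> m a b /existsP[i h]; apply/existsP; exists i; exact: near_nat_mono.
- move=> m a b mm; apply/existsP; exists ord_max; apply: near_nat_full; apply: leq_trans mm.
    by rewrite (bigD1 ord_max) //= (bigD1 a) //= -!addnA leq_addr.
  by rewrite (bigD1 ord_max) //= (bigD1 b) //= -!addnA leq_addr.
- move=> m; apply: (@leq_trans (\sum_(a < N) \sum_(i < l) near_nat m (tm ord_max a) (tm (widen_ord (leqnSn l) i) a))).
    by apply: leq_sum => a _; exact: exists_le_sum.
  rewrite exchange_big /=; apply: (@leq_trans (\sum_(i < l) Cn * m.+1)).
    by apply: leq_sum => i _; exact: count_self.
  by rewrite sum_nat_const card_ord; lia.
- move=> m b; apply: (@leq_trans (\sum_(a < N) \sum_(i < l.+1) near_nat m (tm ord_max a) (tm i b))).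
    by apply: leq_sum => a _; exact: exists_le_sum.
  rewrite exchange_big /=; apply: (@leq_trans (\sum_(i < l.+1) (2 * m + 1))).
    by apply: leq_sum => i _; exact: count_close.
  rewrite sum_nat_const card_ord; nia.
- by move=> g; rewrite /e normr_ge0; exact: (basic _).2.
- by move=> r; rewrite mulr_ge0 // addr_ge0 // powR_ge0.
- move=> n; under eq_bigr do rewrite mulrCA.
  by rewrite -mulr_sumr ler_wpM2l.
- move=> r g r0 /existsP[k /andP[/existsPn h1 /forallP h2]].
  apply: (iso (k0 := k)) => // [[k' i] ne|i]; last exact: beta_dev.
  rewrite /t /= orbC; apply: not_near_nat.
  (* Times of another entry are kept away by [close], the other times of the entry [k] by [self]. *)
  have [k'k|k'k] := eqVneq k' k; last first.
    by have := h2 k'; rewrite k'k /= => /existsPn.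
  rewrite k'k in ne *; move: ne; move: i; apply: ord_last_case => [|i _]; first by rewrite eqxx.
  exact: h1.
Qed.

End FourthMoment.

(** * Almost sure convergence *)

Section AlmostSure.
Context {R : realType} {d} {T : measurableType d} (P : probability T R).

(** Sum and integral commute for nonnegative terms, so the series has a finite integral, is finite
    almost everywhere, and its terms tend to 0. *)
Lemma ae_cvg0_of_summable (g : nat -> T -> R) (M : R) :
  (forall n x, 0 <= g n x) -> (forall n, P.-integrable setT (EFin \o g n)) ->
  (forall n, \sum_(0 <= k < n) \int[P]_x g k x <= M) ->
  {ae P, forall x, g n x @[n --> \oo] --> 0}.
Proof.
move=> g0 ig hM.
have mg n : measurable_fun setT (EFin \o g n) by have /integrableP[] := ig n.
have mser : measurable_fun setT (fun x => \sum_(0 <= n <oo) (g n x)%:E)%E.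
  have h0 k x : setT x -> xpredT k -> (0 <= (EFin \o g k) x)%E by rewrite lee_fin.
  exact: (ge0_emeasurable_sum (P := xpredT) h0 (fun k _ => mg k)).
have ser0 x : (0 <= \sum_(0 <= n <oo) (g n x)%:E)%E.
  by apply: nneseries_ge0 => n _ _; rewrite lee_fin.
have fin : (\int[P]_x (\sum_(0 <= n <oo) (g n x)%:E) < +oo)%E.
  rewrite (integral_nneseries _ measurableT mg); last by move=> n x _; rewrite lee_fin.
  apply: (@le_lt_trans _ _ M%:E); last exact: ltry.
  apply: lime_le.
    by apply: is_cvg_nneseries => n _ _; apply: integral_ge0 => x _; rewrite lee_fin.
  apply: nearW => n; have := hM n; rewrite -lee_fin; apply: le_trans; rewrite -sumEFin le_eqVlt; apply/predU1P; left.
  apply: eq_bigr => k _; rewrite /Rintegral fineK //.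
  by apply: integrable_fin_num => //; exact: ig.
have iser : P.-integrable setT (fun x => \sum_(0 <= n <oo) (g n x)%:E)%E.
  apply/integrableP; split => //.
  apply: le_lt_trans fin; rewrite le_eqVlt; apply/predU1P; left.
  by apply: eq_integral => x _; rewrite gee0_abs.
apply: filterS (integrable_ae measurableT iser) => x /(_ I) finx.
apply: cvg_series_cvg_0; apply: nondecreasing_is_cvgn.
  by apply/nondecreasing_seqP => n; rewrite seriesSr lerDl.
exists (fine (\sum_(0 <= n <oo) (g n x)%:E)%E) => _ [n _ <-].
rewrite -lee_fin fineK // /series /= -sumEFin.
by apply: nneseries_lim_ge => k _; rewrite lee_fin.
Qed.

Lemma sum_inv_sq_le n : \sum_(0 <= k < n) (k.+1%:R ^- 2) <= 2 :> R.
Proof.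
(* Strengthened so that the induction telescopes; at [n = 0] the convention [0^-1 = 0] makes the
   bound 2. *)
suff : \sum_(0 <= k < n) (k.+1%:R ^- 2) <= 2 - n%:R^-1 :> R.
  by move=> /le_trans; apply; rewrite lerBlDr lerDl invr_ge0.
elim: n => [|n IH]; first by rewrite big_geq // invr0 subr0.
rewrite big_nat_recr //=; case: n IH => [|n] IH.
  by rewrite big_geq // add0r expr1n invr1; lra.
apply: (le_trans (lerD IH (lexx _))).
rewrite -lerBrDl opprB addrC -addrA addrA [leRHS](_ : _ = n.+1%:R^-1 - n.+2%:R^-1); last by ring.
have n1 : (0 : R) < n.+1%:R by rewrite ltr0n.
have n2 : (0 : R) < n.+2%:R by rewrite ltr0n.
have -> : n.+1%:R^-1 - n.+2%:R^-1 = (n.+1%:R * n.+2%:R)^-1 :> R.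
  rewrite -[n.+2]addn1 natrD; field.
  by rewrite gt_eqF //= natr1 gt_eqF.
by rewrite lef_pV2 ?posrE ?exprn_gt0 ?mulr_gt0 // expr2 ler_pM2r // ler_nat.
Qed.

(** The fourth power of the mean has expectation at most [M / N^2], a summable bound. The index is
    shifted to avoid division by 0, and the terms below [N0], about which nothing is known, are set
    to 0. *)
Lemma ae_mean_cvg0 (S : nat -> T -> R) (N0 : nat) (M : R) : 0 <= M ->
  (forall N, (N0 <= N)%N -> P.-integrable setT (EFin \o (fun x => S N x ^+ 4)) /\
     \int[P]_x S N x ^+ 4 <= M * N%:R ^+ 2) ->
  {ae P, forall x, N%:R^-1 * S N x @[N --> \oo] --> 0}.
Proof.
move=> M0 hS.
pose g N x : R := if (N0 <= N.+1)%N then N.+1%:R ^- 4 * S N.+1 x ^+ 4 else 0.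
have g0 N x : 0 <= g N x.
  rewrite /g; case: ifP => // _; by rewrite mulr_ge0 ?invr_ge0 ?exprn_even_ge0.
have ig N : P.-integrable setT (EFin \o g N).
  rewrite /g; case: (boolP (N0 <= N.+1)%N) => [h|_]; last exact: integrable_real_cst.
  by apply: integrable_realZ; exact: (hS _ h).1.
have hg N : \int[P]_x g N x <= M * N.+1%:R ^- 2.
  rewrite /g; case: (boolP (N0 <= N.+1)%N) => [h|_]; last first.
    by rewrite Rintegral_cst // mul0r mulr_ge0 // invr_ge0 exprn_ge0.
  rewrite (RintegralZl _ measurableT (hS _ h).1).
  have n1 : (0 : R) < N.+1%:R by rewrite ltr0n.
  apply: (@le_trans _ _ (N.+1%:R ^- 4 * (M * N.+1%:R ^+ 2))).
    by rewrite ler_wpM2l ?invr_ge0 ?exprn_ge0 //; exact: (hS _ h).2.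
  rewrite le_eqVlt; apply/predU1P; left; field.
  by rewrite addrC natr1 gt_eqF.
have := @ae_cvg0_of_summable g (M * 2) g0 ig _.
have hM n : \sum_(0 <= k < n) \int[P]_x g k x <= M * 2.
  apply: (@le_trans _ _ (\sum_(0 <= k < n) M * k.+1%:R ^- 2)); first by apply: ler_sum.
  by rewrite -mulr_sumr ler_wpM2l // sum_inv_sq_le.
move=> /(_ hM); apply: filterS => x cg.
rewrite -cvg_shiftS /=; apply/cvgr0Pnorm_lt => e e0.
have e40 : 0 < e ^+ 4 by rewrite exprn_gt0.
move/cvgr0Pnorm_lt: cg => /(_ _ e40) cg.
near=> N.
have NN0 : (N0 <= N.+1)%N.
  by apply: leqW; near: N; exact: nbhs_infty_ge.
have : `|g N x| < e ^+ 4 by near: N.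
rewrite /g NN0 -exprVn -exprMn normrX => h.
by rewrite -(ltr_pXn2r (n := 4)) // ?nnegrE // ltW.
Unshelve. all: by end_near.
Qed.

End AlmostSure.

(** * Integrating out the last variable *)

Lemma iter_integral_rcons {R : realType} {d} {V : measurableType d}
    (mu : {measure set V -> \bar R}) (l : nat) (F : l.+1.-tuple V -> R) :
  iter_integral mu F = iter_integral mu (fun x : l.-tuple V => \int[mu]_y F [tuple of rcons x y]).
Proof.
(* The last variable is already the innermost one in [iter_integral], so no exchange of integrals is
   involved. *)
elim: l F => [|l IH] F.
  rewrite /=; congr (Rintegral mu setT _); apply/funext => y; congr F; exact: val_inj.
rewrite [LHS]/= [RHS]/=; congr (Rintegral mu setT _); apply/funext => x.
rewrite -[LHS]/(iter_integral mu (fun t => F (cons_tuple x t))) IH.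
congr (iter_integral mu _); apply/funext => t.
by congr (Rintegral mu setT _); apply/funext => y; congr F; exact: val_inj.
Qed.

Section Peeling.
Context {R : realType} {p l : nat} (mu : probability (p.-tuple R) R).
Local Notation V := (p.-tuple R).
Variables (F : l.+1.-tuple V -> R) (K iota kappa v : R).
Hypotheses (K0 : 0 <= K) (iota0 : 0 <= iota) (kappa0 : 0 < kappa) (iv : iota <= v).
Hypothesis mu_v : mu.-integrable setT (EFin \o (fun y => vnorm y `^ v)).
Hypothesis reg : regular F K iota kappa.

Definition front (x : l.+1.-tuple V) : l.-tuple V := [tuple tnth x (widen_ord (leqnSn l) i) | i < l].
Definition integrate_last (x : l.-tuple V) : R := \int[mu]_y F [tuple of rcons x y].
Definition center_last (x : l.+1.-tuple V) : R := F x - integrate_last (front x).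

Let int_rcons (x : l.-tuple V) : mu.-integrable setT (EFin \o (fun y => F [tuple of rcons x y])).
Proof. exact: (integrable_rcons x K0 iota0 kappa0 iv reg mu_v). Qed.

Let mu_iota : mu.-integrable setT (EFin \o (fun y => vnorm y `^ iota)).
Proof.
have mid : measurable_fun setT (id : V -> V) by exact: measurable_id.
have [] // := @dominated_Rintegral _ _ _ mu (fun y => vnorm y `^ iota) (fun y => 1 + vnorm y `^ v).
- by apply: measurable_powR_comp; exact: measurable_vnorm.
- by apply: integrable_realD => //; exact: integrable_real_cst.
- by move=> y; rewrite ger0_norm ?powR_ge0 // powR_le1D // vnorm_ge0.
Qed.

Let Mi : R := \int[mu]_y vnorm y `^ iota.
Let Mi0 : 0 <= Mi. Proof. by apply: Rintegral_ge0 => y _; exact: powR_ge0. Qed.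
Definition peel_const : R := K * (1 + 2 * Mi).

Lemma peel_const_ge0 : 0 <= peel_const.
Proof. by rewrite mulr_ge0 // addr_ge0 // mulr_ge0. Qed.

Lemma regular_integrate_last : regular integrate_last peel_const iota kappa.
Proof.
split => [x z|x].
  set A := \sum_(i < l) (_ + _); set B := \sum_(i < l) _.
  have A0 : 0 <= A by rewrite sumr_ge0 // => i _; rewrite addr_ge0 ?powR_ge0.
  have B0 : 0 <= B by rewrite sumr_ge0 // => i _; exact: powR_ge0.
  rewrite -RintegralB //.
  have [||//|_] := @dominated_Rintegral _ _ _ mu
    (fun y => F [tuple of rcons x y] - F [tuple of rcons z y])
    (fun y => K * B * (1 + A + 2 * vnorm y `^ iota)).
  - apply: measurable_funB; apply/measurable_EFinP.
      by have /integrableP[] := int_rcons x.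
    by have /integrableP[] := int_rcons z.
  - apply: integrable_realZ; apply: integrable_realD; first exact: integrable_real_cst.
    exact: integrable_realZ.
  - move=> y; apply: (le_trans (reg.1 _ _)).
    (* Both arguments share their last entry [y], so its Hölder term is [0 ^ kappa = 0]; in the
       weight [y] occurs twice, which is the 2 of [peel_const]. *)
    rewrite !big_ord_recr /= !tnth_rcons_max vdistxx powR0 ?gt_eqF // addr0.
    under eq_bigr do rewrite !tnth_rcons_widen.
    under [X in _ * X <= _]eq_bigr do rewrite !tnth_rcons_widen.
    by rewrite -/A -/B le_eqVlt; apply/predU1P; left; ring.
  move=> h; apply: (le_trans h).
  rewrite RintegralZl //; last first.
    apply: integrable_realD; first exact: integrable_real_cst.
    exact: integrable_realZ.
  rewrite RintegralD //; [|exact: integrable_real_cst|exact: integrable_realZ].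
  rewrite RintegralZl // Rintegral_cst // (_ : fine (mu setT) = 1); last exact: (prb_setT mu).
  rewrite mulr1 -/Mi /peel_const.
  have -> : K * (1 + 2 * Mi) * (1 + A) * B = K * B * (1 + A + 2 * Mi) + K * B * (2 * Mi * A) by ring.
  by rewrite lerDl !mulr_ge0.
set A := \sum_(i < l) _; have A0 : 0 <= A by rewrite sumr_ge0 // => i _; exact: powR_ge0.
have [||//|_] := @dominated_Rintegral _ _ _ mu (fun y => F [tuple of rcons x y])
    (fun y => K * (1 + A + vnorm y `^ iota)).
- by apply/measurable_EFinP; have /integrableP[] := int_rcons x.
- by apply: integrable_realZ; apply: integrable_realD => //; exact: integrable_real_cst.
- move=> y; apply: (le_trans (reg.2 _)).
  rewrite !big_ord_recr /= !tnth_rcons_max.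
  under eq_bigr do rewrite !tnth_rcons_widen.
  by rewrite -/A addrA.
move=> h; apply: (le_trans h).
rewrite RintegralZl //; last by apply: integrable_realD => //; exact: integrable_real_cst.
rewrite RintegralD //; last exact: integrable_real_cst.
rewrite Rintegral_cst // (_ : fine (mu setT) = 1); last exact: (prb_setT mu).
rewrite mulr1 -/Mi /peel_const -mulrA ler_wpM2l //.
have := mulr_ge0 Mi0 A0; move: Mi0 A0; lra.
Qed.

Lemma regular_center_last : regular center_last (K + peel_const) iota kappa.
Proof.
have [h1 h2] := regular_integrate_last.
have kl0 := peel_const_ge0.
split => [x z|x]; rewrite /center_last.
  have -> : F x - integrate_last (front x) - (F z - integrate_last (front z))
    = (F x - F z) - (integrate_last (front x) - integrate_last (front z)) by ring.
  apply: (le_trans (ler_normB _ _)); rewrite !mulrDl; apply: lerD; first exact: reg.1.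
  apply: (le_trans (h1 _ _)); apply: ler_pM.
  - by rewrite mulr_ge0 // addr_ge0 // sumr_ge0 // => i _; rewrite addr_ge0 ?powR_ge0.
  - by rewrite sumr_ge0 // => i _; exact: powR_ge0.
  - rewrite ler_wpM2l // lerD2l [leRHS]big_ord_recr /=.
    under eq_bigr do rewrite !tnth_mktuple.
    by rewrite lerDl addr_ge0 ?powR_ge0.
  - rewrite [leRHS]big_ord_recr /=.
    under eq_bigr do rewrite !tnth_mktuple.
    by rewrite lerDl ?powR_ge0.
apply: (le_trans (ler_normB _ _)); rewrite mulrDl; apply: lerD; first exact: reg.2.
apply: (le_trans (h2 _)); rewrite ler_wpM2l // lerD2l [leRHS]big_ord_recr /=.
under eq_bigr do rewrite !tnth_mktuple.
by rewrite lerDl ?powR_ge0.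
Qed.

Lemma center_last_centered (x : l.-tuple V) : \int[mu]_y center_last [tuple of rcons x y] = 0.
Proof.
have fr y : front [tuple of rcons x y] = x.
  by apply: eq_from_tnth => i; rewrite tnth_mktuple tnth_rcons_widen.
rewrite /center_last; under eq_Rintegral do rewrite fr.
rewrite RintegralB //; last exact: integrable_real_cst.
rewrite Rintegral_cst // (_ : fine (mu setT) = 1); last exact: (prb_setT mu).
by rewrite mulr1 subrr.
Qed.

End Peeling.

Section StrongLaw.
Context {R : realType} {d} {T : measurableType d} (P : probability T R).
Variables (p : nat) (xi : nat -> T -> p.-tuple R) (Fam : \bar int -> \bar int -> set (set T)).
Variable mu : probability (p.-tuple R) R.
Local Notation V := (p.-tuple R).
Hypothesis xi_meas : forall n, measurable_fun setT (xi n).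
Hypothesis Fam_sigma : forall k m, (k <= m)%E ->
  sigma_algebra [set: T] (Fam k m) /\ Fam k m `<=` measurable.
Hypothesis Fam_mono : forall k m k' m', (k <= m)%E -> (k' <= k)%E -> (m <= m')%E ->
  Fam k m `<=` Fam k' m'.
Hypothesis xi_law : forall n (A : set V), measurable A -> P (xi n @^-1` A) = mu A.
Variables (iota kappa w q v : R).
Hypotheses (iota0 : 0 <= iota) (kappa0 : 0 < kappa) (q1 : 1 <= q) (w4 : 4 < w) (v0 : 0 < v).
Hypothesis wvq : iota / v + kappa / q < w^-1.
Hypothesis mu_v : mu.-integrable setT (EFin \o (fun y => vnorm y `^ v)).
Hypothesis mu_q : mu.-integrable setT (EFin \o (fun y => vnorm y `^ q)).
Variables (beta : nat -> R) (S : R).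
Hypothesis beta_ge0 : forall r, 0 <= beta r.
Hypothesis beta_dev : forall r k, (0 < r)%N -> (cond_dev P Fam xi q k r <= (beta r)%:E)%E.
Hypothesis sum_eps : forall n,
  \sum_(1 <= r < n) r%:R * (phi_mix P Fam r `^ (1 - 4 / w) + beta r `^ kappa) <= S.
Variables (D : nat) (c : nat -> nat -> nat -> nat).
Hypothesis c_supp : forall i, bsupp D (c i).

Definition poly_mean l (F : l.-tuple V -> R) (N : nat) (x : T) : R :=
  N%:R^-1 * \sum_(n < N) F [tuple xi (beval D (c i) n.+1 N) x | i < l].

(** The comparisons inside one entry are counted through nonconstant differences of polynomials,
    those between entries through strict monotonicity of the last polynomial in [n]. The threshold
    [Cn + 1] exceeds all counting constants and forces [N > 0]. *)
Lemma centered_strong_law l (f : l.+1.-tuple V -> R) (K : R) :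
  0 <= K -> regular f K iota kappa ->
  (forall x : l.-tuple V, \int[mu]_y f [tuple of rcons x y] = 0) ->
  (exists a b, (0 < a)%N /\ c l a b <> 0%N) ->
  (forall i, (i < l)%N -> exists a b, (0 < a + b)%N /\ c l a b <> c i a b) ->
  {ae P, forall x, poly_mean f N x @[N --> \oo] --> 0}.
Proof.
move=> K0 reg cen cl cdiff.
have [C1 [C10 [basic iso]]] := isolated_bound xi_meas Fam_sigma Fam_mono xi_law iota0 kappa0
  q1 w4 v0 wvq mu_v mu_q K0 reg cen.
have /choice[Ci hCi] : forall i : 'I_l, exists C, forall N m, (C <= N)%N ->
   (\sum_(n < N) near_nat m (beval D (c l) n.+1 N) (beval D (c i) n.+1 N) <= C * m.+1)%N.
  by move=> i; exact: count_near_beval (c_supp _) (c_supp _) (cdiff i (ltn_ord i)).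
pose Cn := \max_i Ci i.
have S0 : 0 <= S by have := sum_eps 0; rewrite big_geq.
pose M : R := (24 * (Cn * l + 2 * l.+1) ^ 2)%:R * (16 * C1 + 98 * (C1 * S)).
have M0 : 0 <= M by apply: mulr_ge0 => //; apply: addr_ge0; do ?apply: mulr_ge0.
apply: (ae_mean_cvg0 (N0 := (Cn + 1)%N) M0) => N NC.
pose tm (i : 'I_l.+1) n := beval D (c i) n.+1 N.
split; first exact: (@integrable_fourth_power _ _ _ P p xi l f C1 basic N tm).
apply: (fourth_moment_le C10 basic iso beta_ge0 beta_dev sum_eps (tm := tm)).
- move=> m i; apply: (@leq_trans (Ci i * m.+1)).
    exact: (hCi _ _ _ (leq_trans (leq_bigmax i) (leq_trans (leq_addr 1 Cn) NC))).
  by rewrite leq_mul2r leq_bigmax orbT.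
- move=> m t; apply: (@count_near_incr N m t (fun n => beval D (c l) n.+1 N)) => n n' nn'.
  have N0 : (0 < N)%N by apply: leq_trans NC; rewrite addn1.
  exact: (beval_ltn N0 (c_supp l) cl).
Qed.

(** The constant [K] is generalized in the induction because integrating out a variable changes it
    to [peel_const]; the exponents [iota] and [kappa], hence the moment condition, are preserved. *)
Lemma poly_strong_law l (F : l.-tuple V -> R) (K : R) :
  0 <= K -> regular F K iota kappa ->
  (forall i, (i < l)%N -> exists a b, (0 < a)%N /\ c i a b <> 0%N) ->
  (forall i j, (i < l)%N -> (j < l)%N -> i <> j ->
     exists a b, (0 < a + b)%N /\ c i a b <> c j a b) ->
  {ae P, forall x, poly_mean F N x @[N --> \oo] --> iter_integral mu F}.
Proof.
have iv : iota <= v.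
  have kq : 0 < kappa / q by rewrite divr_gt0 // (lt_le_trans _ q1).
  have w1 : w^-1 < 1 by rewrite invf_lt1; move: w4; lra.
  have : iota / v <= 1 by move: wvq; lra.
  by rewrite ler_pdivrMr // mul1r.
elim: l F K => [|l IH] F K K0 reg c0 cd.
  apply: aeW => x; rewrite /=.
  apply: cvg_near_cst; near=> N.
  have N0 : (0 < N)%N by near: N; exact: nbhs_infty_ge.
  rewrite /poly_mean (eq_bigr (fun=> F [tuple])) => [|n _]; last by rewrite [LHS](congr1 F (tuple0 _)).
  by rewrite sumr_const card_ord -[X in _ * X]mulr_natl mulKf // pnatr_eq0 -lt0n.
have ae1 : {ae P, forall x, poly_mean (center_last mu F) N x @[N --> \oo] --> 0}.
  apply: (centered_strong_law (K := K + peel_const mu K iota)).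
  - by rewrite addr_ge0 // peel_const_ge0.
  - exact: (regular_center_last K0 iota0 kappa0 iv mu_v reg).
  - exact: (center_last_centered K0 iota0 kappa0 iv mu_v reg).
  - exact: c0.
  - move=> i il; have li : l <> i by move=> e; rewrite e ltnn in il.
    exact: (cd l i (ltnSn l) (ltnW il) li).
have ae2 := IH (integrate_last mu F) (peel_const mu K iota) (peel_const_ge0 _ _ K0)
  (regular_integrate_last K0 iota0 kappa0 iv mu_v reg)
  (fun i il => c0 i (ltnW il)) (fun i j il jl => cd i j (ltnW il) (ltnW jl)).
apply: filterS2 ae1 ae2 => x h1 h2.
rewrite iter_integral_rcons -[iter_integral _ _]add0r.
rewrite (_ : poly_mean F ^~ x = fun N => poly_mean (center_last mu F) N x + poly_mean (integrate_last mu F) N x).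
  exact: cvgD h1 h2.
apply/funext => N; rewrite /poly_mean -mulrDr -big_split; congr (_ * _); apply: eq_bigr => n _ /=.
rewrite /center_last (_ : front _ = [tuple xi (beval D (c i) n.+1 N) x | i < l]) ?subrK //.
by apply: eq_from_tnth => i; rewrite !tnth_mktuple.
Unshelve. all: by end_near.
Qed.

End StrongLaw.
Theorem mainTheorem1
  (R : realType) (d : measure_display) (T : measurableType d)
  (P : probability T R) (p : nat) (xi : nat -> T -> p.-tuple R)
  (Fam : \bar int -> \bar int -> set (set T))
  (mu : probability (p.-tuple R) R)
  (l : nat) (F : l.-tuple (p.-tuple R) -> R)
  (K iota kappa : R)
  (D : nat) (c : nat -> nat -> nat -> nat)
  (w q v : R) :
  (0 < p)%N ->
  (* random vectors *)
  (forall n, measurable_fun [set: T] (xi n)) ->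
  (* filtration-like family of sub-sigma-algebras F_{k,l} *)
  (forall k m, (k <= m)%E -> sigma_algebra [set: T] (Fam k m) /\
                             Fam k m `<=` measurable) ->
  (forall k m k' m', (k <= m)%E -> (k' <= k)%E -> (m <= m')%E ->
     Fam k m `<=` Fam k' m') ->
  (* stationarity *)
  (forall n (A : set (p.-tuple R)), measurable A -> P (xi n @^-1` A) = mu A) ->
  (forall n m n' m', (m%:Z - n%:Z = m'%:Z - n'%:Z)%R ->
     forall A : set (p.-tuple R * p.-tuple R), measurable A ->
       P ((fun x => (xi n x, xi m x)) @^-1` A) =
       P ((fun x => (xi n' x, xi m' x)) @^-1` A)) ->
  (* regularity of F *)
  0 < K -> 0 <= iota -> 0 < kappa -> kappa <= 1 ->
  (forall x z : l.-tuple (p.-tuple R),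
     `| F x - F z | <= K * (1 + \sum_(i < l) (vnorm (tnth x i) `^ iota + vnorm (tnth z i) `^ iota))
                         * \sum_(i < l) (vdist (tnth x i) (tnth z i)) `^ kappa) ->
  (forall x : l.-tuple (p.-tuple R),
     `| F x | <= K * (1 + \sum_(i < l) vnorm (tnth x i) `^ iota)) ->
  (* moment assumption (M) *)
  4 < w -> 1 <= q -> 0 < v -> iota / v + kappa / q < w^-1 ->
  (Lnorm P v%:E (fun x => (vnorm (xi 0%N x))%:E) < +oo)%E ->
  (Lnorm P w%:E (fun x => (vnorm (xi 0%N x))%:E) < +oo)%E ->
  (Lnorm P q%:E (fun x => (vnorm (xi 0%N x))%:E) < +oo)%E ->
  (* polynomials q_1, ..., q_l (indexed 0 .. l-1) *)
  (forall i, bsupp D (c i)) ->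
  (forall i, (i < l)%N -> exists a b, (0 < a)%N /\ c i a b <> 0%N) ->
  (forall i, (i.+1 < l)%N -> (bdeg D (c i) <= bdeg D (c i.+1))%N) ->
  (forall i j, (i < l)%N -> (j < l)%N -> i <> j ->
     exists a b, (0 < a + b)%N /\ c i a b <> c j a b) ->
  (forall i, (i < l)%N -> bdeg D (c i) = 1%N ->
     exists ai bi : int, forall n N, (beval D (c i) n N)%:Z = ai * n%:Z + bi * N%:Z) ->
  (* mixing condition *)
  (\sum_(1 <= k <oo) ((k%:R)%:E * ((phi_mix P Fam k `^ (1 - 4 / w))%:E
                                   + (beta_q P Fam xi q k) `^ kappa)) < +oo)%E ->
  {ae P, forall x,
    (fun N : nat => N%:R^-1 *
       \sum_(1 <= n < N.+1) F [tuple xi (beval D (c i) n N) x | i < l])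
    @ \oo --> iter_integral mu F}.
Proof.
move=> p0 xi_meas Fam_sigma Fam_mono xi_law _ K0 iota0 kappa0 kappa1 hF gF w4 q1 v0 wvq
  Lv _ Lq c_supp c_dep _ c_diff _ mix.
have q0 : 0 < q by exact: lt_le_trans q1.
have vn_meas : measurable_fun setT (fun x => vnorm (xi 0%N x)) by exact: measurable_vnorm.
have mu_int r : 0 < r -> (Lnorm P r%:E (fun x => (vnorm (xi 0%N x))%:E) < +oo)%E ->
    mu.-integrable setT (EFin \o (fun y => vnorm y `^ r)).
  move=> r0 Lr; have law A : measurable A -> P (xi 0%N @^-1` A) = mu A by exact: xi_law.
  apply: (integrable_transfer (xi_meas 0%N) law (measurable_vnorm_powR r)).1.
  by apply: Lnorm_lty_integrable => // x; exact: vnorm_ge0.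
have dev0 k r : (0 <= cond_dev P Fam xi q k r)%E.
  by apply: le_ereal_inf_tmp => _ [Y _ <-]; exact: Lnorm_ge0.
have dev_beta k r : (cond_dev P Fam xi q k r <= beta_q P Fam xi q r)%E.
  by apply: ereal_sup_ubound; exists k.
have beta0 r : (0 <= beta_q P Fam xi q r)%E by exact: le_trans (dev_beta 0%N r).
pose u (k : nat) := ((k%:R)%:E * ((phi_mix P Fam k `^ (1 - 4 / w))%:E
                                   + (beta_q P Fam xi q k) `^ kappa))%E.
have u0 k : (0 <= u k)%E by rewrite mule_ge0 ?adde_ge0 ?poweR_ge0 ?lee_fin ?powR_ge0.
have u_le n : (\sum_(1 <= k < n) u k <= \sum_(1 <= k <oo) u k)%E.
  by apply: nneseries_lim_ge => k _.
have u_fin k : (0 < k)%N -> (u k < +oo)%E.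
  move=> k0; apply: le_lt_trans mix; apply: le_trans (u_le k.+1).
  by rewrite big_nat_recr //= leeDr // sume_ge0.
(* An infinite coefficient would make the [k]-th term of the series infinite, since its factor [k]
   is positive; so finiteness is obtained from rank 1 on. *)
have beta_fin k : (0 < k)%N -> (beta_q P Fam xi q k = (fine (beta_q P Fam xi q k))%:E)%E.
  move=> k0; rewrite fineK // ge0_fin_numE // ltNge leye_eq; apply/negP => /eqP e.
  have := u_fin _ k0; rewrite /u e poweRyr ?gt_eqF // addey //.
  by rewrite gt0_muley ?ltxx // lte_fin ltr0n.
pose S := fine (\sum_(1 <= k <oo) u k).
have sum_eps n : \sum_(1 <= r < n) r%:R * (phi_mix P Fam r `^ (1 - 4 / w)
    + fine (beta_q P Fam xi q r) `^ kappa) <= S.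
  rewrite -lee_fin /S fineK; last first.
    by rewrite ge0_fin_numE //; apply: nneseries_ge0 => k _ _; exact: u0.
  apply: le_trans (u_le n); rewrite -sumEFin big_nat [leRHS]big_nat.
  apply: lee_sum => k /andP[k1 _].
  by rewrite /u [in leRHS](beta_fin k k1).
have beta_dev r k : (0 < r)%N -> (cond_dev P Fam xi q k r <= (fine (beta_q P Fam xi q r))%:E)%E.
  by move=> r0; rewrite -beta_fin.
have reg : regular F K iota kappa by split.
have := @poly_strong_law R d T P p xi Fam mu xi_meas Fam_sigma Fam_mono xi_law iota kappa w q v
  iota0 kappa0 q1 w4 v0 wvq (mu_int v v0 Lv) (mu_int q q0 Lq)
  (fun r => fine (beta_q P Fam xi q r)) S (fun r => fine_ge0 (beta0 r)) beta_dev sum_eps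
  D c c_supp l F K (ltW K0) reg c_dep c_diff.
apply: filterS => x.
rewrite (_ : (fun N : nat => N%:R^-1 * _) = fun N => poly_mean xi D c F N x) //.
by apply/funext => N; rewrite /poly_mean big_add1 big_mkord.
Qed.
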